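(* Let $\alpha\ge 0$ and let $\nu$ satisfy the Malthusian Hypotheses and the non-explosion assumption (see context). Then the process $\mathbf{X}=(\mathbf{X}(t),t\ge 0)$, $\mathbf{X}(t)=\sum_{u\in\mathcal{U}}\mathbf{1}_{\{t\in I_u\}}\delta_{\xi_u}$, takes its values (almost surely) in the set $\mathcal{M}_p(\mathbb{R}_+^* )$ of finite point measures on $(0,\infty)$. It is a branching Markov chain; more precisely, for all $t,r\ge 0$, the conditional distribution of $\mathbf{X}(t+r)$ given that $\mathbf{X}(r)=\mathbf{s}=\sum_{i}\delta_{s_i}$ is the same as that of the sum $\sum_i\mathbf{X}^{(i)}(t)$, where for each index $i$, $\mathbf{X}^{(i)}(t)$ is distributed as $\mathbf{X}(t)$ under $\mathbb{P}_{s_i}$ and the variables $\mathbf{X}^{(i)}(t)$ are independent. The process $\mathbf{X}$ also has the scaling property: for every $c>0$, the distribution of the rescaled process $(c\,\mathbf{X}(c^{\alpha}t),t\ge 0)$ under $\mathbb{P}_1$ is $\mathbb{P}_c$, where for $\mathbf{s}=\sum_i\delta_{s_i}$ one writes $c\,\mathbf{s}:=\sum_i\delta_{c s_i}$.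
   Context: **Point measures.** $\mathcal{M}_p(\mathbb{R}_+^* )$ is the space of finite point measures $\mathbf{s}=\sum_{i=1}^{n}\delta_{s_i}$ on $\mathbb{R}_+^*=(0,\infty)$ ($n\ge 0$ an arbitrary integer), with the topology of weak convergence; $\sharp\mathbf{s}=n$ is the number of atoms. For measurable $f$, $\langle f,\mathbf{s}\rangle=\langle f(x),\mathbf{s}\rangle:=\sum_{i=1}^{\sharp\mathbf{s}}f(s_i)$ (atoms repeated according to multiplicity). A point measure is identified with the infinite sequence $(s_1,\dots,s_n,0,0,\dots)$; a random infinite sequence $(\xi_i)_{i\in\mathbb{N}}$ has law $\nu$ if there is a random index $n$ with $\xi_i=0\Leftrightarrow i>n$ and $\sum_{i=1}^n\delta_{\xi_i}$ has law $\nu$. **Marked tree.** Fix $\alpha\ge 0$ and a probability measure $\nu$ on $\mathcal{M}_p(\mathbb{R}_+^* )$. Let $\mathbb{N}=\{1,2,\dots\}$, $\mathcal{U}=\bigcup_{n\ge 0}\mathbb{N}^n$ with $\mathbb{N}^0=\{\emptyset\}$; $|u|=n$ if $u\in\mathbb{N}^n$; $ui$ is the $i$-th child of $u$. Let $(\overline{\xi}_u)_{u\in\mathcal{U}}$, $\overline{\xi}_u=(\widetilde{\xi}_{ui})_{i\in\mathbb{N}}$, be i.i.d. sequences with law $\nu$, and, independently, let $(\mathbf{e}_u)_{u\in\mathcal{U}}$ be i.i.d. exponential variables of parameter $1$. For $x>0$ set $\xi_\emptyset=x$, $a_\emptyset=0$, $\zeta_\emptyset=x^{-\alpha}\mathbf{e}_\emptyset$,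 and recursively $\xi_{ui}=\widetilde{\xi}_{ui}\xi_u$ (size), $a_{ui}=a_u+\zeta_u$ (birth time), $\zeta_{ui}=\xi_{ui}^{-\alpha}\mathbf{e}_{ui}$ (lifetime). **The process.** If $\xi_u>0$ let $I_u:=[a_u,a_u+\zeta_u)$; if $\xi_u=0$ let $I_u:=\emptyset$. Set $\mathbf{X}(t)=\sum_{u\in\mathcal{U}}\mathbf{1}_{\{t\in I_u\}}\delta_{\xi_u}$, $t\ge 0$. $\mathbb{P}_x$ denotes the law of the process started from a single individual of size $x$ (root of size $x$). **Malthusian Hypotheses.** Let $\underline{p}:=\inf\{p\in\mathbb{R}:\int\langle x^p,\mathbf{s}\rangle\,\nu(d\mathbf{s})<\infty\}$, $p_\infty:=\inf\{p>\underline{p}:\int\langle x^p,\mathbf{s}\rangle\,\nu(d\mathbf{s})=\infty\}$ (with $\inf\emptyset=\infty$), and $\kappa(p):=\int(1-\langle x^p,\mathbf{s}\rangle)\,\nu(d\mathbf{s})$ for $p\in(\underline{p},p_\infty)$. The hypotheses are: the equation $\kappa(p)=0$ has a solution in $(\underline{p},p_\infty)$, and $p_0:=\inf\{p\in(\underline{p},p_\infty):\kappa(p)=0\}$ satisfies $p_0>0$; $\kappa(p)>0$ for some $p>p_0$ (with $p<p_\infty$); and $\int(\langle x^{p_0},\mathbf{s}\rangle)^p\,\nu(d\mathbf{s})<\infty$ for some $p>1$. **Non-explosion assumption.** Let $F(u):=\int u^{\sharp\mathbf{s}}\,\nu(d\mathbf{s})$. (Under the Malthusian Hypotheses $F(u)<u$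 for $u<1$ close enough to $1$.) Assume $\int_{1-\epsilon}^1\frac{du}{u-F(u)}=\infty$ for every sufficiently small $\epsilon>0$ (small enough that $F(u)<u$ on $(1-\epsilon,1)$). *)

(* Defs.v *)
From HB Require Import structures.
From mathcomp Require Import all_boot all_order all_algebra.
From mathcomp Require Import finmap.
From mathcomp Require Import all_classical all_reals all_analysis.
From mathcomp Require Import measurable_realfun.

Set Implicit Arguments.
Unset Strict Implicit.
Unset Printing Implicit Defensive.

Import Order.TTheory GRing.Theory Num.Theory.
Import numFieldNormedType.Exports.

Local Open Scope classical_set_scope.
Local Open Scope ring_scope.

(** ** Finite point measures on (0, +oo) *)

(* Measures on (0, +oo) are seen as measures on R carried by (0, +oo).  The
   equation below is required of all sets, not only of the measurable ones, so
   that a point measure is determined by its values on Borel sets. *)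
Record point_measure (R : realType) := PointMeasure {
  pm_measure :> {measure set R -> \bar R};
  pm_atomsP : exists s : seq R, all (fun a => 0 < a) s /\
    forall A : set R, pm_measure A = (\sum_(a <- s) \d_a A)%E }.

Section point_measure.
Context {R : realType}.
Implicit Types (s : point_measure R) (l : seq R).

(* An enumeration of the atoms of s, repeated according to multiplicity; every
   notion below that uses it is independent of the order of enumeration. *)
Definition atoms s : seq R := sval (cid (pm_atomsP s)).

Lemma atoms_gt0 s : all (fun a => 0 < a) (atoms s).
Proof. by rewrite /atoms; case: cid => l []. Qed.

Lemma pmE s (A : set R) : s A = (\sum_(a <- atoms s) \d_a A)%E.
Proof. by rewrite /atoms; case: cid => l []. Qed.

Definition natoms s : nat := size (atoms s).

Definition pm_int (f : R -> R) s : R := \sum_(a <- atoms s) f a.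

Let dirac_sum_seq l :
  exists l' : seq R, all (fun a => 0 < a) l' /\
    forall A : set R,
      msum (fun i => [the {measure set R -> \bar R} of \d_([seq a <- l | 0 < a]`_i)])
           (size [seq a <- l | 0 < a]) A = (\sum_(a <- l') \d_a A)%E.
Proof.
exists [seq a <- l | 0 < a]; split; first exact: filter_all.
by move=> A; rewrite /msum (big_nth 0) big_mkord.
Qed.

(* The sum of the Dirac masses at the positive entries of l. *)
Definition pm_of_seq l : point_measure R := PointMeasure (dirac_sum_seq l).

Lemma pm_of_seqE l (A : set R) :
  pm_of_seq l A = (\sum_(a <- l | (0 < a)%R) \d_a A)%E.
Proof. by rewrite /= /msum -big_filter (big_nth 0) big_mkord. Qed.

Definition pm_sum (ss : seq (point_measure R)) : point_measure R :=
  pm_of_seq (flatten (map atoms ss)).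

Lemma pm_sumE (ss : seq (point_measure R)) (A : set R) :
  pm_sum ss A = (\sum_(s <- ss) s A)%E.
Proof.
rewrite pm_of_seqE -big_filter; under [RHS]eq_bigr do rewrite pmE.
rewrite (_ : [seq _ <- _ | _] = flatten (map atoms ss)).
  by rewrite big_flatten big_map.
apply/all_filterP; elim: ss => //= s ss IH.
by rewrite all_cat atoms_gt0.
Qed.

Definition pm_scale (c : R) s : point_measure R :=
  pm_of_seq [seq c * a | a <- atoms s].

Lemma pm_scaleE (c : R) s (A : set R) : 0 < c ->
  pm_scale c s A = s ((fun a => c * a) @^-1` A).
Proof.
move=> c0; rewrite pm_of_seqE pmE big_map big_seq_cond [RHS]big_seq.
apply: eq_big => [a|a _].
  by apply/andb_idr => /(allP (atoms_gt0 s)); exact: mulr_gt0.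
by rewrite !diracE.
Qed.

End point_measure.

HB.instance Definition _ (R : realType) := gen_eqMixin (point_measure R).
HB.instance Definition _ (R : realType) := gen_choiceMixin (point_measure R).
HB.instance Definition _ (R : realType) :=
  isPointed.Build (point_measure R) (pm_of_seq [::]).

Definition bounded_continuous_on_pos (R : realType) (f : R -> R) : Prop :=
  {within `]0, +oo[, continuous f} /\
  exists M : R, forall x, 0 < x -> `|f x| <= M.

(* Topology of weak convergence: the coarsest one for which s |-> <f, s> is
   continuous for all f bounded and continuous on (0, +oo). *)
HB.instance Definition _ (R : realType) :=
  Topological.copy (point_measure R)
    (sup_topology (fun f : {f : R -> R | bounded_continuous_on_pos f} =>
       Topological.class (initial_topology (@pm_int R (sval f))))).

HB.instance Definition _ (R : realType) :=
  Measurable.copy (point_measure R)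
    (g_sigma_algebraType (@open (point_measure R))).

(* The point measure equal to m, if there is one; the null measure otherwise. *)
Definition to_point_measure (R : realType) (m : set R -> \bar R) :
    point_measure R :=
  get [set s : point_measure R | forall A, m A = s A].

Definition is_point_measure (R : realType) (m : set R -> \bar R) : Prop :=
  exists s : point_measure R, forall A, m A = s A.

(** ** Sigma-algebras and independence *)

Definition sigma_of (Omega I : Type) d (T : measurableType d) (D : set I)
    (Y : I -> Omega -> T) : set_system Omega :=
  <<s \bigcup_(i in D) preimage_set_system [set: Omega] (Y i) measurable >>.

Definition independent (R : realType) d (T : measurableType d)
    (P : probability T R) (I : choiceType) (G : I -> set_system T) : Prop :=
  forall (J : {fset I}) (A : I -> set T),
    (forall i, i \in J -> G i (A i)) ->
    P (\bigcap_(i in [set` J]) A i) = (\prod_(i <- J) fine (P (A i)))%:E.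

(* K is a regular version of the conditional distribution of Y given G. *)
Definition conditional_law (R : realType) d (T : measurableType d)
    (P : probability T R) d' (T' : measurableType d') (G : set_system T)
    (Y : T -> T') (K : T -> set T' -> \bar R) : Prop :=
  forall B : set T', measurable B ->
    g_sigma_algebra_preimage (K ^~ B) `<=` G /\
    forall A : set T, G A -> P (A `&` Y @^-1` B) = (\int[P]_(w in A) K w B)%E.

Definition indep_sum_law (R : realType) (n : nat)
    (mu : 'I_n -> set (point_measure R) -> \bar R)
    (K : set (point_measure R) -> \bar R) : Prop :=
  exists (d : measure_display) (T : measurableType d) (P : probability T R)
      (Y : 'I_n -> {RV P >-> point_measure R}),
    [/\ independent P
          (fun i => g_sigma_algebra_preimage (Y i)),
        forall i B, measurable B -> distribution P (Y i) B = mu i B &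
        forall B, measurable B ->
          P ((fun w => pm_sum [seq Y i w | i <- enum 'I_n]) @^-1` B) = K B].

(** ** Assumptions on the reproduction law *)

Section reproduction_law.
Context {R : realType} (nu : probability (point_measure R) R).
Local Open Scope ereal_scope.

Definition moment (p : R) : \bar R :=
  \int[nu]_s (pm_int (fun x => x `^ p)%R s)%:E.

Definition p_low : \bar R :=
  ereal_inf [set p%:E | p in [set p : R | moment p < +oo]].

Definition p_infty : \bar R :=
  ereal_inf [set p%:E | p in [set p : R | p_low < p%:E /\ moment p = +oo]].

Definition kappa (p : R) : \bar R :=
  \int[nu]_s (1 - pm_int (fun x => x `^ p)%R s)%:E.

Definition kappa_zeros : set R :=
  [set p : R | p_low < p%:E < p_infty /\ kappa p = 0].

Definition p_zero : \bar R := ereal_inf [set p%:E | p in kappa_zeros].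

(* Under the first two conditions p_zero is finite, so that fine p_zero is its
   genuine value. *)
Definition malthusian : Prop :=
  [/\ kappa_zeros !=set0,
      0 < p_zero,
      (exists p : R, [/\ p_zero < p%:E, p%:E < p_infty & 0 < kappa p]) &
      exists p : R, (1 < p)%R /\
        \int[nu]_s (pm_int (fun x => x `^ fine p_zero)%R s `^ p)%:E < +oo].

Definition offspring_gf (u : R) : R := fine (\int[nu]_s (u ^+ natoms s)%:E).

Definition non_explosion : Prop :=
  forall eps : R, (0 < eps)%R ->
    (forall u, (1 - eps < u < 1)%R -> (offspring_gf u < u)%R) ->
    \int[lebesgue_measure]_(u in `](1 - eps)%R, 1%R[)
      ((u - offspring_gf u)^-1)%:E = +oo.

End reproduction_law.

(** ** The marked tree *)

(* An individual is a finite word of naturals, stored with its last letter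
   first: [::] is the root, and i :: u is the child of u of rank i (ranks start
   at 0).  The mark xi u i is the ratio of the size of i :: u to that of u. *)

Definition has_sequence_law (R : realType) d (T : measurableType d)
    (P : probability T R) (nu : probability (point_measure R) R)
    (Z : nat -> T -> R) : Prop :=
  exists n : T -> nat,
    [/\ measurable_fun [set: T] n,
        forall w i, (i < n w)%N -> 0 < Z i w,
        forall w i, (n w <= i)%N -> Z i w = 0 &
        forall B, measurable B ->
          P ((fun w => pm_of_seq [seq Z i w | i <- iota 0 (n w)]) @^-1` B)
          = nu B].

Definition marks (R : realType) d (T : measurableType d) (P : probability T R)
    (nu : probability (point_measure R) R)
    (xi : seq nat -> nat -> {RV P >-> R}) (e : seq nat -> {RV P >-> R}) : Prop :=
  [/\ (forall u, has_sequence_law P nu (xi u)) /\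
      (forall u v B,
         sigma_of [set: nat] (fun i (z : nat -> R) => z i) B ->
         P ((fun w => xi u ^~ w) @^-1` B) = P ((fun w => xi v ^~ w) @^-1` B)),
      independent P (fun u => sigma_of [set: nat] (xi u)),
      forall u B, measurable B -> distribution P (e u) B = exponential_prob 1 B,
      independent P
        (fun u => g_sigma_algebra_preimage (e u)) &
      forall A B,
        sigma_of [set: seq nat * nat] (fun ui => xi ui.1 ui.2) A ->
        sigma_of [set: seq nat] e B -> P (A `&` B) = (P A * P B)%E].

(** ** The process *)

Section process.
Context {R : realType}.

Section realization.
Variables (alpha x : R) (xi : seq nat -> nat -> R) (e : seq nat -> R).

Fixpoint isize (u : seq nat) : R :=
  if u is i :: v then xi v i * isize v else x.

Definition lifetime (u : seq nat) : R := isize u `^ (- alpha) * e u.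

Fixpoint birth (u : seq nat) : R :=
  if u is _ :: v then birth v + lifetime v else 0.

Definition life_interval (u : seq nat) : set R :=
  if 0 < isize u then `[birth u, birth u + lifetime u[%classic else set0.

Definition population (t : R) (A : set R) : \bar R :=
  (\esum_(u in [set u | life_interval u t]) \d_(isize u) A)%E.

End realization.

Context d (T : measurableType d) (P : probability T R).
Variables (alpha : R) (xi : seq nat -> nat -> {RV P >-> R})
  (e : seq nat -> {RV P >-> R}).

Definition X_measure (x t : R) (w : T) : set R -> \bar R :=
  population alpha x (fun u i => xi u i w) (fun u => e u w) t.

(* P_x is the law of X x under P: only the size of the root depends on x. *)
Definition X (x t : R) (w : T) : point_measure R :=
  to_point_measure (X_measure x t w).

Definition finite_valued : Prop :=
  forall x : R, 0 < x ->
    {ae P, forall w, forall t : R, 0 <= t -> is_point_measure (X_measure x t w)} /\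
    forall t : R, 0 <= t -> measurable_fun [set: T] (X x t).

(* Besides the conditional distribution given X(r), the Markov property is
   stated with respect to the natural filtration of the process. *)
Definition branching_markov : Prop :=
  forall t : R, 0 <= t ->
  exists Q : R.-pker (point_measure R) ~> (point_measure R),
    (forall l : seq R, all (fun a => 0 < a) l ->
       indep_sum_law (fun (i : 'I_(size l)) B => P (X l`_i t @^-1` B))
         (Q (pm_of_seq l))) /\
    forall x r : R, 0 < x -> 0 <= r ->
      conditional_law P
        (g_sigma_algebra_preimage (X x r))
        (X x (t + r)) (fun w => Q (X x r w)) /\
      conditional_law P
        (sigma_of [set q : R | 0 <= q <= r] (X x))
        (X x (t + r)) (fun w => Q (X x r w)).

(* Laws of processes are compared on the sigma-algebra generated by the
   coordinates of nonnegative index. *)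
Definition scaling : Prop :=
  forall c : R, 0 < c ->
  forall B : set (R -> point_measure R),
    sigma_of [set t : R | 0 <= t] (fun t (f : R -> point_measure R) => f t) B ->
    P ((fun w t => pm_scale c (X 1 (c `^ alpha * t) w)) @^-1` B)
    = P ((fun w t => X c t w) @^-1` B).

End process.

(* Main.v *)
Require Import Defs.
From HB Require Import structures.
From mathcomp Require Import all_boot all_order all_algebra.
From mathcomp Require Import finmap.
From mathcomp Require Import all_classical all_reals all_analysis.
From mathcomp Require Import measurable_realfun.
From mathcomp Require Import lra ring.

Set Implicit Arguments.
Unset Strict Implicit.
Unset Printing Implicit Defensive.

Import Order.TTheory GRing.Theory Num.Theory.
Import numFieldNormedType.Exports.

Local Open Scope classical_set_scope.
Local Open Scope ring_scope.

(** The marks and the clocks of the tree form a family of independent variables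
    indexed by the individuals (tree_law_product).  Everything is proved on the
    product space in which this family takes its values: there, subtrees can be
    exchanged, resampled and grafted by renaming coordinates.

    Finiteness.  X(t) is a finite point measure if and only if finitely many
    individuals are alive at time t.  Let p > 0 be a zero of kappa.  The p-th
    powers of the sizes of the children of an individual of size x have expected
    sum x ^ p, so a size C is ever reached with probability at most (x / C) ^ p:
    sizes are almost surely bounded (reaches_ae).  Clocks then run at bounded
    speed, and it suffices to exclude explosion when all sizes are 1.  Let q(t) be
    the probability that some generation is entirely born after time t in that
    case.  Conditioning on the ancestor and using the lack of memory of its clock
    gives q' >= F(q) - q, where F is the generating function of the number of
    children; as the integral of 1 / (u - F(u)) diverges at 1, a function that
    starts from 1 cannot leave it (no_fall).

    Markov property.  Suppose that S is the finite set of the individuals alive at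
    time r.  It is an antichain.  The past until r is a function of the tree
    outside the subtrees of S (sealed_snapshot), and the only information that it
    gives on these subtrees is that the clocks of S exceed the ages reached at
    time r (front_alive).  The population at time t + r is the sum of those
    descending from the elements of S (snapshot_add).  By the lack of memory, the
    subtrees of S with their residual clocks are independent copies of the tree
    (survivors_law), so that, given the past, X(t + r) has the law of the
    population at time t of a forest whose roots have the sizes of the elements of
    S.  Summing over the countably many finite sets S yields tree_markov.  The law
    of a forest does not depend on the order of its trees (forest_law_perm); it is
    a measurable function of the point measure of the sizes of the roots, because
    the Borel sigma-algebra for weak convergence is generated by the counts on
    intervals (measurable_pm_fun), for which the decreasing enumeration of the
    atoms is measurable.

    Scaling holds for each sample: a root c times larger makes all sizes c times
    larger and all lifetimes c ^ alpha times shorter (snapshot_scale). *)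

(** * The Borel sigma-algebra of point measures *)

Lemma measurable_preimage d d' (T : measurableType d) (T' : measurableType d')
    (f : T -> T') (B : set T') :
  measurable_fun setT f -> measurable B -> measurable (f @^-1` B).
Proof. by move=> mf mB; rewrite -[X in measurable X]setTI; exact: mf. Qed.

Section point_measures.
Context {R : realType}.
Implicit Types (s : point_measure R) (l : seq R).

Lemma pm_ext s s' : (forall A, s A = s' A) -> s = s'.
Proof.
case: s s' => [m p] [m' p'] /= mm'.
suff E : m = m' by subst m'; congr PointMeasure; exact: Prop_irrelevance.
by apply/eq_measure/funext.
Qed.

Lemma sum_dirac_count l (A : set R) :
  (\sum_(a <- l) \d_a A)%E = (count (fun a => a \in A) l)%:R%:E :> \bar R.
Proof.
elim: l => [|a l IH]; first by rewrite big_nil.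
by rewrite big_cons IH diracE /= natrD -EFinD.
Qed.

Lemma pm_count s (A : set R) : s A = (count (fun a => a \in A) (atoms s))%:R%:E.
Proof. by rewrite pmE sum_dirac_count. Qed.

Lemma pm_of_seq_pos l (A : set R) : all (fun a => 0 < a) l ->
  pm_of_seq l A = (count (fun a => a \in A) l)%:R%:E.
Proof. by move=> /all_filterP l0; rewrite pm_of_seqE -big_filter sum_dirac_count l0. Qed.

Lemma pm_setT s : s setT = (natoms s)%:R%:E.
Proof.
rewrite pm_count (@eq_count _ _ predT) ?count_predT// => a.
by rewrite in_setT.
Qed.

Lemma perm_atoms_of_seq l : all (fun a => 0 < a) l ->
  perm_eq (atoms (pm_of_seq l)) l.
Proof.
move=> l0; apply/allP => a _ /=.
have := pm_of_seq_pos [set a] l0; rewrite pm_count => -[] /eqP.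
rewrite eqr_nat => /eqP E; apply/eqP.
have Ea b : (b \in [set a]) = (b == a) by apply/idP/eqP; rewrite inE.
by rewrite -!(eq_count Ea).
Qed.

Lemma pm_int_of_seq (f : R -> R) l : all (fun a => 0 < a) l ->
  pm_int f (pm_of_seq l) = \sum_(a <- l) f a.
Proof. by move=> l0; apply: perm_big; exact: perm_atoms_of_seq. Qed.

Lemma natoms_of_seq l : all (fun a => 0 < a) l ->
  natoms (pm_of_seq l) = size l.
Proof. by move=> l0; apply: perm_size; exact: perm_atoms_of_seq. Qed.

Lemma uniform_radius (T : eqType) (P : T -> R -> Prop) (L : seq T) :
  (forall x, x \in L ->
     exists2 r, 0 < r & forall r', 0 < r' -> r' <= r -> P x r') ->
  exists2 r, 0 < r & forall x, x \in L -> P x r.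
Proof.
move=> H; suff [r r0 Hr] : exists2 r, 0 < r &
    forall x, x \in L -> forall r', 0 < r' -> r' <= r -> P x r'.
  by exists r => // x xL; exact: Hr.
elim: L H => [_|y L IH H]; first by exists 1.
have [r1 r10 H1] := H y (mem_head _ _).
have [|r2 r20 H2] := IH; first by move=> x xL; apply: H; rewrite inE xL orbT.
exists (Num.min r1 r2); first by rewrite lt_min r10.
move=> x; rewrite inE => /orP[/eqP->|xL] r' r'0; rewrite le_min => /andP[a b].
  exact: H1.
exact: H2.
Qed.

(** Rational endpoints make the boxes countable in number.  The number of atoms
    is prescribed as well, for the intervals alone would not see an atom that
    lies outside of all of them. *)
Definition pm_box (n : nat) (k : seq (rat * rat * nat)) : set (point_measure R) :=
  [set s | natoms s = n /\ forall p, p \in k ->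
     s `]ratr p.1.1, ratr p.1.2[%classic = p.2%:R%:E].

(** Take rational intervals around the atoms of s, disjoint for distinct atoms
    and so short that f varies little on each of them.  A point measure with
    the same number of atoms and the same counts on these intervals has its
    atoms matched with those of s within them, so that its integral of f is
    close to that of s. *)
Lemma pm_box_int (f : R -> R) (U : set R) s : bounded_continuous_on_pos f ->
  open U -> U (pm_int f s) ->
  exists k, pm_box (natoms s) k s /\ pm_box (natoms s) k `<=` pm_int f @^-1` U.
Proof.
move=> [cf _] oU Us; set l := atoms s; set n := natoms s.
have l0 a : a \in l -> 0 < a by move: a; apply/allP; exact: atoms_gt0.
have [d d0 dU] : exists2 d, 0 < d & forall y, `|pm_int f s - y| < d -> U y.
  move: oU; rewrite openE => /(_ _ Us)/nbhs_ballP[d /= d0 dU].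
  by exists d => // y yd; apply: dU.
(* n.+1 rather than n: s may be null *)
pose e := d / n.+1%:R.
have e0 : 0 < e by rewrite divr_gt0.
pose P (p : R * R) (r : R) := (`|p.1 - p.2| < r + r -> p.1 = p.2) /\
   (forall y, 0 < y -> `|p.1 - y| < r -> `|f p.1 - f y| < e).
have [r r0 Hr] : exists2 r, 0 < r & forall p, p \in [seq (a, b) | a <- l, b <- l] -> P p r.
  apply: uniform_radius => -[a b] /allpairsP[[a' b'] /= [al bl [-> ->]]].
  have [r1 r10 H1] : exists2 r, 0 < r & forall r', 0 < r' -> r' <= r ->
      (`|a' - b'| < r' + r' -> a' = b').
    have [->|ab] := eqVneq a' b'; first by exists 1.
    have ab0 : 0 < `|a' - b'| by rewrite normr_gt0 subr_eq0.
    exists (`|a' - b'| / 2); first by rewrite divr_gt0.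
    by move=> r' _ rr; move=> h; exfalso; lra.
  have [r2 r20 H2] : exists2 r, 0 < r & forall r', 0 < r' -> r' <= r ->
      (forall y, 0 < y -> `|a' - y| < r' -> `|f a' - f y| < e).
    have a0 := l0 _ al.
    have /continuous_within_itvcyP : {within `[a'/2, +oo[, continuous f}.
      apply: continuous_subspaceW cf => x /=; rewrite !in_itv/= !andbT; lra.
    move=> [/(_ a')]; rewrite in_itv/= andbT ltr_pdivrMr// ltr_pMr// ltr1n => /(_ isT).
    move=> /cvgrPdist_lt/(_ _ e0)/nbhs_ballP[r2 /= r20 H2] _.
    exists r2 => // r' _ rr y y0 ay; apply: H2.
    by rewrite /ball/=; lra.
  exists (Num.min r1 r2); first by rewrite lt_min r10.
  move=> r' r'0; rewrite le_min => /andP[ra rb]; split; first exact: H1.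
  exact: H2.
have HP a b : a \in l -> b \in l -> P (a, b) r.
  by move=> al bl; apply: Hr; apply/allpairsP; exists (a, b).
have /choice[p Hp] : forall a, exists p : rat, ratr p \in `]a - r, a[.
  by move=> a; apply: rat_in_itvoo; rewrite ltrBlDr ltrDl.
have /choice[q Hq] : forall a, exists p : rat, ratr p \in `]a, a + r[.
  by move=> a; apply: rat_in_itvoo; rewrite ltrDl.
pose V a := `]ratr (p a), ratr (q a) : R[%classic.
have Vr a y : y \in V a -> `|a - y| < r.
  rewrite inE /V/= in_itv/= => /andP[ay ya].
  move: (Hp a) (Hq a); rewrite !in_itv/= => /andP[h1 h2] /andP[h3 h4].
  by rewrite ltr_norml; apply/andP; split; lra.
have VV a : a \in V a.
  move: (Hp a) (Hq a); rewrite !in_itv/= => /andP[h1 h2] /andP[h3 h4].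
  by rewrite inE /V/= in_itv/= h2 h3.
have Vinj a b y : a \in l -> b \in l -> y \in V a -> y \in V b -> a = b.
  move=> al bl /Vr ya /Vr yb; apply: (HP _ _ al bl).1.
  rewrite /= -[a - b](subrKA y) (le_lt_trans (ler_normD _ _))// ltrD//.
  by rewrite distrC.
pose m a := count_mem a l.
exists [seq (p a, q a, m a) | a <- l]; split.
  split=> // _ /mapP[a al ->] /=; rewrite pm_count; congr (_%:R%:E).
  apply: eq_in_count => b bl /=; apply/idP/eqP => [bV|->]; last exact: VV.
  by apply: (Vinj b a b) => //; exact: VV.
move=> s' [ns' Hs'] /=; apply: dU; set l' := atoms s'.
have cV a : a \in l -> count (fun y => y \in V a) l' = m a.
  move=> al; have := Hs' (p a, q a, m a) (map_f (fun a => (p a, q a, m a)) al).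
  by rewrite pm_count => -[]/eqP; rewrite eqr_nat => /eqP.
pose u := undup l.
(* every atom of s' lies in exactly one of the intervals: in at most one (c1)
   as they are disjoint, and the counts add up to the number of atoms (c2) *)
have c1 y : (\sum_(a <- u) (y \in V a)%:R <= 1 :> R)%R.
  have [[a au ya]|H] := pselect (exists2 a, a \in u & y \in V a).
    rewrite (bigD1_seq a)//= ?undup_uniq// ya big_seq_cond big1 ?addr0//.
    move=> b /andP[bu ba]; case: (boolP (y \in V b)) => //yb.
    by case/negP: ba; apply/eqP/(Vinj _ _ y) => //; rewrite -mem_undup.
  rewrite big_seq big1// => a au; case: (boolP (y \in V a)) => // ya.
  by case: H; exists a.
have szn : \sum_(a <- u) (m a)%:R = n%:R :> R.
  rewrite -natr_sum; congr (_%:R); rewrite /n/natoms -/l.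
  rewrite -[size l]sum1_size -[RHS]big_undup_iterop_count/=; apply: eq_bigr => a _.
  by rewrite /m Monoid.iteropE iter_addn_0 mul1n.
have sumc (F : R -> R) : \sum_(a <- u) \sum_(y <- l' | y \in V a) F y =
    \sum_(y <- l') F y * \sum_(a <- u) (y \in V a)%:R.
  under [RHS]eq_bigr do rewrite mulr_sumr.
  rewrite exchange_big/=; apply: eq_bigr => a _; rewrite big_mkcond/=.
  by apply: eq_bigr => y _; case: ifPn => _; rewrite ?mulr1 ?mulr0.
have c2 y : y \in l' -> \sum_(a <- u) (y \in V a)%:R = 1 :> R.
  move=> yl'; apply/eqP; rewrite -subr_eq0 -oppr_eq0 opprB; apply/eqP.
  have h0 : \sum_(y <- l') (1 - \sum_(a <- u) (y \in V a)%:R) = 0 :> R.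
    rewrite sumrB; have := sumc (fun=> 1); under [RHS]eq_bigr do rewrite mul1r.
    have -> : \sum_(y <- l') 1 = n%:R :> R.
      by rewrite -(natr_sum _ _ _ (fun=> 1%N)) sum1_size -ns'.
    move=> <-; rewrite -szn.
    apply/eqP; rewrite subr_eq0; apply/eqP; rewrite big_seq [RHS]big_seq.
    apply: eq_bigr => a; rewrite mem_undup => al.
    by rewrite -(natr_sum _ _ _ (fun=> 1%N)) sum1_count cV.
  move/eqP: h0; rewrite psumr_eq0; last by move=> z _; rewrite subr_ge0.
  by move=> /allP/(_ _ yl')/eqP.
have E' : pm_int f s' = \sum_(a <- u) \sum_(y <- l' | y \in V a) f y.
  rewrite sumc /pm_int big_seq [RHS]big_seq; apply: eq_bigr => y yl'.
  by rewrite c2// mulr1.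
have E : pm_int f s = \sum_(a <- u) \sum_(y <- l' | y \in V a) f a.
  rewrite /pm_int -/l -[LHS]big_undup_iterop_count/= big_seq [RHS]big_seq.
  apply: eq_bigr => a; rewrite mem_undup => al.
  by rewrite Monoid.iteropE big_const_seq cV.
rewrite E E' -sumrB (le_lt_trans (ler_norm_sum _ _ _))//.
apply: (@le_lt_trans _ _ (\sum_(a <- u) (m a)%:R * e)).
  rewrite big_seq [leRHS]big_seq; apply: ler_sum => a; rewrite mem_undup => al.
  rewrite -sumrB (le_trans (ler_norm_sum _ _ _))//.
  rewrite -cV// -sum1_count (natr_sum _ _ _ (fun=> 1%N)) mulr_suml big_seq_cond [leRHS]big_seq_cond.
  apply: ler_sum => y /andP[yl' ya]; rewrite mul1r ltW//.
  have := (HP _ _ al al).2 y; apply; last exact: Vr.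
  exact: (allP (atoms_gt0 s') _ yl').
by rewrite -mulr_suml szn /e mulrCA gtr_pMr// ltr_pdivrMr// mul1r ltr_nat.
Qed.

Definition boxed (O : set (point_measure R)) :=
  forall s, O s -> exists k, pm_box (natoms s) k s /\ pm_box (natoms s) k `<=` O.

(** A basic open set is a finite intersection of sets to which pm_box_int
    applies; the conditions that define the boxes are put together. *)
Lemma boxed_open (O : set (point_measure R)) : open O -> boxed O.
Proof.
move=> [B sB <-] s [C BC Cs].
have [D sD ID] := sB _ BC.
have /choice[g Hg] : forall E : set (point_measure R), exists k, E \in D ->
    pm_box (natoms s) k s /\ pm_box (natoms s) k `<=` E.
  move=> E; case: (boolP (E \in D)) => [ED|]; last by exists [::].
  have /sD := ED; rewrite inE => -[[f bf] _ [U oU UE]].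
  have [k [ks kE]] : exists k, pm_box (natoms s) k s /\
      pm_box (natoms s) k `<=` pm_int f @^-1` U.
    apply: pm_box_int => //.
    by move: Cs; rewrite -ID => /(_ E ED); rewrite -UE.
  by exists k => _; split=> //; rewrite -UE.
exists (flatten (map g (enum_fset D))); split.
  split=> // p /flatten_mapP[E ED pE].
  by have [[_ h] _] := Hg E ED; apply: h.
move=> s' [ns' Hs'].
suff Cs' : C s' by exists C.
rewrite -ID => E ED; have [_ h] := Hg E ED; apply: h; split => // p pE.
by apply: Hs'; apply/flatten_mapP; exists E.
Qed.

(** An open set is the union of the boxes that it contains, and there are
    countably many boxes: to be measurable into point measures, it suffices to
    have measurable total mass and measurable counts on intervals. *)
Lemma measurable_pm_fun d (T : measurableType d) (g : T -> point_measure R) :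
  measurable_fun setT (fun w => g w setT) ->
  (forall a b : R, measurable_fun setT (fun w => g w `]a, b[%classic)) ->
  measurable_fun setT g.
Proof.
move=> mT mab; apply: (measurability (@open (point_measure R))) => //.
move=> _ [U oU <-]; rewrite setTI.
have mbox n k : measurable (g @^-1` pm_box n k).
  rewrite (_ : _ @^-1` _ = [set w | g w setT = n%:R%:E] `&`
      \big[setI/setT]_(p <- k)
        [set w | g w `]ratr p.1.1, ratr p.1.2[%classic = p.2%:R%:E]).
    apply: measurableI.
      by have := mT measurableT [set n%:R%:E] (emeasurable_set1 _); rewrite setTI.
    apply: bigsetI_measurable => p _.
    by have := mab (ratr p.1.1) (ratr p.1.2) measurableT [set p.2%:R%:E] (emeasurable_set1 _);
      rewrite setTI.
  rewrite predeqE => w; rewrite -bigcap_seq /pm_box/=; split=> [[nw H]|[nw H]].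
    by split; [rewrite /= pm_setT nw|move=> p /= /H].
  split; first by move: nw; rewrite /= pm_setT => -[]/eqP; rewrite eqr_nat => /eqP.
  by move=> p /H.
pose F (c : nat * seq (rat * rat * nat)) :=
  if `[< pm_box c.1 c.2 `<=` U >] then g @^-1` pm_box c.1 c.2 else set0.
rewrite (_ : _ @^-1` _ = \bigcup_c F c).
  apply: countable_bigcupT_measurable => //.
  by move=> c; rewrite /F; case: ifP => _.
rewrite predeqE => w; split=> [Uw|[c _]]; last first.
  by rewrite /F; case: ifPn => // /asboolP + H; apply.
have [k [k1 k2]] := boxed_open oU Uw.
exists (natoms (g w), k) => //; rewrite /F /=.
by case: asboolP.
Qed.

End point_measures.

Section measurable_pm.
Context {R : realType}.
Implicit Types (s : point_measure R) (l : seq R).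

Lemma open_pm_int (f : R -> R) (U : set R) : bounded_continuous_on_pos f ->
  open U -> open ((pm_int f : point_measure R -> R) @^-1` U).
Proof.
move=> bf oU.
exists [set pm_int f @^-1` U]; last first.
  by rewrite predeqE => s; split=> [[_ ->]|] //; exists (pm_int f @^-1` U).
move=> _ ->; exists [fset (pm_int f @^-1` U : set (point_measure R))]%fset.
  move=> A; rewrite inE inE => /eqP ->.
  by exists (exist (@bounded_continuous_on_pos R) f bf) => //; exists U.
rewrite predeqE => s; split=> [h|Us A].
  by have := h (pm_int f @^-1` U); apply; rewrite /= inE.
by rewrite /= inE => /eqP ->.
Qed.

Lemma measurable_pm_int (f : R -> R) : bounded_continuous_on_pos f ->
  measurable_fun [set: point_measure R] (pm_int f).
Proof.
move=> bf; apply: (measurability (@RGenOpens.G R)).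
  exact: RGenOpens.measurableE.
move=> _ [_ [x [y ->]] <-]; rewrite setTI.
by apply: sub_sigma_algebra; apply: open_pm_int => //; exact: itv_open.
Qed.

(** This gives access to unbounded integrands such as powers, and to indicator
    functions. *)
Lemma measurable_pm_int_cvg (g : nat -> R -> R) (f : R -> R) :
  (forall n, bounded_continuous_on_pos (g n)) ->
  (forall x, 0 < x -> g n x @[n --> \oo] --> f x) ->
  measurable_fun [set: point_measure R] (pm_int f).
Proof.
move=> bg gf; apply: (measurable_fun_cvg (h := fun n => pm_int (g n))).
  by move=> n; exact: measurable_pm_int.
move=> s _; rewrite /pm_int; move: (atoms_gt0 s).
elim: (atoms s) => [|a l IH] /=.
  by move=> _; under eq_fun do rewrite big_nil; rewrite big_nil; exact: cvg_cst.
move=> /andP[a0 l0]; under eq_fun do rewrite big_cons; rewrite big_cons.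
by apply: cvgD; [exact: gf|exact: IH].
Qed.

(** The indicator of the set where g is positive is the limit of the functions
    min 1 (n max 0 g). *)
Lemma measurable_pm_int_pos (g : R -> R) : continuous g ->
  measurable_fun [set: point_measure R] (pm_int \1_[set x | 0 < g x]).
Proof.
move=> cg.
apply: (measurable_pm_int_cvg (g := fun n x => Num.min 1 (n%:R * Num.max 0 (g x)))).
- move=> n; split; last first.
    exists 1 => x _; rewrite ger0_norm ?ge_min ?lexx//.
    by rewrite le_min ler01 mulr_ge0// le_max lexx.
  apply: continuous_subspaceT => x; apply: (@continuous_min R R (cst 1) (fun x => n%:R * Num.max 0 (g x))).
    exact: cvg_cst.
  apply: (@continuousM R R (cst n%:R) (fun x => Num.max 0 (g x))); first exact: cvg_cst.
  by apply: (@continuous_max R R (cst 0) g); [exact: cvg_cst|exact: cg].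
- move=> x _; rewrite indicE; case: (ltP 0 (g x)) => gx.
    rewrite mem_set//=; apply: cvg_near_cst.
    near=> n; apply/eqP; rewrite (min_idPl _)//.
    by rewrite -ler_pdivrMr// mul1r; near: n; exact: nbhs_infty_ger.
  rewrite memNset//=; last by apply/negP; rewrite -leNgt.
  under eq_fun do rewrite mulr0 (min_idPr ler01).
  exact: cvg_cst.
Unshelve. all: by end_near. Qed.

Lemma pm_int_indic s (A : set R) : s A = (pm_int \1_A s)%:E.
Proof. by rewrite pmE /pm_int -sumEFin. Qed.

Lemma measurable_pm_itvoo (a b : R) :
  measurable_fun [set: point_measure R] (fun s => s `]a, b[%classic).
Proof.
rewrite (_ : (fun s => _) = EFin \o pm_int \1_[set x | 0 < Num.min (x - a) (b - x)]).
  apply/measurable_EFinP; apply: measurable_pm_int_pos => x.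
  apply: (@continuous_min R R (fun x => x - a) (fun x => b - x)).
    by apply: continuousB => //; exact: cvg_cst.
  by apply: continuousB => //; exact: cvg_cst.
apply/funext => s; rewrite pm_int_indic /=; do 3 f_equal.
by apply/seteqP; split => x /=; rewrite in_itv/= lt_min !subr_gt0.
Qed.

Lemma measurable_pm_itvoy (a : R) :
  measurable_fun [set: point_measure R] (fun s => s `]a, +oo[%classic).
Proof.
rewrite (_ : (fun s => _) = EFin \o pm_int \1_[set x | 0 < x - a]).
  apply/measurable_EFinP; apply: measurable_pm_int_pos => x.
  by apply: continuousB => //; exact: cvg_cst.
apply/funext => s; rewrite pm_int_indic /=; do 3 f_equal.
by apply/seteqP; split => x /=; rewrite in_itv/= andbT !subr_gt0.
Qed.

Lemma pm_setTE s : s setT = s `]0, +oo[%classic.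
Proof.
rewrite !pm_count; congr (_%:R%:E); apply: eq_in_count => a al.
rewrite in_setT mem_set//= in_itv/= andbT.
exact: (allP (atoms_gt0 s)).
Qed.

Lemma measurable_pm_setT : measurable_fun [set: point_measure R] (fun s => s setT).
Proof. by under eq_fun do rewrite pm_setTE; exact: measurable_pm_itvoy. Qed.

Lemma measurable_fun_natP d (T : measurableType d) (f : T -> nat) :
  (forall n, measurable (f @^-1` [set n])) -> measurable_fun setT f.
Proof.
move=> mf _ B _; rewrite setTI.
rewrite (_ : _ @^-1` _ = \bigcup_(n in B) f @^-1` [set n]).
  exact: bigcup_measurable.
apply/seteqP; split=> [x Bx|x [n Bn fx]]; first by exists (f x).
by rewrite /preimage/= fx.
Qed.

Lemma measurable_natoms : measurable_fun [set: point_measure R] (@natoms R).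
Proof.
apply: measurable_fun_natP => n.
rewrite (_ : _ @^-1` _ = (fun s => s setT) @^-1` [set n%:R%:E]).
  exact: (measurable_preimage measurable_pm_setT (emeasurable_set1 n%:R%:E)).
apply/seteqP; split => s /=; rewrite pm_setT; first by move=> ->.
by move=> -[] /eqP; rewrite eqr_nat => /eqP.
Qed.

Lemma measurable_pm_int_powR (p : R) :
  measurable_fun [set: point_measure R] (pm_int (fun x => x `^ p)).
Proof.
apply: (measurable_pm_int_cvg (g := fun n x => Num.min n%:R (x `^ p))).
- move=> n; split; last first.
    exists n%:R => x _; rewrite ger0_norm ?ge_min ?lexx//.
    by rewrite le_min ler0n powR_ge0.
  apply: continuous_in_subspaceT => x; rewrite inE/= in_itv/= andbT => x0.
  apply: (@continuous_min R R (cst n%:R) (fun x => x `^ p)); first exact: cvg_cst.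
  apply: differentiable_continuous; apply/derivable1_diffP.
  by apply: derivable_powR; rewrite in_itv/= andbT.
- move=> x _; apply: cvg_near_cst; near=> n.
  by apply/eqP; rewrite (min_idPr _)//; near: n; exact: nbhs_infty_ger.
Unshelve. all: by end_near. Qed.

(** The atoms in decreasing order, followed by zeros: sorting makes each entry
    measurable in s, which an arbitrary enumeration need not be. *)
Definition ratom s (i : nat) : R := nth 0 (sort (>=%R) (atoms s)) i.

Lemma nth_sorted_gt (a : R) l i : 0 <= a -> sorted (>=%R) l ->
  (a < nth 0 l i) = (i < count (fun x => (a < x)%R) l)%N.
Proof.
move=> a0; elim: l i => [|x l IH] i; first by rewrite nth_nil/= ltNge a0.
move=> xl; have sl := path_sorted xl.
have {}xl : all (fun y => y <= x) l.
  by move: xl => /=; rewrite path_sortedE => [/andP[]//|y z t yz zt]; exact: le_trans yz.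
case: (ltP a x) => ax.
  by case: i => [|i] /=; rewrite ax// IH.
have Ha y : y \in l -> y <= a by move=> /(allP xl)/le_trans; apply.
have -> : count (fun x => a < x) (x :: l) = 0%N.
  rewrite /= ltNge ax/= (@eq_in_count _ _ pred0) ?count_pred0// => y yl /=.
  by rewrite ltNge Ha.
rewrite ltn0 ltNge; case: i => [|i] /=; first by rewrite ax.
have [il|il] := ltnP i (size l); last by rewrite nth_default// a0.
by rewrite Ha// mem_nth.
Qed.

Lemma perm_ratom s : perm_eq [seq ratom s i | i <- iota 0 (natoms s)] (atoms s).
Proof.
rewrite /ratom /natoms -(size_sort (>=%R)) map_nth_iota0// take_size.
by rewrite perm_sort.
Qed.

Lemma ratom_gt0 s i : (i < natoms s)%N -> 0 < ratom s i.
Proof.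
move=> ns; have /perm_mem/(_ (ratom s i)) := perm_ratom s.
have -> : ratom s i \in [seq ratom s i | i <- iota 0 (natoms s)].
  by apply/map_f; rewrite mem_iota.
by move/esym => h; exact: (allP (atoms_gt0 s)).
Qed.

Lemma ratom_ge0 s i : 0 <= ratom s i.
Proof.
case: (ltnP i (natoms s)) => [/ratom_gt0/ltW//|h].
by rewrite /ratom nth_default// size_sort.
Qed.

(** For a nonnegative a, the entry of rank i exceeds a if and only if more than
    i atoms do. *)
Lemma measurable_ratom i : measurable_fun [set: point_measure R] (ratom ^~ i).
Proof.
apply: (measurability (@RGenOInfty.G R)).
  exact: RGenOInfty.measurableE.
move=> _ [_ [a ->] <-]; rewrite setTI.
have [a0|a0] := leP 0 a; last first.
  rewrite (_ : _ @^-1` _ = setT)//; apply/seteqP; split => s //= _.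
  by rewrite in_itv/= andbT (lt_le_trans a0)// ratom_ge0.
rewrite (_ : _ @^-1` _ = (fun s => s `]a, +oo[%classic) @^-1` `]i%:R%:E, +oo[).
  rewrite -[X in measurable X]setTI; apply: measurable_pm_itvoy => //.
  exact: emeasurable_itv.
have E s : count (fun x => x \in `]a, +oo[%classic) (atoms s) =
    count (fun x => a < x) (sort (>=%R) (atoms s)).
  rewrite count_sort; apply: eq_count => x.
  by apply/idP/idP; rewrite inE/= in_itv/= andbT.
have srt s : sorted (>=%R) (sort (>=%R) (atoms s)).
  by apply: sort_sorted => x y; exact: le_total.
apply/seteqP; split => s /=; rewrite !in_itv/= !andbT nth_sorted_gt//;
  by rewrite pm_count E lte_fin ltr_nat.
Qed.

End measurable_pm.

(** * Families of independent variables *)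

Section product_space.
Context (I : Type) d (E : measurableType d).

Definition coordinate_sets : set_system (I -> E) :=
  \bigcup_(i in [set: I])
     preimage_set_system [set: I -> E] (fun z : I -> E => z i) measurable.

Definition product_space := g_sigma_algebraType coordinate_sets.

HB.instance Definition _ := Measurable.on product_space.

Lemma measurable_coordinate i :
  measurable_fun [set: product_space] (fun z : product_space => z i).
Proof.
move=> _ B mB; apply: sub_sigma_algebra; exists i => //.
by exists B.
Qed.

Lemma measurable_to_product_space d' (T : measurableType d')
    (g : T -> product_space) :
  (forall i, measurable_fun setT (fun w => g w i)) -> measurable_fun setT g.
Proof.
move=> mg; apply: (@measurability _ _ T product_space setT g coordinate_sets) => //.
move=> _ [_ [i _ [B mB <-]] <-]; rewrite !setTI.
exact: (measurable_preimage (mg i) mB).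
Qed.

End product_space.

Definition mfun_of d d' (T : measurableType d) (T' : measurableType d')
    (f : T -> T') (mf : measurable_fun setT f) : {mfun T >-> T'} :=
  HB.pack f (isMeasurableFun.Build _ _ _ _ f mf).

Section product_law.
Context {R : realType} (K : choiceType) d (E : measurableType d).
Implicit Types (mu : K -> probability E R).
Local Notation Omega := (product_space K E).

Definition cylinder (s : seq K) (A : K -> set E) : set Omega :=
  [set w | forall k, k \in s -> A k (w k)].

(** The coordinates are independent and mu k is the law of the one of index k;
    this determines Q, as cylinders generate the sigma-algebra. *)
Definition product_law mu (Q : set Omega -> \bar R) := forall s (A : K -> set E),
  uniq s -> (forall k, measurable (A k)) ->
  Q (cylinder s A) = (\prod_(k <- s) fine (mu k (A k)))%:E.

Definition cylinders : set_system Omega :=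
  [set C | exists s A, [/\ uniq s, (forall k, measurable (A k)) & C = cylinder s A]].

Lemma measurable_cylinder s A : (forall k, measurable (A k)) ->
  measurable (cylinder s A).
Proof.
move=> mA; rewrite (_ : cylinder s A =
    \big[setI/setT]_(k <- s) (fun w : Omega => w k) @^-1` A k).
  apply: bigsetI_measurable => k _.
  exact: (measurable_preimage (@measurable_coordinate K _ E k) (mA k)).
rewrite -bigcap_seq predeqE => w; split=> H k /= ks; exact: H.
Qed.

Lemma setI_closed_cylinders : setI_closed cylinders.
Proof.
move=> _ _ [s [A [us mA ->]]] [s' [A' [us' mA' ->]]].
exists (undup (s ++ s')); exists (fun k =>
  (if k \in s then A k else setT) `&` (if k \in s' then A' k else setT)).
split; first exact: undup_uniq.
  by move=> k; apply: measurableI; case: ifP.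
rewrite predeqE => w; split => /= [[H H'] k|H].
  by rewrite mem_undup mem_cat => _; split; case: ifPn => // /[dup] ? ; [exact: H|exact: H'].
by split => k ks; have := H k; rewrite mem_undup mem_cat ks ?orbT => /(_ isT)[].
Qed.

Lemma measurable_cylindersE : measurable = <<s cylinders >> :> set_system Omega.
Proof.
apply/seteqP; split => C.
  apply: smallest_sub; first exact: smallest_sigma_algebra.
  move=> _ [k _ [B mB <-]]; apply: sub_sigma_algebra.
  exists [:: k], (fun=> B); split => //.
  rewrite setTI predeqE => w; split => [Bw j|]; first by rewrite inE => /eqP ->.
  by move=> /(_ k (mem_head _ _)).
apply: smallest_sub; first exact: sigma_algebra_measurable.
by move=> _ [s [A [us mA ->]]]; exact: measurable_cylinder.
Qed.

Lemma measure_eq_on_cylinders (m1 m2 : {measure set Omega -> \bar R}) :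
  (m1 setT < +oo)%E ->
  (forall s A, uniq s -> (forall k, measurable (A k)) ->
    m1 (cylinder s A) = m2 (cylinder s A)) ->
  forall A, measurable A -> m1 A = m2 A.
Proof.
move=> m1oo H; apply: (measure_unique cylinders (fun=> setT)) => //.
- exact: measurable_cylindersE.
- exact: setI_closed_cylinders.
- by move=> _; exists [::], (fun=> setT); split => //; apply/seteqP; split.
- by rewrite bigcup_const.
- by move=> _ [s [A [us mA ->]]]; exact: H.
Qed.

Lemma cylinder_nil A : cylinder [::] A = setT.
Proof. by apply/seteqP; split. Qed.

Lemma product_law_unique mu (m1 m2 : {measure set Omega -> \bar R}) :
  product_law mu m1 -> product_law mu m2 ->
  forall A, measurable A -> m1 A = m2 A.
Proof.
move=> h1 h2; apply: measure_eq_on_cylinders => [|s A us mA].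
  rewrite -(cylinder_nil (fun=> setT)) h1 ?big_nil ?ltry//.
by rewrite h1// h2.
Qed.

Section recombination.
Variables (mu : K -> probability E R) (PP : probability Omega R).
Hypothesis PP_prod : product_law mu PP.
Variables (D : pred K) (f g : K -> K).
Hypotheses (f_inj : {in D &, injective f}) (g_inj : {in predC D &, injective g}).
Hypotheses (mu_f : forall k, mu (f k) = mu k) (mu_g : forall k, mu (g k) = mu k).

(** This resamples a part of a family when f and g are the identity, and grafts
    pieces of w' into w when g renames the coordinates outside D. *)
Definition recombine (w w' : Omega) : Omega :=
  fun k => if D k then w (f k) else w' (g k).

Lemma measurable_recombine :
  measurable_fun setT (fun p : Omega * Omega => recombine p.1 p.2).
Proof.
apply: measurable_to_product_space => k; rewrite /recombine.
case: (D k).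
  by apply: (measurableT_comp (measurable_coordinate (f k))); exact: measurable_fst.
by apply: (measurableT_comp (measurable_coordinate (g k))); exact: measurable_snd.
Qed.

Let relabel s (h : K -> K) (A : K -> set E) : K -> set E :=
  fun j => \big[setI/setT]_(k <- s | h k == j) A k.

Let cyl_relabel s (h : K -> K) (A : K -> set E) (w : Omega) :
  {in s &, injective h} ->
  (forall k, k \in s -> A k (w (h k))) <->
  cylinder (map h s) (relabel s h A) w.
Proof.
move=> hinj; split=> [H _ /mapP[k ks ->]|H k ks].
  rewrite /relabel -bigcap_seq_cond => j /= /andP[js /eqP <-].
  exact: H.
have := H (h k) (map_f h ks); rewrite /relabel -bigcap_seq_cond.
by move=> /(_ k); apply => /=; rewrite ks eqxx.
Qed.

Let prod_relabel s (h : K -> K) (A : K -> set E) :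
  uniq s -> {in s &, injective h} -> (forall k, mu (h k) = mu k) ->
  (forall k, measurable (A k)) ->
  PP (cylinder (map h s) (relabel s h A)) = (\prod_(k <- s) fine (mu k (A k)))%:E.
Proof.
move=> us hinj muh mA; rewrite PP_prod ?map_inj_in_uniq//; last first.
  by move=> j; apply: bigsetI_measurable => k _.
congr EFin; rewrite big_map; apply: eq_big_seq => k ks.
rewrite muh /relabel; congr (fine (mu k _)).
rewrite -bigcap_seq_cond; apply/seteqP; split=> [x /(_ k)|x Akx j /= /andP[js /eqP hj]].
  by apply; rewrite /= ks eqxx.
by rewrite (hinj j k).
Qed.

(** As f is injective on D and g outside of D, a cylinder of the recombined
    family is a product of a cylinder in w and one in w', each involving
    distinct coordinates. *)
Lemma recombine_law A : measurable A ->
  PP A = (PP \x PP)%E ((fun p => recombine p.1 p.2) @^-1` A).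
Proof.
move: A; apply: (product_law_unique (m1 := PP)
  (m2 := distribution (PP \x PP)%E (mfun_of measurable_recombine)) PP_prod).
move=> s A us mA.
change ((PP \x PP)%E ((fun p => recombine p.1 p.2) @^-1` cylinder s A) =
  (\prod_(k <- s) fine (mu k (A k)))%:E).
set s1 := [seq k <- s | D k]; set s2 := [seq k <- s | predC D k].
have mrel h r : measurable (cylinder (map h r) (relabel r h A)).
  by apply: measurable_cylinder => j; apply: bigsetI_measurable => k _.
have i1 : {in s1 &, injective f}.
  by move=> j k; rewrite !mem_filter => /andP[Dj _] /andP[Dk _]; exact: f_inj.
have i2 : {in s2 &, injective g}.
  by move=> j k; rewrite !mem_filter => /andP[Dj _] /andP[Dk _]; exact: g_inj.
rewrite (_ : _ @^-1` _ = cylinder (map f s1) (relabel s1 f A) `*`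
    cylinder (map g s2) (relabel s2 g A)).
  transitivity (PP (cylinder (map f s1) (relabel s1 f A)) *
                PP (cylinder (map g s2) (relabel s2 g A)))%E.
    exact: product_measure1E.
  rewrite !prod_relabel ?filter_uniq// -EFinM; congr EFin.
  by rewrite !big_filter [RHS](bigID D).
apply/seteqP; split => -[w w'] /=.
  move=> H; split=> /=.
    apply: (iffLR (cyl_relabel _ _ i1)) => k.
    rewrite mem_filter => /andP[Dk ks]; have := H k ks.
    by rewrite /recombine /= Dk.
  apply: (iffLR (cyl_relabel _ _ i2)) => k.
  rewrite mem_filter /= => /andP[Dk ks]; have := H k ks.
  by rewrite /recombine /= (negbTE Dk).
move=> -[/= /(iffRL (cyl_relabel _ _ i1)) H1 /(iffRL (cyl_relabel _ _ i2)) H2] k ks.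
rewrite /recombine/=.
case: ifPn => Dk; first by apply: H1 => //; rewrite mem_filter Dk.
by apply: H2 => //; rewrite mem_filter /= Dk.
Qed.

(** Fubini: what comes from w can be frozen while w' is averaged. *)
Lemma integral_recombine (h : Omega -> \bar R) :
  measurable_fun setT h -> (forall w, 0 <= h w)%E ->
  (\int[PP]_w h w = \int[PP]_w \int[PP]_w' h (recombine w w'))%E.
Proof.
move=> mh h0.
transitivity (\int[distribution (PP \x PP)%E (mfun_of measurable_recombine)]_w h w)%E.
  by apply: eq_measure_integral => A mA _; exact: recombine_law.
rewrite ge0_integral_distribution// fubini_tonelli1//.
  exact: (measurableT_comp mh measurable_recombine).
by move=> p; exact: h0.
Qed.

End recombination.

End product_law.

(** * Individuals alive at a given time *)

Lemma cat_injl (T : Type) (v v' u : seq T) : v ++ u = v' ++ u -> v = v'.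
Proof.
move=> E; have sz : size v = size v'.
  by have := congr1 size E; rewrite !size_cat => /eqP; rewrite eqn_add2r => /eqP.
by have := congr1 (take (size v)) E; rewrite take_size_cat// sz take_size_cat.
Qed.

Lemma cat_comparable (T : Type) (u u' v v' : seq T) : (size u' <= size u)%N ->
  v ++ u = v' ++ u' -> u = drop (size v) v' ++ u'.
Proof.
move=> uu E; have sz : (size v <= size v')%N.
  have := congr1 size E; rewrite !size_cat => sE.
  by rewrite -(leq_add2r (size u')) -sE leq_add2l.
have := congr1 (drop (size v)) E; rewrite drop_size_cat// drop_cat.
by move: sz; rewrite leq_eqVlt => /orP[/eqP ->|->//]; rewrite ltnn subnn drop0 drop_size.
Qed.

Section tree.
Context {R : realType}.
Variable alpha : R.
Implicit Types (x t r c : R) (xi : seq nat -> nat -> R) (e : seq nat -> R) (u v z : seq nat).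

Definition alive x xi e t : set (seq nat) :=
  [set u | life_interval alpha x xi e u t].

Definition snapshot x xi e t : point_measure R :=
  to_point_measure (population alpha x xi e t).

Lemma aliveP x xi e t u : alive x xi e t u <->
  [/\ 0 < isize x xi u, birth alpha x xi e u <= t
    & t < birth alpha x xi e u + lifetime alpha x xi e u].
Proof.
rewrite /alive /life_interval/=; case: ifPn => h; last by split=> // -[].
by rewrite /= in_itv/=; split=> [/andP[]|[_ -> ->]].
Qed.

Lemma population_finite x xi e t (A : set R) : finite_set (alive x xi e t) ->
  population alpha x xi e t A =
  pm_of_seq [seq isize x xi u | u <- fset_set (alive x xi e t)] A.
Proof.
move=> fA; rewrite /population pm_of_seqE big_map.
rewrite -[X in \esum_(_ in X) _](fset_setK fA) esum_fset//.
rewrite fsbig_finite//= set_fsetK big_seq_cond [RHS]big_seq_cond.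
apply: eq_bigl => u; case: (boolP (u \in _)) => //=.
by rewrite in_fset_set// inE => /aliveP[->].
Qed.

(** Infinitely many living individuals give an infinite total mass. *)
Lemma is_point_measure_population x xi e t :
  is_point_measure (population alpha x xi e t) <-> finite_set (alive x xi e t).
Proof.
split=> [[s Hs]|fA]; last first.
  exists (pm_of_seq [seq isize x xi u | u <- fset_set (alive x xi e t)]) => A.
  exact: population_finite.
apply: contrapT => /(infinite_set_fset (natoms s).+1)[B BA Bn].
suff : (population alpha x xi e t setT >= (natoms s).+1%:R%:E)%E.
  by rewrite Hs pm_setT lee_fin ler_nat ltnn.
apply: (@le_trans _ _ (\sum_(u <- B) 1%E)%E).
  by rewrite sumEFin -(natr_sum _ _ _ (fun=> 1%N)) sum1_size lee_fin ler_nat.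
apply: esum_ge; exists [set` B]; first by split.
rewrite fsbig_finite//= set_fsetK; apply: lee_sum => u _.
by rewrite diracT.
Qed.

Lemma snapshot_finite x xi e t : finite_set (alive x xi e t) ->
  snapshot x xi e t = pm_of_seq [seq isize x xi u | u <- fset_set (alive x xi e t)].
Proof.
move=> fA; apply: pm_ext => A; rewrite -population_finite//.
rewrite /snapshot /to_point_measure; case: xgetP => [s _ ->//|].
by move=> /(_ (pm_of_seq [seq isize x xi u | u <- fset_set (alive x xi e t)]))[];
  move=> B; exact: population_finite.
Qed.

Lemma snapshot_infinite x xi e t : ~ finite_set (alive x xi e t) ->
  snapshot x xi e t = pm_of_seq [::].
Proof.
move=> nfA; rewrite /snapshot /to_point_measure; case: xgetP => [s _ Hs|//].
by case: nfA; apply/is_point_measure_population; exists s.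
Qed.

Lemma isize_cat x xi u v :
  isize x xi (v ++ u) = isize (isize x xi u) (fun z => xi (z ++ u)) v.
Proof. by elim: v => //= i v ->. Qed.

(** The clock of u runs at speed size ^ alpha, so this is what it has consumed
    of e u at time r, and residual_clock is what is left to run in the subtree
    of u. *)
Definition age_at_rate x xi e r u := isize x xi u `^ alpha * (r - birth alpha x xi e u).

Definition residual_clock (c : R) e u : seq nat -> R :=
  fun z => if z is [::] then e u - c else e (z ++ u).

Lemma residual_lifetime x xi e r u : 0 < isize x xi u ->
  lifetime alpha (isize x xi u) (fun z => xi (z ++ u))
    (residual_clock (age_at_rate x xi e r u) e u) [::] =
  lifetime alpha x xi e u - (r - birth alpha x xi e u).
Proof.
move=> x0; rewrite /lifetime /= /age_at_rate mulrBr mulrA -powRD.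
  by rewrite addNr powRr0 mul1r.
by apply/implyP => _; rewrite gt_eqF.
Qed.

Lemma residual_birth x xi e r u i v : 0 < isize x xi u ->
  birth alpha (isize x xi u) (fun z => xi (z ++ u))
    (residual_clock (age_at_rate x xi e r u) e u) (i :: v) =
  birth alpha x xi e ((i :: v) ++ u) - r.
Proof.
move=> x0; elim: v i => [|j v IH] i.
  by rewrite [LHS]/= add0r residual_lifetime//=; lra.
set x' := isize x xi u; set xi' := fun z => xi (z ++ u); set e' := residual_clock _ e u.
have E : lifetime alpha x' xi' e' (j :: v) = lifetime alpha x xi e ((j :: v) ++ u).
  by rewrite /lifetime -isize_cat.
change (birth alpha x' xi' e' (j :: v) + lifetime alpha x' xi' e' (j :: v) =
  birth alpha x xi e ((j :: v) ++ u) + lifetime alpha x xi e ((j :: v) ++ u) - r).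
by rewrite E IH addrAC.
Qed.

(** Seen from time r, the subtree of a living individual u is a tree whose root
    has the size of u and only the remaining lifetime of u. *)
Lemma alive_shift x xi e t r u v : 0 <= t -> alive x xi e r u ->
  alive x xi e (t + r) (v ++ u) <->
  alive (isize x xi u) (fun z => xi (z ++ u))
    (residual_clock (age_at_rate x xi e r u) e u) t v.
Proof.
move=> t0 /aliveP[x0 br rb].
split=> /aliveP[h1 h2 h3]; apply/aliveP; split.
- by rewrite -isize_cat.
- by case: v h1 h2 h3 => [//|i v] h1 h2 h3; rewrite residual_birth// lerBlDr.
- case: v h1 h2 h3 => [|i v] h1 h2 h3.
    by rewrite residual_lifetime// add0r; move: h3; rewrite cat0s; lra.
  by rewrite residual_birth// /lifetime -isize_cat addrAC ltrBrDr.
- by rewrite isize_cat.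
- case: v h1 h2 h3 => [|i v] h1 h2 h3; last by rewrite -lerBlDr -residual_birth.
  by rewrite cat0s; lra.
- case: v h1 h2 h3 => [|i v] h1 h2 h3.
    by move: h3; rewrite residual_lifetime// add0r cat0s; lra.
  by move: h3; rewrite residual_birth// /lifetime -isize_cat addrAC ltrBrDr.
Qed.

Lemma isize_gt0_suffix x xi u v : (forall z i, 0 <= xi z i) -> 0 <= x ->
  0 < isize x xi (v ++ u) -> 0 < isize x xi u.
Proof.
move=> xi0 x0; have H z : 0 <= isize x xi z by elim: z => //= i z; exact: mulr_ge0.
elim: v => //= i v IH; have [->|h] := eqVneq (isize x xi (v ++ u)) 0.
  by rewrite mulr0 ltxx.
by move=> _; apply: IH; rewrite lt_neqAle eq_sym h H.
Qed.

(** The life intervals along the line of descent of z are adjacent and start at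
    time 0, hence one of them contains r. *)
Lemma alive_ancestor x xi e t r z : (forall z i, 0 <= xi z i) -> 0 <= x -> 0 <= r -> r <= t ->
  alive x xi e t z -> exists v u, z = v ++ u /\ alive x xi e r u.
Proof.
move=> xi0 x0 r0 rt /aliveP[s0 bt tb].
have : exists v u, [/\ z = v ++ u, birth alpha x xi e u <= r
    & r < birth alpha x xi e u + lifetime alpha x xi e u].
  move: (le_lt_trans rt tb) => {tb bt s0}; elim: z => [|i z IH].
    by move=> h; exists [::], [::].
  move=> h; have [b|b] := leP (birth alpha x xi e (i :: z)) r.
    by exists [::], (i :: z).
  have [v [u [-> ? ?]]] := IH b; by exists (i :: v), u.
move=> [v [u [zE b l]]]; exists v, u; split => //; apply/aliveP; split => //.
by apply: (@isize_gt0_suffix x xi u v) => //; rewrite -zE.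
Qed.

Lemma lifetime_ge0 x xi e u : (forall z, 0 <= e z) -> 0 <= lifetime alpha x xi e u.
Proof. by move=> e0; rewrite mulr_ge0// powR_ge0. Qed.

Lemma birth_ge0 x xi e u : (forall z, 0 <= e z) -> 0 <= birth alpha x xi e u.
Proof. by move=> e0; elim: u => //= i u IH; rewrite addr_ge0// lifetime_ge0. Qed.

Lemma birth_child_le x xi e u v i : (forall z, 0 <= e z) ->
  birth alpha x xi e u + lifetime alpha x xi e u <= birth alpha x xi e (v ++ i :: u).
Proof.
move=> e0; elim: v => [|j v IH] //=.
by rewrite (le_trans IH)// lerDl lifetime_ge0.
Qed.

(** A descendant is born after the death of its ancestors. *)
Lemma alive_antichain x xi e r u v : (forall z, 0 <= e z) ->
  alive x xi e r u -> alive x xi e r (v ++ u) -> v = [::].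
Proof.
move=> e0 /aliveP[_ _ h] /aliveP[_ b _].
case/lastP: v b => [//|v i]; rewrite cat_rcons => b.
by have := le_lt_trans (le_trans (@birth_child_le x xi e u v i e0) b) h; rewrite ltxx.
Qed.

(** An individual alive at time t + r has an ancestor alive at time r, and only
    one since those alive at time r form an antichain. *)
Lemma snapshot_add x xi e t r (S : {fset seq nat}) :
  (forall z i, 0 <= xi z i) -> 0 <= x -> (forall z, 0 <= e z) ->
  0 <= t -> 0 <= r -> alive x xi e r = [set` S] ->
  finite_set (alive x xi e (t + r)) ->
  snapshot x xi e (t + r) =
  pm_sum [seq snapshot (isize x xi u) (fun z => xi (z ++ u))
    (residual_clock (age_at_rate x xi e r u) e u) t | u <- S].
Proof.
move=> xi0 x0 e0 t0 r0 SE fA.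
pose B u := alive (isize x xi u) (fun z => xi (z ++ u))
    (residual_clock (age_at_rate x xi e r u) e u) t.
have Sr u : u \in S -> alive x xi e r u by rewrite SE.
have fB u : u \in S -> finite_set (B u).
  move=> /Sr ur; apply: (@sub_finite_set _ _ [set v | (v ++ u) \in fset_set (alive x xi e (t + r))]).
    by move=> v Bv /=; rewrite in_fset_set// inE; apply/alive_shift.
  apply: (finite_preimage (f := cat^~ u) (B := [set` fset_set (alive x xi e (t + r))])) => //.
  by move=> v v' _ _ /= /cat_injl.
apply: pm_ext => A.
rewrite pm_sumE big_map snapshot_finite// pm_of_seqE big_map.
transitivity (\sum_(u <- S) \sum_(v <- fset_set (B u) | (0 < isize x xi (v ++ u))%R)
    \d_(isize x xi (v ++ u)) A : \bar R)%E; last first.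
  apply: eq_big_seq => u uS; rewrite snapshot_finite; last exact: fB.
  by rewrite pm_of_seqE big_map; apply: eq_big => [v|v _]; rewrite isize_cat.
rewrite (perm_big [seq v ++ u | u <- enum_fset S, v <- enum_fset (fset_set (B u))]).
  rewrite big_mkcond big_allpairs_dep/=; apply: eq_bigr => u _.
  by rewrite [RHS]big_mkcond.
apply: uniq_perm; first exact: fset_uniq.
  apply: allpairs_uniq_dep; [exact: fset_uniq|by move=> u _; exact: fset_uniq|].
  move=> p q /allpairsPdep[u1 [v1 [uS vB ->]]] /allpairsPdep[u2 [v2 [uS' vB' ->]]] /= E.
  suff E' : u1 = u2 by move: E; rewrite E' => /cat_injl ->.
  wlog h : u1 v1 u2 v2 uS uS' vB vB' E / (size u1 <= size u2)%N.
    move=> W; have [h|/ltnW h] := leqP (size u1) (size u2); first exact: (W _ v1 _ v2).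
    by apply/esym; apply: (W _ v2 _ v1).
  have E2 := cat_comparable h (esym E).
  have := alive_antichain e0 (Sr _ uS) _; move=> /(_ (drop (size v2) v1)).
  by rewrite -E2 => /(_ (Sr _ uS')) W; rewrite E2 W.
move=> z; rewrite in_fset_set//; apply/idP/idP.
  rewrite inE => zA; have [v [u [zE ur]]] := alive_ancestor xi0 x0 r0 (ler_wpDl t0 (lexx r)) zA.
  have uS : u \in S by move: ur; rewrite SE.
  apply/allpairsPdep; exists u, v; split => //.
  by rewrite in_fset_set ?inE; [apply/alive_shift; rewrite -?zE|exact: fB].
move=> /allpairsPdep[u [v [uS vB ->]]]; rewrite inE.
apply/alive_shift => //; first exact: Sr.
by move: vB; rewrite in_fset_set ?inE//; exact: fB.
Qed.

Lemma isize_scale c x xi u : isize (c * x) xi u = c * isize x xi u.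
Proof. by elim: u => //= i u ->; rewrite mulrCA. Qed.

Lemma isize_ge0 x xi u : (forall z i, 0 <= xi z i) -> 0 <= x -> 0 <= isize x xi u.
Proof. by move=> xi0 x0; elim: u => //= i u IH; exact: mulr_ge0. Qed.

Lemma lifetime_scale c x xi e u : 0 < c -> (forall z i, 0 <= xi z i) -> 0 <= x ->
  lifetime alpha (c * x) xi e u = c `^ (- alpha) * lifetime alpha x xi e u.
Proof.
move=> c0 xi0 x0; rewrite /lifetime isize_scale powRM ?mulrA//; first exact: ltW.
exact: isize_ge0.
Qed.

Lemma birth_scale c x xi e u : 0 < c -> (forall z i, 0 <= xi z i) -> 0 <= x ->
  birth alpha (c * x) xi e u = c `^ (- alpha) * birth alpha x xi e u.
Proof.
move=> c0 xi0 x0; elim: u => [|i u IH]; first by rewrite /= mulr0.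
by rewrite /= IH lifetime_scale// mulrDr.
Qed.

(** A root c times larger makes all sizes c times larger, and all lifetimes
    shorter by the factor c ^ alpha. *)
Lemma snapshot_scale c x xi e t : 0 < c -> (forall z i, 0 <= xi z i) -> 0 <= x ->
  snapshot (c * x) xi e t = pm_scale c (snapshot x xi e (c `^ alpha * t)).
Proof.
move=> c0 xi0 x0.
have E : alive (c * x) xi e t = alive x xi e (c `^ alpha * t).
  have ca : 0 < c `^ alpha by rewrite powR_gt0.
  apply/seteqP; split=> u /aliveP[h1 h2 h3]; apply/aliveP; move: h1 h2 h3;
  rewrite isize_scale birth_scale// lifetime_scale// pmulr_rgt0// -mulrDr powRN;
  by rewrite ler_pdivrMl// ltr_pdivlMl.
have [fA|nfA] := pselect (finite_set (alive (c * x) xi e t)); last first.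
  rewrite snapshot_infinite// snapshot_infinite; last by rewrite -E.
  apply: pm_ext => A; rewrite pm_scaleE// !pm_of_seqE !big_nil//.
rewrite snapshot_finite// snapshot_finite; last by rewrite -E.
rewrite E; apply: pm_ext => A; rewrite pm_scaleE// !pm_of_seqE !big_map.
apply: eq_big => [u|u _]; rewrite isize_scale; first by rewrite pmulr_rgt0.
by rewrite !diracE.
Qed.

End tree.

(** * Measurability of the population *)

Lemma countable_bigcap_measurable (K : countType) d (T : measurableType d)
    (F : K -> set T) : (forall k, measurable (F k)) ->
  measurable [set w | forall k, F k w].
Proof.
move=> mF; rewrite (_ : [set w | _] = ~` \bigcup_k ~` F k).
  apply: measurableC; apply: countable_bigcupT_measurable => // k.
  exact: measurableC.
rewrite setC_bigcup; apply/seteqP; split => w /=.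
  by move=> H k _; apply; exact: H.
by move=> H k; apply: contrapT; exact: (H k I).
Qed.

Lemma countable_bigcup_measurable (K : countType) d (T : measurableType d)
    (F : K -> set T) : (forall k, measurable (F k)) ->
  measurable [set w | exists k, F k w].
Proof.
move=> mF; rewrite (_ : [set w | _] = \bigcup_k F k).
  exact: countable_bigcupT_measurable.
by apply/seteqP; split => w /= [k]; [exists k|move=> _; exists k].
Qed.

Section random_set.
Context (K : countType) d (T : measurableType d).
Variable A : T -> set K.
Hypothesis mA : forall k, measurable [set w | A w k].

Lemma measurable_random_set_eq (S : {fset K}) :
  measurable [set w | A w = [set` S]].
Proof.
rewrite (_ : [set w | _] = [set w | forall k, (if k \in S then
  [set w | A w k] else ~` [set w | A w k]) w]).
  apply: countable_bigcap_measurable => k; case: ifP => _; first exact: mA.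
  exact/measurableC/mA.
apply/seteqP; split => w /=; first by move=> E k; case: ifPn => kS /=; rewrite E//= (negbTE kS).
move=> H; apply/seteqP; split => k /=; have := H k; case: ifPn => //.
Qed.

Lemma measurable_random_set_finite : measurable [set w | finite_set (A w)].
Proof.
rewrite (_ : [set w | _] = [set w | exists S : {fset K}, A w = [set` S]]).
  apply: countable_bigcup_measurable => S; exact: measurable_random_set_eq.
by apply/seteqP; split => w /finite_fsetP.
Qed.

(** A random set has only countably many finite values S, and f can be examined
    separately on each event where the set is S. *)
Lemma measurable_fun_random_set d' (T' : measurableType d') (f : T -> T')
    (f0 : T') (g : {fset K} -> T -> T') :
  (forall S, measurable_fun setT (g S)) ->
  (forall w S, A w = [set` S] -> f w = g S w) ->
  (forall w, ~ finite_set (A w) -> f w = f0) ->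
  measurable_fun setT f.
Proof.
move=> mg fg ff0 _ B mB; rewrite setTI.
rewrite (_ : f @^-1` B =
  [set w | exists S : {fset K}, ([set w | A w = [set` S]] `&` g S @^-1` B) w] `|`
  (~` [set w | finite_set (A w)] `&` (if f0 \in B then setT else set0))).
  apply: measurableU.
    apply: countable_bigcup_measurable => S; apply: measurableI.
      exact: measurable_random_set_eq.
    exact: (measurable_preimage (mg S) mB).
  apply: measurableI; last by case: ifP.
  exact/measurableC/measurable_random_set_finite.
apply/seteqP; split => w /=.
  move=> Bf; have [fA|nfA] := pselect (finite_set (A w)); [left|right].
    by have /finite_fsetP[S AS] := fA; exists S; split=> //; rewrite -fg.
  by split=> //; rewrite mem_set//; rewrite -(ff0 w).
move=> [[S [AS]]|[nfA]]; first by rewrite -fg.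
by case: ifPn => //; rewrite inE => + _; rewrite (ff0 w).
Qed.

End random_set.

Section measurable_tree.
Context {R : realType} (alpha t : R) d (Y : measurableType d).
Variables (x : Y -> R) (xi : Y -> seq nat -> nat -> R) (e : Y -> seq nat -> R).
Hypotheses (mx : measurable_fun setT x)
  (mxi : forall u i, measurable_fun setT (fun y => xi y u i))
  (me : forall u, measurable_fun setT (fun y => e y u)).

Lemma measurable_isize u : measurable_fun setT (fun y => isize (x y) (xi y) u).
Proof. by elim: u => //= i u IH; exact: measurable_funM. Qed.

Lemma measurable_lifetime u :
  measurable_fun setT (fun y => lifetime alpha (x y) (xi y) (e y) u).
Proof.
apply: measurable_funM => //.
exact: (measurableT_comp (measurable_powR _) (measurable_isize u)).
Qed.

Lemma measurable_birth u :
  measurable_fun setT (fun y => birth alpha (x y) (xi y) (e y) u).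
Proof.
elim: u => [|i u IH] /=; first exact: measurable_cst.
by apply: measurable_funD => //; exact: measurable_lifetime.
Qed.

Lemma measurable_bool_set (f : Y -> bool) : measurable_fun setT f ->
  measurable [set y | f y].
Proof.
move=> mf; have := mf measurableT [set true]; rewrite setTI; exact.
Qed.

Lemma measurable_alive u : measurable [set y | alive alpha (x y) (xi y) (e y) t u].
Proof.
rewrite (_ : [set y | _] = [set y | 0 < isize (x y) (xi y) u] `&`
   [set y | birth alpha (x y) (xi y) (e y) u <= t] `&`
   [set y | t < birth alpha (x y) (xi y) (e y) u + lifetime alpha (x y) (xi y) (e y) u]).
  apply: measurableI; [apply: measurableI|]; apply: measurable_bool_set.
  - by apply: measurable_fun_ltr => //; exact: measurable_isize.
  - by apply: measurable_fun_ler => //; exact: measurable_birth.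
  - apply: measurable_fun_ltr => //; apply: measurable_funD.
      exact: measurable_birth.
    exact: measurable_lifetime.
apply/seteqP; split => y /=; first by move=> /aliveP[].
by move=> [[? ?] ?]; apply/aliveP.
Qed.

End measurable_tree.

Section measurable_snapshot.
Context {R : realType} d (Y : measurableType d).

Lemma measurable_pm_of_seq (I : Type) (S : seq I) (f : Y -> I -> R) :
  (forall u, measurable_fun setT (fun y => f y u)) ->
  measurable_fun setT (fun y => pm_of_seq [seq f y u | u <- S]).
Proof.
move=> mf.
have H (A : set R) : measurable A ->
    measurable_fun setT (fun y => pm_of_seq [seq f y u | u <- S] A).
  move=> mA; under eq_fun do rewrite pm_of_seqE big_map big_mkcond/=.
  apply: emeasurable_sum => u.
  apply: measurable_fun_ifT; last exact: measurable_cst.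
    exact: measurable_fun_ltr.
  under eq_fun do rewrite diracE.
  apply/measurable_EFinP.
  have -> : (fun y => (f y u \in A)%:R) = \1_A \o (fun y => f y u) :> (Y -> R) by [].
  by apply: measurableT_comp => //; exact: measurable_indic.
by apply: measurable_pm_fun => [|a b]; apply: H.
Qed.

Lemma measurable_pm_sum (T : Type) (S : seq T) (f : Y -> T -> point_measure R) :
  (forall u, measurable_fun setT (fun y => f y u)) ->
  measurable_fun setT (fun y => pm_sum [seq f y u | u <- S]).
Proof.
move=> mf; apply: measurable_pm_fun => [|a b];
  under eq_fun do rewrite pm_sumE big_map; apply: emeasurable_sum => u.
  by apply: (measurableT_comp measurable_pm_setT); exact: mf.
by apply: (measurableT_comp (measurable_pm_itvoo a b)); exact: mf.
Qed.

Variables (alpha t : R).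
Variables (x : Y -> R) (xi : Y -> seq nat -> nat -> R) (e : Y -> seq nat -> R).
Hypotheses (mx : measurable_fun setT x)
  (mxi : forall u i, measurable_fun setT (fun y => xi y u i))
  (me : forall u, measurable_fun setT (fun y => e y u)).

Lemma measurable_snapshot :
  measurable_fun setT (fun y => snapshot alpha (x y) (xi y) (e y) t).
Proof.
apply: (@measurable_fun_random_set _ _ _ (fun y => alive alpha (x y) (xi y) (e y) t)
  _ _ _ _ (pm_of_seq [::])
  (fun S y => pm_of_seq [seq isize (x y) (xi y) u | u <- S])).
- by move=> u; exact: measurable_alive.
- by move=> S; apply: measurable_pm_of_seq => u; exact: measurable_isize.
- move=> y S E; rewrite snapshot_finite E; last exact: finite_fset.
  by rewrite set_fsetK.
- by move=> y nf; exact: snapshot_infinite.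
Qed.

End measurable_snapshot.

(** * Changes of variables in an independent family *)

Section mixing.
Context {R : realType} (K : choiceType) d (E : measurableType d).
Local Notation Omega := (product_space K E).
Variables (mu : K -> probability E R) (PP : probability Omega R).
Hypothesis PP_prod : product_law mu PP.

Lemma measurable_relabel (f : K -> K) :
  measurable_fun setT (fun w : Omega => (fun k => w (f k)) : Omega).
Proof.
by apply: measurable_to_product_space => k; exact: measurable_coordinate.
Qed.

(** Distinct indices are sent to distinct coordinates of the same law. *)
Lemma relabel_law (f : K -> K) : injective f -> (forall k, mu (f k) = mu k) ->
  forall A : set Omega, measurable A -> PP A = PP ((fun w k => w (f k)) @^-1` A).
Proof.
move=> f_inj mu_f A mA.
rewrite (recombine_law PP_prod (D := predT) (f := f) (g := f))//; last by move=> ? ? _ _; exact: f_inj.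
rewrite (_ : _ @^-1` _ = ((fun w k => w (f k)) @^-1` A) `*` setT).
  have mfA : measurable ((fun w k => w (f k)) @^-1` A : set Omega).
    exact: (measurable_preimage (measurable_relabel f) mA).
  transitivity (PP ((fun w k => w (f k)) @^-1` A) * PP setT)%E.
    exact: product_measure1E.
  by rewrite probability_setT mule1.
by apply/seteqP; split => -[w w'] //= [].
Qed.

Definition alter (L : seq K) (h : K -> E -> E) (w : Omega) : Omega :=
  fun k => if k \in L then h k (w k) else w k.

Lemma measurable_alter L h : (forall k, measurable_fun setT (h k)) ->
  measurable_fun setT (alter L h).
Proof.
move=> mh; apply: measurable_to_product_space => k; rewrite /alter.
case: (k \in L); last exact: measurable_coordinate.
by apply: measurableT_comp => //; exact: measurable_coordinate.
Qed.

(** By independence, conditioning each coordinate of L on V k and transforming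
    it by h k can be done one coordinate at a time; if no individual law is
    affected, then the law of the family is not affected either. *)
Lemma alter_law L (V : K -> set E) (h : K -> E -> E) : uniq L ->
  (forall k, measurable (V k)) -> (forall k, measurable_fun setT (h k)) ->
  (forall k B, k \in L -> measurable B ->
    mu k (V k `&` h k @^-1` B) = (mu k (V k) * mu k B)%E) ->
  forall A, measurable A ->
  PP (cylinder L V `&` alter L h @^-1` A) = (PP (cylinder L V) * PP A)%E.
Proof.
move=> uL mV mh H A mA.
have mcV : measurable (cylinder L V) by exact: measurable_cylinder.
pose PL := fine (PP (cylinder L V)).
have PLE : PL%:E = PP (cylinder L V) by rewrite fineK// fin_num_measure.
have PL0 : 0 <= PL by rewrite fine_ge0.
pose m1 := pushforward (mrestr PP mcV) (mfun_of (measurable_alter L mh)).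
pose m2 := mscale (NngNum PL0) PP.
suff : m1 A = m2 A.
  by rewrite /m1 /m2 /pushforward /mrestr /mscale /= PLE setIC.
apply: measure_eq_on_cylinders mA.
  rewrite /m1 /pushforward /mrestr (le_lt_trans (probability_le1 _ _)) ?ltry//.
  by rewrite preimage_setT setTI.
move=> s B us mB.
pose s' := undup (s ++ L).
pose B1 k := if k \in s then B k else setT.
have mB1 k : measurable (B1 k) by rewrite /B1; case: ifP.
pose V1 k := if k \in L then V k else setT.
have mV1 k : measurable (V1 k) by rewrite /V1; case: ifP.
pose W k := V1 k `&` (if k \in L then h k @^-1` B1 k else B1 k).
have mW k : measurable (W k).
  apply: measurableI => //; case: ifP => // _.
  exact: (measurable_preimage (mh k) (mB1 k)).
have us' : uniq s' by exact: undup_uniq.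
have ss' k : k \in s -> k \in s' by rewrite mem_undup mem_cat => ->.
have Ls' k : k \in L -> k \in s' by rewrite mem_undup mem_cat orbC => ->.
have cB : cylinder s B = cylinder s' B1.
  apply/seteqP; split => w Hw k ks; first by rewrite /B1; case: ifPn => //; exact: Hw.
  by have := Hw k (ss' _ ks); rewrite /B1 ks.
have cV : cylinder L V = cylinder s' V1.
  apply/seteqP; split => w Hw k ks; first by rewrite /V1; case: ifPn => //; exact: Hw.
  by have := Hw k (Ls' _ ks); rewrite /V1 ks.
transitivity (PP (cylinder s' W)).
  change (PP (alter L h @^-1` cylinder s B `&` cylinder L V) = PP (cylinder s' W)).
  rewrite cB cV; congr (PP _); apply/seteqP; split => w /=.
    move=> [h1 h2] k ks; split; first exact: h2.
    by have := h1 k ks; rewrite /alter/=; case: ifP.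
  move=> Hw; split => k ks; have [h1 h2] := Hw k ks => //.
  by move: h2; rewrite /alter; case: ifP.
change (PP (cylinder s' W) = (PL%:E * PP (cylinder s B))%E).
rewrite PLE cB cV !PP_prod// -EFinM -big_split/=; congr EFin.
apply: eq_bigr => k _; rewrite /W /V1; case: ifPn => kL; last first.
  by rewrite setTI probability_setT mul1r.
by rewrite H// fineM// fin_num_measure.
Qed.

End mixing.

Section memoryless.
Context {R : realType}.
Variable Q : probability R R.
Hypothesis QE : forall B, measurable B -> Q B = exponential_prob 1 B.

Lemma exponential_tail (a : R) : Q `]a, +oo[%classic = (expR (- Num.max 0 a))%:E.
Proof.
have H b : Q `]-oo, b]%classic = exponential_prob 1 `[0, b]%classic.
  rewrite QE// /exponential_prob integral_mkcond [RHS]integral_mkcond.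
  apply: eq_integral => y _; rewrite /patch; case: ifPn => yb; case: ifPn => // yb'.
    move: yb yb'; rewrite !inE /= !in_itv/= => yb /negP; rewrite inE/= in_itv/= yb andbT.
    by move=> /negP; rewrite -ltNge => /lt0_exponential_pdf ->.
  by move: yb yb'; rewrite !inE /= !in_itv/= => /negP; rewrite inE/= in_itv/= => yb /andP[_].
have -> : `]a, +oo[%classic = ~` `]-oo, a]%classic :> set R by rewrite setCitvl.
rewrite probability_setC// H.
have [a0|a0] := ltP 0 a.
  rewrite exponential_prob_itv0c// mulN1r.
  transitivity ((1 - (1 - expR (- a)))%:E) => //; congr EFin; lra.
rewrite oppr0 expR0.
suff -> : exponential_prob 1 `[0, a]%classic = 0%E :> \bar R by rewrite sube0.
move: a0; rewrite le_eqVlt => /orP[/eqP ->|a0].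
  by rewrite /exponential_prob set_itv1 integral_set1.
by rewrite set_itv_ge ?/exponential_prob ?integral_set0// -ltNge.
Qed.

(** Both sides are finite measures in B, and on half-lines they agree since
    expR turns sums into products. *)
Lemma exponential_memoryless (c : R) (B : set R) : 0 <= c -> measurable B ->
  Q ([set y | c < y] `&` [set y | B (y - c)]) = (Q [set y | (c < y)%R] * Q B)%E.
Proof.
move=> c0 mB.
have mc : measurable [set y : R | c < y].
  rewrite (_ : [set y | _] = `]c, +oo[%classic)//.
  by apply/seteqP; split => y /=; rewrite in_itv/= andbT.
have ms : measurable_fun setT (fun y : R => y - c) by exact: measurable_funB.
pose PL := fine (Q [set y | c < y]).
have PLE : PL%:E = Q [set y | c < y] by rewrite fineK// fin_num_measure.
have PL0 : 0 <= PL by rewrite fine_ge0.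
pose m1 := pushforward (mrestr Q mc) (mfun_of ms).
pose m2 := mscale (NngNum PL0) Q.
suff : m1 B = m2 B.
  by rewrite /m1 /m2 /pushforward /mrestr /mscale /= PLE setIC.
apply: (measure_unique (@RGenOInfty.G R) (fun n => `](- n%:R), +oo[%classic)) mB => //.
- exact: RGenOInfty.measurableE.
- move=> _ _ [a ->] [b ->]; exists (Num.max a b).
  by apply/seteqP; split => y /=; rewrite !in_itv/= !andbT gt_max => /andP.
- by move=> n; exists (- n%:R).
- apply/seteqP; split => y // _; exists (Num.trunc `|y|).+1 => //=.
  rewrite in_itv/= andbT ltrNl (le_lt_trans (ler_norm _))// normrN.
  exact: truncnS_gt.
- move=> _ [a ->].
  change (Q ((fun y => y - c) @^-1` `]a, +oo[ `&` [set y | c < y]) =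
    (PL%:E * Q `]a, +oo[%classic)%E).
  rewrite PLE.
  rewrite (_ : [set y | c < y] = `]c, +oo[%classic); last first.
    by apply/seteqP; split => y /=; rewrite in_itv/= andbT.
  rewrite (_ : _ `&` _ = `]Num.max 0 a + c, +oo[%classic).
    rewrite !exponential_tail -EFinM -expRD; congr (expR _)%:E.
    rewrite (max_idPr c0) (max_idPr _) ?opprD 1?addrC//.
    by rewrite addr_ge0// le_max lexx.
  apply/seteqP; split => y /=; rewrite !in_itv/= !andbT.
    by move=> [h2 h1]; rewrite -ltrBrDr gt_max h2 andbT subr_gt0.
  rewrite -ltrBrDr gt_max => /andP[h1 h2]; split; first exact: h2.
  by move: h1; rewrite subr_gt0.
- move=> n; change (Q ((fun y => (y - c)%R) @^-1` `](- n%:R)%R, +oo[ `&` [set y | (c < y)%R]) < +oo)%E.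
  rewrite (le_lt_trans (probability_le1 _ _)) ?ltry//; apply: measurableI => //.
  by have := ms measurableT `](- n%:R), +oo[%classic; rewrite setTI; apply.
Qed.

End memoryless.

Section measure_tools.
Context {R : realType} d (T : measurableType d) (P : probability T R).

Lemma probability_ae_eq (A B : set T) : measurable A -> measurable B ->
  {ae P, forall w, A w <-> B w} -> P A = P B.
Proof.
move=> mA mB AB; rewrite -[A]setIT -[B]setIT -!integral_indic//.
apply: ge0_ae_eq_integral => //.
- by apply/measurable_EFinP; exact: measurable_indic.
- by apply/measurable_EFinP; exact: measurable_indic.
apply: filterS AB => w AB _; rewrite !indicE.
suff -> : (w \in A) = (w \in B) by [].
by apply/idP/idP; rewrite !inE => /AB.
Qed.

End measure_tools.

Section recombination_probability.
Context {R : realType} (K : choiceType) d (E : measurableType d).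
Local Notation Omega := (product_space K E).
Variables (mu : K -> probability E R) (PP : probability Omega R).
Hypothesis PP_prod : product_law mu PP.
Variables (D : pred K) (f g : K -> K).
Hypotheses (f_inj : {in D &, injective f}) (g_inj : {in predC D &, injective g}).
Hypotheses (mu_f : forall k, mu (f k) = mu k) (mu_g : forall k, mu (g k) = mu k).

Lemma probability_recombine (A : set Omega) : measurable A ->
  PP A = (\int[PP]_w PP [set w' | A (recombine D f g w w')])%E.
Proof.
move=> mA; rewrite (recombine_law PP_prod f_inj g_inj mu_f mu_g mA).
apply: eq_integral => w _ /=; congr (PP _).
by apply/seteqP; split => w'; rewrite /xsection/= inE.
Qed.

End recombination_probability.

(** * Random trees with independent marks and clocks *)

(** The coordinate (true, u) holds the marks of the children of u, and (false, u)
    holds the clock of u.  A clock is stored as entry 0 of a sequence, so that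
    all coordinates take their values in the same space. *)
Notation mark_space R := (product_space nat R).
Notation tree_space R := (product_space (bool * seq nat) (mark_space R)).

Section canonical.
Context {R : realType}.
Local Notation Omega := (tree_space R).
Implicit Types (w : Omega) (u v : seq nat).

Definition marks_of w u (i : nat) : R := w (true, u) i.
Definition clocks_of w u : R := w (false, u) 0%N.
Definition branch u w : Omega := fun k => w (k.1, k.2 ++ u).

Lemma measurable_marks u i : measurable_fun setT (fun w => marks_of w u i).
Proof.
exact: (measurableT_comp (@measurable_coordinate nat _ R i)
  (@measurable_coordinate _ _ (mark_space R) (true, u))).
Qed.

Lemma measurable_clocks u : measurable_fun setT (fun w => clocks_of w u).
Proof.
exact: (measurableT_comp (@measurable_coordinate nat _ R 0%N)
  (@measurable_coordinate _ _ (mark_space R) (false, u))).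
Qed.

Lemma measurable_constant_seq : measurable_fun setT (fun y : R => (fun=> y) : mark_space R).
Proof. by apply: measurable_to_product_space => j; exact: measurable_id. Qed.

Lemma measurable_tree_isize (x : R) u : measurable_fun setT (fun w => isize x (marks_of w) u).
Proof. by apply: measurable_isize => // v i; exact: measurable_marks. Qed.

Lemma measurable_tree_birth alpha (x : R) u :
  measurable_fun setT (fun w => birth alpha x (marks_of w) (clocks_of w) u).
Proof.
apply: measurable_birth => // [v i|v]; [exact: measurable_marks|exact: measurable_clocks].
Qed.

Lemma measurable_tree_alive alpha (x r : R) u :
  measurable [set w | alive alpha x (marks_of w) (clocks_of w) r u].
Proof.
apply: measurable_alive => // [v i|v]; [exact: measurable_marks|exact: measurable_clocks].
Qed.

Lemma measurable_branch u : measurable_fun setT (branch u).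
Proof. exact: measurable_relabel. Qed.

Lemma measurable_branch_preimage u (A : set Omega) : measurable A ->
  measurable (branch u @^-1` A).
Proof. by move=> mA; exact: (measurable_preimage (measurable_branch u) mA). Qed.

Lemma measurable_fun_section d (Y : measurableType d) d' (T : measurableType d')
    (Q : probability T R) (A : set (Y * T)) :
  measurable A -> measurable_fun setT (fun y => Q [set w | A (y, w)]).
Proof.
move=> mA; rewrite (_ : (fun y => _) = Q \o xsection A).
  exact: measurable_fun_xsection.
apply/funext => y /=; congr (Q _).
by apply/seteqP; split => w'; rewrite /xsection/= inE.
Qed.

Variables (mu : bool -> probability (mark_space R) R) (PP : probability Omega R).
Hypothesis PP_prod : product_law (fun k => mu k.1) PP.

Lemma branch_law u (A : set Omega) : measurable A -> PP A = PP (branch u @^-1` A).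
Proof.
apply: (relabel_law PP_prod (f := fun k => (k.1, k.2 ++ u))) => //.
by move=> [b v] [b' v'] /= [-> /cat_injl ->].
Qed.

(** The subtrees of distinct children of the root involve disjoint sets of
    coordinates.  Words start with their last letter, so the child of the root
    from which a word descends is the last entry of the list. *)
Lemma child_branches_law n (B : nat -> set Omega) :
  (forall i, measurable (B i)) ->
  PP [set w | forall i, (i < n)%N -> B i (branch [:: i] w)] =
  (\prod_(i < n) fine (PP (B i)))%:E.
Proof.
move=> mB.
have mBn m : measurable [set w | forall i, (i < m)%N -> B i (branch [:: i] w)].
  rewrite (_ : [set w | _] = \bigcap_(i in [set i | (i < m)%N]) branch [:: i] @^-1` B i).
    apply: bigcap_measurableType => i _.
    exact: measurable_branch_preimage.
  by apply/seteqP; split => w /= H i; exact: H.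
elim: n => [|n IH].
  rewrite big_ord0 (_ : [set w | _] = setT) ?probability_setT//.
  by apply/seteqP; split.
pose D (k : bool * seq nat) := last n.+1 k.2 == n.
rewrite (recombine_law PP_prod (D := D) (f := id) (g := id) _ _ _ _ (mBn n.+1))//.
rewrite big_ord_recr/= EFinM -IH fineK; last by rewrite fin_num_measure.
rewrite (_ : _ @^-1` _ = branch [:: n] @^-1` B n `*`
    [set w | forall i, (i < n)%N -> B i (branch [:: i] w)]).
  rewrite (branch_law [:: n] (mB n)) muleC.
  apply: product_measure1E => //; exact: measurable_branch_preimage.
have E1 w w' : branch [:: n] (recombine D id id w w') = branch [:: n] w.
  by apply/funext => k; rewrite /branch /recombine /D/= last_cat/= eqxx.
have E2 w w' i : (i < n)%N -> branch [:: i] (recombine D id id w w') = branch [:: i] w'.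
  by move=> ni; apply/funext => k; rewrite /branch /recombine /D/= last_cat/= ltn_eqF.
apply/seteqP; split => -[w w'] /=.
  by move=> H; split => [|i ni]; [have := H n (ltnSn n); rewrite E1
    |have := H i (ltnW ni); rewrite E2].
move=> [H1 H2] i; rewrite ltnS leq_eqVlt => /orP[/eqP ->|ni]; first by rewrite E1.
by rewrite E2//; exact: H2.
Qed.

(** The marks and the clock of the root are independent of all the others. *)
Lemma probability_root (A : set Omega) : measurable A ->
  PP A = (\int[PP]_w PP [set w' | A (recombine (fun k => k.2 == [::]) id id w w')])%E.
Proof. exact: (probability_recombine PP_prod). Qed.

Lemma root_branch w w' i :
  branch [:: i] (recombine (fun k => k.2 == [::]) id id w w') = branch [:: i] w'.
Proof. by apply/funext => -[b [|j v]]. Qed.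

Section maximal_size.
Variable p : R.
Hypothesis p0 : 0 < p.
Hypothesis mean_powers :
  (\int[PP]_w \sum_(0 <= i <oo) (`|marks_of w [::] i| `^ p)%:E <= 1)%E.

Definition reaches (n : nat) (C x : R) : set Omega :=
  [set w | exists u, (size u <= n)%N /\ C <= `|isize x (marks_of w) u|].

Lemma measurable_reaches d (Y : measurableType d) n C (x : Y -> R) (f : Y -> Omega) :
  measurable_fun setT x -> measurable_fun setT f ->
  measurable [set y | reaches n C (x y) (f y)].
Proof.
move=> mx mf; apply: countable_bigcup_measurable => u.
case: (leqP (size u) n) => un; last first.
  by rewrite (_ : (fun _ => _) = set0)//; apply/seteqP; split => y // [].
rewrite (_ : (fun _ => _) = [set y | C <= `|isize (x y) (marks_of (f y)) u|]); last first.
  by apply/seteqP; split => y // [].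
apply: measurable_bool_set; apply: measurable_fun_ler => //.
apply: measurableT_comp => //; apply: measurable_isize => // v i.
by apply: (measurableT_comp (measurable_marks v i)).
Qed.

(** By induction on the number of generations and a union bound over the
    children of the root: the bounds (xi_i x / C) ^ p for their subtrees have
    an expected sum of at most (x / C) ^ p, as the p-th powers of the marks have
    expected sum at most 1. *)
Lemma reaches_bound n (C x : R) : 0 < C -> (PP (reaches n C x) <= ((`|x| / C) `^ p)%:E)%E.
Proof.
move=> C0.
have mr m y : measurable (reaches m C y) by 
  exact: (@measurable_reaches _ Omega m C (fun=> y) id).
have big1 (y : R) : C <= `|y| -> (1 <= ((`|y| / C) `^ p)%:E)%E.
  move=> Cy; rewrite lee_fin; have -> : 1 = 1 `^ p :> R by rewrite powR1.
  apply: ge0_ler_powR; rewrite ?nnegrE ?divr_ge0 ?(ltW p0) ?(ltW C0)//.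
  by rewrite ler_pdivlMr// mul1r.
elim: n x => [|n IH] x; have [Cx|xC] := leP C `|x|.
- by apply: le_trans (big1 _ Cx); exact: probability_le1.
- rewrite (_ : reaches _ _ _ = set0) ?measure0 ?lee_fin ?powR_ge0//.
  by apply/seteqP; split => w // -[[|i u] []] //= _; rewrite leNgt xC.
- by apply: le_trans (big1 _ Cx); exact: probability_le1.
rewrite probability_root//.
have mrb w i : measurable (branch [:: i] @^-1` reaches n C (marks_of w [::] i * x)).
  exact: measurable_branch_preimage.
have mrec (w : Omega) : measurable_fun setT (recombine (fun k : bool * seq nat => k.2 == [::]) id id w).
  exact: (measurableT_comp (@measurable_recombine _ _ (mark_space R) (fun k => k.2 == [::]) id id) (pair1_measurable w)).
have pw0 (w : Omega) i : (0 <= (`|marks_of w [::] i| `^ p)%:E)%E.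
  by rewrite lee_fin powR_ge0.
have mpw i : measurable_fun setT (fun w : Omega => (`|marks_of w [::] i| `^ p)%:E).
  apply/measurable_EFinP; apply: (measurableT_comp (measurable_powR p)).
  by apply: measurableT_comp => //; exact: measurable_marks.
apply: (@le_trans _ _ (\int[PP]_w \sum_(0 <= i <oo)
   ((`|x| / C) `^ p)%:E * (`|marks_of w [::] i| `^ p)%:E)%E); last first.
  under eq_integral do rewrite nneseriesZl//.
  rewrite ge0_integralZl ?lee_fin ?powR_ge0//.
  - by rewrite -[leRHS]mule1 lee_wpmul2l// lee_fin powR_ge0.
  - by apply: ge0_emeasurable_sum => //.
  - by move=> w _; exact: nneseries_ge0.
apply: ge0_le_integral => //.
- apply: (@measurable_fun_section _ Omega _ Omega PP [set ww | reaches n.+1 C x (recombine (fun k => k.2 == [::]) id id ww.1 ww.2)]).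
  apply: (@measurable_reaches _ (Omega * Omega)%type n.+1 C (fun=> x)
    (fun ww => recombine (fun k => k.2 == [::]) id id ww.1 ww.2)).
    exact: measurable_cst.
  exact: measurable_recombine.
- apply: ge0_emeasurable_sum => [i w _ _|i _].
    by rewrite mule_ge0// lee_fin powR_ge0.
  by apply: measurable_funeM.
move=> w _.
apply: (@le_trans _ _ (PP (\bigcup_i branch [:: i] @^-1` reaches n C (marks_of w [::] i * x)))).
  apply: le_measure; rewrite ?inE.
  + exact: (@measurable_reaches _ Omega n.+1 C (fun=> x) _).
  + exact: bigcup_measurable.
  move=> w' [u]; case/lastP: u => [|v i] [].
    by move=> _ /=; rewrite leNgt xC.
  rewrite size_rcons ltnS => vn; rewrite -cats1 isize_cat /= => Cv.
  exists i => //; exists v; split => //.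
  by rewrite -(root_branch w w' i); exact: Cv.
apply: (le_trans (measure_sigma_subadditive _ _ _ _)).
- by move=> i; exact: (mrb w i).
- by apply: bigcup_measurable => i _; exact: (mrb w i).
- exact: subset_refl.
apply: lee_nneseries => // i _.
have := IH (marks_of w [::] i * x); rewrite (branch_law [:: i])//.
move=> /le_trans; apply; rewrite -EFinM lee_fin.
have -> : `|marks_of w [::] i * x| / C = (`|x| / C) * `|marks_of w [::] i|.
  by rewrite normrM mulrAC mulrC mulrA mulrAC.
by rewrite powRM// divr_ge0// ltW.
Qed.

End maximal_size.

End canonical.

(** * An integral criterion of Osgood type *)

Section fall.
Context {R : realType}.
Local Notation leb := (@lebesgue_measure R).

Lemma ge0_integral_translation (h : R) (f : R -> \bar R) :
  measurable_fun setT f -> (forall u, 0 <= f u)%E ->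
  (\int[leb]_u f (u + h)%R = \int[leb]_u f u)%E.
Proof.
move=> mf f0.
pose s := (fun u => u + h) : measurableTypeR R -> measurableTypeR R.
have ms : measurable_fun setT s by exact: measurable_funD.
transitivity (\int[pushforward leb s]_u f u)%E.
  by rewrite ge0_integral_pushforward.
apply: eq_measure_integral => //= A mA _; apply/esym.
apply: (lebesgue_measure_unique (mu := pushforward leb (mfun_of ms))) => //= _ [[a b]] _ <-.
change (leb `]a, b] = leb ((fun u => u + h) @^-1` `]a, b])).
rewrite (_ : _ @^-1` _ = `]a - h, b - h]%classic).
  by rewrite !lebesgue_measure_itv/= !lte_fin ltrD2r; case: ifP => // _;
    rewrite -!EFinB; congr EFin; ring.
by apply/seteqP; split => u /=; rewrite !in_itv/= ltrBlDr lerBrDr.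
Qed.

(** The integrals of T and of its translate nearly cancel: what remains is the
    integral of T on an interval of length h, where T is at most M. *)
Lemma integral_difference_quotient (T : R -> R) (a M h : R) : 0 < h -> a < 1 ->
  measurable_fun setT T -> (forall u, 0 <= T u <= M) ->
  {homo T : u v / u <= v >-> v <= u} -> (forall u, 1 <= u -> T u = 0) ->
  (\int[leb]_(u in `]a, 1%R[) (h^-1 * (T u - T (u + h)))%R%:E <= M%:E)%E.
Proof.
move=> h0 a1 mT TM Tni T1.
have T0 u : 0 <= T u by have /andP[] := TM u.
have M0 : 0 <= M by have /andP[/le_trans] := TM 0; apply.
have uh (u : R) : u <= u + h by rewrite lerDl ltW.
have mTh : measurable_fun setT (fun u : R => T (u + h)).
  by apply: measurableT_comp => //; exact: measurable_funD.
have mD : measurable_fun setT (fun u : R => T u - T (u + h)) by exact: measurable_funB.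
have mE (f : R -> R) (D : set R) : measurable_fun setT f -> measurable_fun D (EFin \o f).
  by move=> mf; apply/measurable_EFinP; exact: measurable_funTS.
under eq_integral do rewrite EFinM.
rewrite ge0_integralZl//; last 3 first.
- exact: mE.
- by move=> u _; rewrite lee_fin subr_ge0; exact: Tni.
- by rewrite lee_fin invr_ge0 ltW.
rewrite lee_pdivrMl//.
set J := (\int[leb]_(u in `]a, 1%R[) (T (u + h)%R)%:E)%E.
have JE : J = (\int[leb]_(u in `](a + h)%R, (1 + h)%R[) (T u)%:E)%E.
  rewrite /J integral_mkcond [RHS]integral_mkcond.
  rewrite -(@ge0_integral_translation h ((fun x : R => (T x)%:E) \_ `]a + h, 1 + h[)).
  - apply: eq_integral => u _; rewrite /patch.
    suff -> : (u + h \in `]a + h, 1 + h[%classic) = (u \in `]a, 1[%classic) by [].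
    by apply/idP/idP; rewrite !inE/= !in_itv/= !ltrD2r.
  - by apply/(measurable_restrictT _ _).1 => //; exact: mE.
  - by move=> u; rewrite /patch; case: ifP; rewrite // lee_fin.
have fin (D : set R) (c d : R) : D `<=` `]c, d[%classic -> measurable D -> (\int[leb]_(u in D) (T u)%:E < +oo)%E.
  move=> Dcd mD'; apply: (@le_lt_trans _ _ (\int[leb]_(u in `]c, d[) M%:E)%E).
    apply: (@le_trans _ _ (\int[leb]_(u in D) M%:E)%E).
      apply: ge0_le_integral => //.
      - by move=> u _; rewrite lee_fin.
      - exact: mE.
      - by move=> u _; rewrite lee_fin; have /andP[] := TM u.
    apply: ge0_subset_integral => //.
  rewrite integral_cst//= lebesgue_measure_itv/=; case: ifP => _; last by rewrite mule0 ltry.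
  by rewrite -EFinB -EFinM ltry.
have Jfin : J \is a fin_num.
  rewrite ge0_fin_numE; last by apply: integral_ge0 => u _; rewrite lee_fin.
  by rewrite JE; exact: (fin _ (a + h) (1 + h)).
rewrite -(leeD2rE _ _ Jfin) -ge0_integralD//; last 4 first.
- by move=> u _; rewrite lee_fin subr_ge0; exact: Tni.
- exact: mE.
- by move=> u _; rewrite lee_fin.
- exact: mE.
under eq_integral do rewrite -EFinD subrK.
apply: (@le_trans _ _ (\int[leb]_(u in `]a, (a + h)%R] `|` `](a + h)%R, (1 + h)%R[) (T u)%:E)%E).
  apply: ge0_subset_integral => //; first exact: measurableU.
    exact: mE.
  - by move=> u _; rewrite lee_fin.
  - move=> u /=; rewrite !in_itv/= => /andP[au u1]; have [uah|ahu] := leP u (a + h).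
      by left; rewrite au.
    by right; rewrite (lt_trans u1)// ltrDl.
rewrite ge0_integral_setU//; last 3 first.
- exact: mE.
- by move=> u _; rewrite lee_fin.
- apply/disj_setPLR => u /=; rewrite !in_itv/= => /andP[_ uh']; apply/negP.
  by rewrite ltNge uh'.
rewrite -JE leeD2r//.
apply: (@le_trans _ _ (\int[leb]_(u in `]a, (a + h)%R]) M%:E)%E).
  apply: ge0_le_integral => //.
  - by move=> u _; rewrite lee_fin.
  - exact: mE.
  - by move=> u _; rewrite lee_fin; have /andP[] := TM u.
rewrite integral_cst//= lebesgue_measure_itv/= lte_fin ltrDl h0 -EFinB -EFinM.
by rewrite lee_fin; lra.
Qed.

(** The last hypothesis on q is an integrated form of q' >= F(q) - q.  If
    F(u) >= u for all u, it prevents q from decreasing at all.  Otherwise F(u) < u near 1,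
    and if q were below 1 at time t1, its inverse T would take values in [0, t1]
    and satisfy -T' >= 1 / (u - F(u)); the integral of the latter function near 1 would
    then be at most t1, instead of infinite.  As q is not known to be
    differentiable, T' is replaced by difference quotients. *)
Lemma no_fall (F q : R -> R) :
  (forall u v, 0 <= u -> u <= v -> v <= 1 -> F u <= F v) ->
  (forall u, 0 <= u <= 1 -> 0 <= F u) -> F 1 = 1 ->
  (forall u v, 0 <= u < 1 -> F u < u -> u < v < 1 -> F v < v) ->
  (forall eps : R, 0 < eps -> (forall u, 1 - eps < u < 1 -> F u < u) ->
    (\int[lebesgue_measure]_(u in `](1 - eps)%R, 1%R[) ((u - F u)^-1)%:E = +oo)%E) ->
  (forall t, 0 <= q t <= 1) -> (forall t, t < 0 -> q t = 1) ->
  {homo q : s t / s <= t >-> t <= s} ->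
  (forall t h, 0 <= h -> q t - q (t + h) <= h * (q t - F (q (t + h)))) ->
  forall t, q t = 1.
Proof.
move=> Fnd F0 F1 Fcvx expl q01 qneg qni qode t1.
have q0 t : 0 <= q t by have /andP[] := q01 t.
have q1 t : q t <= 1 by have /andP[] := q01 t.
have [[u0 u01 Fu0]|HF] := pselect (exists2 u, 0 <= u < 1 & F u < u); last first.
  have Fge u : 0 <= u <= 1 -> u <= F u.
    move=> /andP[u0]; rewrite le_eqVlt => /orP[/eqP ->|u1]; first by rewrite F1.
    by rewrite leNgt; apply/negP => Fu; apply: HF; exists u => //; rewrite u0.
  have step t : q (t + 1/2) = q t.
    apply/eqP; rewrite eq_le qni ?lerDl//=; have := qode t (1/2).
    have := Fge _ (q01 (t + 1/2)); lra.
  have {}step n t : q (t + n%:R * (1/2)) = q t.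
    elim: n => [|n IH]; first by rewrite mul0r addr0.
    by rewrite -natr1 mulrDl [1 * (1 / 2)]mul1r addrA step.
  pose n := (Num.trunc `|t1|).+1.*2.
  rewrite -(subrK (n%:R * (1/2)) t1) step qneg// subr_lt0.
  rewrite /n -mul2n natrM mulrAC mul1r mulfV// mul1r.
  by rewrite (le_lt_trans (ler_norm _))// truncnS_gt.
apply/eqP; rewrite eq_le q1 leNgt; apply/negP => qt1.
have lip t h : 0 <= h -> q t - q (t + h) <= h.
  move=> h0; apply: (le_trans (qode _ _ h0)); rewrite -[leRHS]mulr1 ler_wpM2l//.
  by have := F0 _ (q01 (t + h)); have := q1 t; lra.
have q00 : q 0 = 1.
  apply/eqP; rewrite eq_le q1 /=; apply/ler_addgt0Pr => h h0.
  have := lip (- h) h (ltW h0); rewrite addNr qneg ?oppr_lt0//; lra.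
have t10 : 0 <= t1 by rewrite leNgt; apply/negP => /qneg E; rewrite E ltxx in qt1.
pose a := Num.max u0 (q t1).
have a1 : a < 1 by rewrite gt_max qt1 andbT; have /andP[] := u01.
have a0 : 0 <= a by rewrite le_max; have /andP[->] := u01.
have qa : q t1 <= a by rewrite le_max lexx orbT.
have Fa u : a < u -> u < 1 -> F u < u.
  move=> au u1; apply: (Fcvx u0) => //; rewrite u1 andbT (le_lt_trans _ au)//.
  by rewrite le_max lexx.
(* T u is the last time before t1 at which q is at least u *)
pose S u := [set t | t = 0 \/ (0 <= t <= t1 /\ u <= q t)].
have S0 u : S u 0 by left.
have Sub u : ubound (S u) t1 by move=> t [->|[/andP[]]].
have hS u : has_sup (S u) by split; [exists 0|exists t1].
pose T u := if u < 1 then sup (S u) else 0.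
have supS u : 0 <= sup (S u) <= t1.
  by apply/andP; split; [apply: sup_upper_bound => //|apply: sup_le_ub => //; exists 0].
have TM u : 0 <= T u <= t1 by rewrite /T; case: ifP; rewrite // lexx.
have Tni : {homo T : u v / u <= v >-> v <= u}.
  move=> u v uv; rewrite /T; case: ifPn => v1; last by case: ifP => //; have /andP[] := supS u.
  rewrite (le_lt_trans uv v1); apply: sup_le_ub; first by exists 0.
  move=> t St; apply: sup_upper_bound => //.
  by case: St => [->|[h1 h2]]; [left|right; split=> //; exact: le_trans h2].
have qT u : a < u -> u < 1 -> q (T u) = u.
  move=> au u1; rewrite /T u1; set s := sup (S u).
  have /andP[s0 st1] := supS u.
  have us : u <= q s.
    apply/ler_addgt0Pr => h h0.
    have [t St st] := sup_adherent h0 (hS u); rewrite -/s in st.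
    have ut : u <= q t by case: St => [->|[]//]; rewrite q00 ltW.
    have ts : t <= s by exact: sup_upper_bound.
    have := lip t (s - t); rewrite subr_ge0 => /(_ ts).
    have -> : t + (s - t) = s by ring.
    lra.
  apply/eqP; rewrite eq_le us andbT; apply/ler_addgt0Pr => h h0.
  have st : s < t1.
    rewrite lt_neqAle st1 andbT; apply/eqP => E; move: us; rewrite E; lra.
  pose k := Num.min h (t1 - s).
  have k0 : 0 < k by rewrite lt_min h0 subr_gt0.
  have kh : k <= h by rewrite ge_min lexx.
  have kt : s + k <= t1 by rewrite -lerBrDl ge_min lexx orbT.
  have := lip s k (ltW k0).
  suff : q (s + k) < u by lra.
  rewrite ltNge; apply/negP => uq.
  have : s + k <= s by apply: sup_upper_bound => //; right; split=> //; rewrite kt addr_ge0// ltW.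
  lra.
have Tquot u h : 0 < h -> a < u -> u + h < 1 ->
    (u + h - F u)^-1 <= h^-1 * (T u - T (u + h)).
  move=> h0 au uh1; have u1 : u < 1 by lra.
  have Fu := Fa _ au u1.
  have D0 : 0 < u + h - F u by lra.
  have := qode (T (u + h)) (T u - T (u + h)).
  rewrite subr_ge0 Tni ?lerDl ?(ltW h0)// => /(_ isT).
  have -> : T (u + h) + (T u - T (u + h)) = T u by ring.
  have auh : a < u + h by lra.
  rewrite (qT _ au u1) (qT _ auh uh1).
  move=> H; rewrite ler_pdivlMl// ler_pdivrMr//; move: H; lra.
have mF (D : set R) : measurable D -> D `<=` `[0, 1]%classic -> measurable_fun D F.
  move=> mD D01.
  have mF' : measurable_fun D (fun u => F (Num.max 0 (Num.min u 1))).
    apply: nondecreasing_measurable => // u v uv; apply: Fnd.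
    - by rewrite le_max lexx.
    - by rewrite ge_max !le_max lexx/= le_min !ge_min uv lexx !orbT.
    - by rewrite ge_max ler01 ge_min lexx orbT.
  apply: eq_measurable_fun mF' => u /set_mem/D01.
  by rewrite /= in_itv/= => /andP[u0' u1]; rewrite (min_idPl u1) (max_idPr u0').
pose h (n : nat) : R := n.+1%:R^-1.
have h0 n : 0 < h n by rewrite invr_gt0.
(* the quotient bound Tquot with h := h n only holds for u + h n < 1; these
   truncations increase to (u - F u)^-1 as n grows *)
pose g n u := if u + h n < 1 then (u + h n - F u)^-1 else 0.
have a01 : `]a, 1[%classic `<=` `[0, 1]%classic.
  by move=> u /=; rewrite !in_itv/= => /andP[au u1]; rewrite (ltW u1) (le_trans a0)// ltW.
have g0 n u : `]a, 1[%classic u -> 0 <= g n u.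
  rewrite /= in_itv/= => /andP[au u1]; rewrite /g; case: ifP => // _.
  by rewrite invr_ge0; have := Fa _ au u1; have := h0 n; lra.
have mg n : measurable_fun `]a, 1[%classic (g n).
  have mg' : measurable_fun `]a, 1[%classic (fun u => (u + h n - F u) `^ (-1)).
    apply: (measurableT_comp (measurable_powR _)).
    apply: measurable_funB; last exact: mF.
    by apply: measurable_funD => //.
  have {}mg' : measurable_fun `]a, 1[%classic (fun u => (u + h n - F u)^-1).
    apply: eq_measurable_fun mg' => u /set_mem; rewrite /= in_itv/= => /andP[au u1].
    by rewrite powR_inv1//; have := Fa _ au u1; have := h0 n; lra.
  apply: measurable_fun_if => //.
  - by apply: measurable_fun_ltr => //; apply: measurable_funD => //.
  - by apply: measurable_funS mg' => //; exact: subIsetl.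
have mT : measurable_fun setT T.
  by apply: nonincreasing_measurable => // u v; exact: Tni.
have mTh n : measurable_fun setT (fun u : R => T (u + h n)).
  by apply: measurableT_comp => //; exact: measurable_funD.
have gnd u : `]a, 1[%classic u -> {homo (g ^~ u) : m n / (m <= n)%N >-> m <= n}.
  rewrite /= in_itv/= => /andP[au u1] m n mn; rewrite /g.
  have hmn : h n <= h m by rewrite lef_pV2 ?posrE// ler_nat.
  have Fu := Fa _ au u1; have hn0 := h0 n.
  case: ifPn => [um|_].
    have -> : u + h n < 1 by lra.
    by rewrite lef_pV2 ?posrE//; lra.
  by case: ifP => // _; rewrite invr_ge0; lra.
have gint n : (\int[leb]_(u in `]a, 1%R[) (g n u)%:E <= t1%:E)%E.
  apply: le_trans (integral_difference_quotient (h0 n) a1 mT TM Tni _).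
  - apply: ge0_le_integral => //.
    + by move=> u au; rewrite lee_fin; exact: g0.
    + apply/measurable_EFinP; exact: mg.
    + apply/measurable_EFinP/measurable_funTS; apply: measurable_funM => //.
      by apply: measurable_funB => //; exact: mTh.
    + move=> u /=; rewrite in_itv/= => /andP[au u1]; rewrite lee_fin /g.
      case: ifPn => uh; first exact: Tquot.
      apply: mulr_ge0; first by rewrite invr_ge0 ltW.
      by rewrite subr_ge0; apply: Tni; rewrite lerDl ltW.
  - by move=> u u1; rewrite /T ltNge u1.
have : (\int[leb]_(u in `]a, 1%R[) ((u - F u)^-1)%:E <= t1%:E)%E.
  rewrite (_ : (\int[leb]_(u in `]a, 1%R[) ((u - F u)^-1)%:E)%E =
      (\int[leb]_(u in `]a, 1%R[) limn (fun n => (g n u)%:E))%E).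
    rewrite monotone_convergence//.
    - apply: lime_le; last by apply: nearW => n; exact: gint.
      apply: ereal_nondecreasing_is_cvgn => m n mn; apply: ge0_le_integral => //.
      + by move=> u au; rewrite lee_fin; exact: g0.
      + apply/measurable_EFinP; exact: mg.
      + apply/measurable_EFinP; exact: mg.
      + by move=> u au; rewrite lee_fin; exact: gnd.
    - by move=> n; apply/measurable_EFinP; exact: mg.
  apply: eq_integral => u; rewrite inE/= in_itv/= => /andP[au u1].
  apply/esym/cvg_lim => //; apply/cvg_EFin; first by near=> n.
  have Fu := Fa _ au u1.
  have : (u + h n - F u)^-1 @[n --> \oo] --> (u - F u)^-1.
    apply: cvgV; first by rewrite gt_eqF// subr_gt0.
    apply: cvgB; last exact: cvg_cst.
    rewrite -[X in _ --> X]addr0; apply: cvgD; first exact: cvg_cst.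
    exact: cvg_harmonic.
  apply: cvg_trans; apply: near_eq_cvg; near=> n.
  rewrite /= /g ifT// -ltrBrDl; near: n.
  have : 0 < 1 - u by rewrite subr_gt0.
  by move=> /(cvgr_lt (0:R)); apply; exact: cvg_harmonic.
rewrite leNgt => /negP; apply.
have := expl (1 - a); rewrite subr_gt0 => /(_ a1); rewrite opprB addrC subrK => -> //.
  exact: ltry.
by move=> u /andP[au u1]; exact: Fa.
Unshelve. all: by end_near.
Qed.

End fall.

Section exponential_integrals.
Context {R : realType}.
Variable Q : probability R R.
Hypothesis QE : forall B, measurable B -> Q B = exponential_prob 1 B.

Lemma memoryless_integral (c : R) (f : R -> \bar R) : 0 <= c ->
  measurable_fun setT f -> (forall y, 0 <= f y)%E ->
  (\int[Q]_(y in `]c, +oo[) f (y - c)%R =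
   Q `]c, +oo[%classic * \int[Q]_(y in `]0%R, +oo[) f y)%E.
Proof.
move=> c0 mf f0.
pose s' (y : R) : R := if c < y then y - c else -1.
have ms : measurable_fun setT s'.
  apply: measurable_fun_ifT => //; last exact: measurable_funB.
  exact: measurable_fun_ltr.
pose p := fine (Q `]c, +oo[%classic).
have p0 : 0 <= p by rewrite fine_ge0.
have pE : Q `]c, +oo[%classic = p%:E by rewrite fineK// fin_num_measure.
have sE : s' @^-1` `]0, +oo[%classic = `]c, +oo[%classic.
  apply/seteqP; split => y /=; rewrite !in_itv/= !andbT /s'; case: ifPn => // cy.
    by rewrite ltr0N1.
  by rewrite subr_gt0.
transitivity (\int[distribution Q (mfun_of ms)]_(y in `]0%R, +oo[) f y)%E.
  rewrite ge0_integral_pushforward//; last exact: measurable_funTS.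
  rewrite -sE; apply: eq_integral => y; rewrite inE sE /= in_itv/= andbT => cy.
  by rewrite /s' cy.
transitivity (\int[mscale (NngNum p0) Q]_(y in `]0%R, +oo[) f y)%E; last first.
  by rewrite ge0_integral_mscale// ?pE//; exact: measurable_funTS.
apply: eq_measure_integral => A mA A0.
change (Q (s' @^-1` A) = (p%:E * Q A)%E).
have Ec : [set y : R | c < y] = `]c, +oo[%classic.
  by apply/seteqP; split => y /=; rewrite in_itv/= andbT.
rewrite -pE -Ec -(exponential_memoryless QE)//; congr (Q _).
apply/seteqP; split => y /=; rewrite /s'; case: ifPn => // cy; last by case.
  by move=> /A0; rewrite /= in_itv/= ltr0N1.
by case.
Qed.

Lemma exponential_ge0 : Q [set y | 0 <= y] = 1%E.
Proof.
apply/eqP; rewrite eq_le probability_le1/=; last first.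
  rewrite (_ : [set y | _] = `[0, +oo[%classic)//.
  by apply/seteqP; split => y /=; rewrite in_itv/= andbT.
have <- : Q `]0, +oo[%classic = 1%E.
  by rewrite (exponential_tail QE) max_r// oppr0 expR0.
apply: le_measure; rewrite ?inE//.
  rewrite (_ : [set y | _] = `[0, +oo[%classic)//.
  by apply/seteqP; split => y /=; rewrite in_itv/= andbT.
by move=> y /=; rewrite in_itv/= andbT => /ltW.
Qed.

Lemma integral_split (a : R) (f : R -> \bar R) : measurable_fun setT f ->
  (forall y, 0 <= f y)%E ->
  (\int[Q]_y f y = \int[Q]_(y in `]a, +oo[) f y + \int[Q]_(y in `]-oo, a]) f y)%E.
Proof.
move=> mf f0; rewrite -ge0_integral_setU//.
- by rewrite -setCitvr setUv.
- exact: measurable_funTS.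
- apply/disj_setPLR => y /=; rewrite !in_itv/= andbT => hy; apply/negP.
  by rewrite -ltNge.
Qed.

(** Consider q (t + h).  With probability expR (- h) the clock y of the ancestor
    exceeds h, and by lack of memory the contribution is then q t; otherwise
    t + h - y is at most t + h, and f is nonincreasing.  Finally
    1 - expR (- h) is at most h. *)
Lemma renewal_step (f : R -> R) (q : R -> R) (t h : R) : 0 <= h ->
  measurable_fun setT f -> {homo f : s t / s <= t >-> t <= s} -> (forall s, 0 <= f s <= 1) ->
  (forall t, (q t)%:E = \int[Q]_y (f (t - Num.max 0 y))%:E)%E ->
  q t - q (t + h) <= h * (q t - f (t + h)).
Proof.
move=> h0 mf fni f01 qE.
have f0 s : 0 <= f s by have /andP[] := f01 s.
have mt s : measurable_fun setT (fun y : R => (f (s - Num.max 0 y))%:E).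
  apply/measurable_EFinP; apply: measurableT_comp => //.
  by apply: measurable_funB => //; apply: measurable_maxr.
have p1 : Q `]h, +oo[%classic = (expR (- h))%:E.
  by rewrite (exponential_tail QE) max_r.
have p2 : Q `]-oo, h]%classic = (1 - expR (- h))%:E.
  by rewrite -[X in Q X]setCK setCitvl probability_setC// p1 -EFinB.
have H1 : expR (- h) * q t + (1 - expR (- h)) * f (t + h) <= q (t + h).
  rewrite -lee_fin qE EFinD.
  rewrite (integral_split h (mt _)); last by move=> y; rewrite lee_fin.
  apply: leeD.
    have E : (\int[Q]_(y in `]h, +oo[) (f (t + h - Num.max 0 y))%:E =
        \int[Q]_(y in `]h, +oo[) (f (t - Num.max 0 (y - h)%R))%:E)%E.
      apply: eq_integral => y; rewrite inE/= in_itv/= andbT => hy.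
      by rewrite !max_r ?subr_ge0 ?(ltW hy) ?(le_trans h0 (ltW hy))// opprB addrA.
    rewrite E (memoryless_integral (f := fun y => (f (t - Num.max 0 y))%:E))//; last first.
      by move=> y; rewrite lee_fin.
    rewrite p1 EFinM lee_wpmul2l ?lee_fin ?expR_ge0// qE.
    rewrite (integral_split 0 (mt _)); last by move=> y; rewrite lee_fin.
    rewrite [X in (_ + X)%E](_ : _ = 0%E) ?adde0//.
    apply/eqP; rewrite eq_le integral_ge0 ?andbT; last by move=> y _; rewrite lee_fin.
    apply: (@le_trans _ _ (\int[Q]_(y in `]-oo, 0%R]) 1)%E).
      apply: ge0_le_integral => //.
      + by move=> y _; rewrite lee_fin.
      + exact: measurable_funTS.
      + by move=> y _; rewrite lee_fin; have /andP[] := f01 (t - Num.max 0 y).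
    rewrite integral_cst// mul1e le_eqVlt; apply/orP; left; apply/eqP.
    rewrite (_ : `]-oo, 0]%classic = ~` `]0, +oo[%classic); last by rewrite setCitvr.
    apply: (etrans (probability_setC Q _)) => //.
    by rewrite (exponential_tail QE) maxxx oppr0 expR0 subee.
  rewrite EFinM -p2 muleC -integral_cst//; apply: ge0_le_integral => //.
  - by move=> y _; rewrite lee_fin.
  - exact: measurable_funTS.
  - move=> y; rewrite /= in_itv/= => yh; rewrite lee_fin; apply: fni.
    by rewrite lerBlDr lerDl le_max lexx.
have H2 : f (t + h) <= q t.
  rewrite -lee_fin qE -[leLHS]mule1 -(probability_setT Q) -integral_cst//.
  apply: ge0_le_integral => //; first by move=> y _; rewrite lee_fin.
  move=> y _; rewrite lee_fin; apply: fni.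
  have : 0 <= Num.max 0 y :> R by rewrite le_max lexx.
  lra.
have H3 : 1 - expR (- h) <= h by have := expR_ge1Dx (- h); lra.
have := ler_wpM2r (_ : 0 <= q t - f (t + h)) H3; rewrite subr_ge0 => /(_ H2); lra.
Qed.

End exponential_integrals.

(** * Absence of explosion when all sizes are 1 *)

Section words.
Context {R : realType}.

(** Birth times in a tree where all sizes are 1.  Clocks are truncated at 0, so
    that birth times increase along lines of descent on the whole sample space
    and not only almost surely. *)
Fixpoint hbirth (e : seq nat -> R) (u : seq nat) : R :=
  if u is _ :: v then hbirth e v + Num.max 0 (e v) else 0.

Fixpoint viable (xi : seq nat -> nat -> R) (u : seq nat) : bool :=
  if u is i :: v then (0 < xi v i) && viable xi v else true.

Lemma hbirth_cat e u v :
  hbirth e (v ++ u) = hbirth e u + hbirth (fun z => e (z ++ u)) v.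
Proof. by elim: v => [|i v IH] /=; rewrite ?addr0// IH addrA. Qed.

Lemma viable_cat xi u v :
  viable xi (v ++ u) = viable (fun z => xi (z ++ u)) v && viable xi u.
Proof. by elim: v => //= i v ->; rewrite andbA. Qed.

Lemma hbirth_ge0 e u : 0 <= hbirth e u.
Proof. by elim: u => //= i u IH; rewrite addr_ge0// le_max lexx. Qed.

Lemma le_hbirth_cat e u v : hbirth e u <= hbirth e (v ++ u).
Proof. by rewrite hbirth_cat lerDl hbirth_ge0. Qed.

Definition child_count (z : nat -> R) (n : nat) := forall i, (0 < z i) = (i < n)%N.

Lemma child_count_inj z n m : child_count z n -> child_count z m -> n = m.
Proof.
move=> zn zm; apply/eqP; rewrite eqn_leq; apply/andP; split; rewrite leqNgt; apply/negP => h.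
  by have := zn m; rewrite zm ltnn h.
by have := zm n; rewrite zn ltnn h.
Qed.

Definition kids (z : nat -> R) : nat := xget 0%N [set n | child_count z n].

Lemma kidsE z n : child_count z n -> kids z = n.
Proof.
move=> zn; apply: (child_count_inj (z := z)) => //.
by rewrite /kids; case: xgetP => [m _|/(_ n)].
Qed.

Lemma measurable_child_count n : measurable [set z : mark_space R | child_count z n].
Proof.
apply: (@countable_bigcap_measurable nat _ (mark_space R) (fun i => [set z | (0 < z i) = (i < n)%N])) => i.
have mb : measurable_fun setT (fun z : mark_space R => 0 < z i).
  by apply: measurable_fun_ltr => //; exact: (@measurable_coordinate nat _ R i).
by have := mb measurableT [set (i < n)%N]; rewrite setTI; apply.
Qed.

Lemma measurable_child_count_of u n :
  measurable [set w : tree_space R | child_count (marks_of w u) n].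
Proof.
exact: (measurable_preimage (@measurable_coordinate _ _ (mark_space R) (true, u))
  (measurable_child_count n)).
Qed.

Lemma measurable_kids : measurable_fun setT (kids : mark_space R -> nat).
Proof.
apply: measurable_fun_natP => n.
rewrite (_ : _ @^-1` _ = [set z | child_count z n] `|`
   (if n == 0%N then ~` [set z | exists m, child_count z m] else set0)).
  apply: measurableU; first exact: measurable_child_count.
  case: ifP => // _; apply: measurableC.
  apply: (@countable_bigcup_measurable nat _ (mark_space R) (fun m => [set z | child_count z m])) => m.
  exact: measurable_child_count.
apply/seteqP; split => z /=.
  rewrite /kids; case: xgetP => [m _ zm <-|nz <-]; first by left.
  by right => /= -[m zm]; exact: (nz m).
move=> [/kidsE//|]; case: ifPn => // /eqP -> nz.
by rewrite /kids; case: xgetP => // m _ zm; exfalso; apply: nz; exists m.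
Qed.

End words.

Lemma integral_constant d (T : measurableType d) (R : realType)
  (P : probability T R) (r : R) : (\int[P]_w r%:E = r%:E)%E.
Proof.
rewrite integral_cst// -[RHS]mule1; congr (_ * _)%E.
exact: probability_setT.
Qed.

Section non_explosion.
Context {R : realType}.
Local Notation Omega := (tree_space R).
Variables (mu : bool -> probability (mark_space R) R) (PP : probability Omega R).
Hypothesis PP_prod : product_law (fun k => mu k.1) PP.
Variable Q : probability R R.
Hypothesis QE : forall B, measurable B -> Q B = exponential_prob 1 B.
Hypothesis clock_law : forall B, measurable B ->
  PP [set w | B (clocks_of w [::])] = Q B.
Hypothesis finite_progeny : PP [set w | exists n, child_count (marks_of w [::]) n] = 1%E.

Definition dies_out (t : R) : set Omega := [set w | exists n, forall u,
  size u = n -> viable (marks_of w) u -> t < hbirth (clocks_of w) u].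

Lemma measurable_hbirth d (Y : measurableType d) (e : Y -> seq nat -> R) u :
  (forall v, measurable_fun setT (fun y => e y v)) ->
  measurable_fun setT (fun y => hbirth (e y) u).
Proof.
move=> me; elim: u => [|i u IH] /=; first exact: measurable_cst.
by apply: measurable_funD => //; exact: measurable_maxr.
Qed.

Lemma measurable_viable d (Y : measurableType d) (xi : Y -> seq nat -> nat -> R) u :
  (forall v i, measurable_fun setT (fun y => xi y v i)) ->
  measurable_fun setT (fun y => viable (xi y) u).
Proof.
move=> mxi; elim: u => [|i u IH] /=; first exact: measurable_cst.
by apply: measurable_and => //; exact: measurable_fun_ltr.
Qed.

Lemma measurable_dies_out d (Y : measurableType d) (t : Y -> R) (f : Y -> Omega) :
  measurable_fun setT t -> measurable_fun setT f ->
  measurable [set y | dies_out (t y) (f y)].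
Proof.
move=> mt mf; apply: countable_bigcup_measurable => n.
apply: countable_bigcap_measurable => u.
rewrite (_ : (fun y => _) = [set y | (size u == n) ==> viable (marks_of (f y)) u ==>
   (t y < hbirth (clocks_of (f y)) u)]).
  apply: measurable_bool_set; case: (size u == n) => //=.
  under eq_fun do rewrite implybE; apply: measurable_or.
    apply: measurable_neg; apply: measurable_viable => v i.
    exact: (measurableT_comp (measurable_marks v i)).
  apply: measurable_fun_ltr => //; apply: measurable_hbirth => v.
  exact: (measurableT_comp (measurable_clocks v)).
apply/seteqP; split => y /=.
  by move=> H; apply/implyP => /eqP un; apply/implyP; exact: H.
by move=> H /eqP un v; move: H; rewrite un v.
Qed.

Lemma measurable_dies_out1 t : measurable (dies_out t).
Proof. exact: (@measurable_dies_out _ Omega (fun=> t) id). Qed.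

Lemma dies_out_mono (t : R) (w : Omega) n : (forall u, size u = n -> viable (marks_of w) u ->
    t < hbirth (clocks_of w) u) ->
  forall u, (n <= size u)%N -> viable (marks_of w) u -> t < hbirth (clocks_of w) u.
Proof.
move=> H u nu; rewrite -(cat_take_drop (size u - n) u) viable_cat => /andP[_ vu].
apply: (lt_le_trans (H _ _ vu)); last exact: le_hbirth_cat.
by rewrite size_drop subKn.
Qed.

Definition no_explosion t : R := fine (PP (dies_out t)).
Local Notation q := no_explosion.

Lemma no_explosionE t : (q t)%:E = PP (dies_out t).
Proof. by rewrite fineK// fin_num_measure//; exact: measurable_dies_out1. Qed.

Lemma no_explosion01 t : 0 <= q t <= 1.
Proof.
rewrite fine_ge0//= -lee_fin no_explosionE.
by rewrite probability_le1//; exact: measurable_dies_out1.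
Qed.

Lemma no_explosion_neg t : t < 0 -> q t = 1.
Proof.
move=> t0; apply: EFin_inj; rewrite no_explosionE -(probability_setT PP); congr (PP _).
by apply/seteqP; split => // w _; exists 0%N => -[].
Qed.

Lemma no_explosion_ni : {homo q : s t / s <= t >-> t <= s}.
Proof.
move=> s t st; rewrite -lee_fin !no_explosionE.
apply: le_measure; rewrite ?inE; [exact: measurable_dies_out1..|].
by move=> w [n H]; exists n => u un vu; exact: le_lt_trans (H _ un vu).
Qed.

Lemma measurable_no_explosion : measurable_fun setT q.
Proof. by apply: nonincreasing_measurable => //; exact: no_explosion_ni. Qed.

(** The generation that is late in the whole tree can be chosen one after the
    latest of the generations given by the finitely many children. *)
Lemma dies_out_root (t : R) (w w' : Omega) : child_count (marks_of w [::]) (kids (marks_of w [::])) ->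
  dies_out t (recombine (fun k => k.2 == [::]) id id w w') <->
  (forall i, (i < kids (marks_of w [::]))%N ->
     dies_out (t - Num.max 0 (clocks_of w [::])) (branch [:: i] w')).
Proof.
set N := kids _; move=> wN; set r := recombine _ _ _ _ _.
have hb v i : hbirth (clocks_of r) (v ++ [:: i]) =
    Num.max 0 (clocks_of w [::]) + hbirth (clocks_of (branch [:: i] w')) v.
  by rewrite hbirth_cat /= add0r -(root_branch w w' i).
have vb v i : viable (marks_of r) (v ++ [:: i]) =
    viable (marks_of (branch [:: i] w')) v && (i < N)%N.
  by rewrite viable_cat /= andbT -(wN i) -(root_branch w w' i).
split=> [[[|n] H] i iN|H].
- exists 0%N => -[|//] _ _ /=.
  have /= := H [::] erefl isT; have : 0 <= Num.max 0 (clocks_of w [::]) by rewrite le_max lexx.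
  lra.
- exists n => v vn vv; have := H (v ++ [:: i]); rewrite hb vb vv iN size_cat vn addn1.
  by rewrite ltrBlDl; apply.
have /choice[m Hm] : forall i, exists m, (i < N)%N -> forall u, size u = m ->
    viable (marks_of (branch [:: i] w')) u ->
    t - Num.max 0 (clocks_of w [::]) < hbirth (clocks_of (branch [:: i] w')) u.
  move=> i; case: (ltnP i N) => iN; last by exists 0%N.
  by have [m Hm] := H i iN; exists m.
exists (\max_(i < N) m i).+1 => u; case/lastP: u => // v i.
rewrite size_rcons -cats1 => -[vm]; rewrite vb hb => /andP[vv iN].
rewrite -ltrBlDl; apply: (dies_out_mono (n := m i)) => //; first exact: Hm.
by rewrite vm; exact: (leq_bigmax (Ordinal iN)).
Qed.

Definition progeny_gf (u : R) : R := fine (\int[PP]_w (u ^+ kids (marks_of w [::]))%:E).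

Let measurable_kids_root : measurable_fun setT (fun w : Omega => kids (marks_of w [::])).
Proof.
apply: (measurableT_comp (measurable_kids (R := R))).
exact: (@measurable_coordinate _ _ (mark_space R) (true, [::])).
Qed.

Let measurable_pow (f : Omega -> R) : measurable_fun setT f ->
  measurable_fun setT (fun w => f w ^+ kids (marks_of w [::])).
Proof.
move=> mf _ B mB; rewrite setTI.
rewrite (_ : _ @^-1` _ = [set w | exists n, ((fun w => kids (marks_of w [::])) @^-1` [set n] `&`
    (fun w => f w ^+ n) @^-1` B) w]).
  apply: countable_bigcup_measurable => n; apply: measurableI.
    by rewrite -[X in measurable X]setTI; exact: measurable_kids_root.
  exact: (measurable_preimage (measurable_funX n mf) mB).
apply/seteqP; split => w /=; first by exists (kids (marks_of w [::])).
by move=> [n [<-]].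
Qed.

Lemma progeny_gfE u : 0 <= u <= 1 ->
  (progeny_gf u)%:E = (\int[PP]_w (u ^+ kids (marks_of w [::]))%:E)%E.
Proof.
move=> /andP[u0 u1]; rewrite fineK// ge0_fin_numE; last first.
  by apply: integral_ge0 => w _; rewrite lee_fin exprn_ge0.
apply: (@le_lt_trans _ _ (\int[PP]_w 1)%E).
  apply: ge0_le_integral => //.
  - by move=> w _; rewrite lee_fin exprn_ge0.
  - by apply/measurable_EFinP; exact: (measurable_pow (measurable_cst u)).
  - by move=> w _; rewrite lee_fin exprn_ile1.
by rewrite integral_constant ltry.
Qed.

Lemma progeny_gf_nd u v : 0 <= u -> u <= v -> v <= 1 -> progeny_gf u <= progeny_gf v.
Proof.
move=> u0 uv v1; rewrite -lee_fin !progeny_gfE ?u0 ?v1 ?(le_trans uv)// ?(le_trans u0)//.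
apply: ge0_le_integral => //.
- by move=> w _; rewrite lee_fin exprn_ge0.
- by apply/measurable_EFinP; exact: (measurable_pow (measurable_cst u)).
- by apply/measurable_EFinP; exact: (measurable_pow (measurable_cst v)).
- by move=> w _; rewrite lee_fin lerXn2r// nnegrE// (le_trans u0).
Qed.

Lemma progeny_gf_ge0 u : 0 <= u -> 0 <= progeny_gf u.
Proof.
by move=> u0; apply: fine_ge0; apply: integral_ge0 => w _; rewrite lee_fin exprn_ge0.
Qed.

Lemma progeny_gf1 : progeny_gf 1 = 1.
Proof.
apply: EFin_inj; rewrite progeny_gfE ?ler01 ?lexx//.
under eq_integral do rewrite expr1n.
by rewrite integral_constant.
Qed.

Lemma progeny_gf01 u : 0 <= u <= 1 -> 0 <= progeny_gf u <= 1.
Proof.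
by move=> /andP[u0 u1]; rewrite progeny_gf_ge0//= -progeny_gf1 progeny_gf_nd.
Qed.

(** By convexity, v ^ n lies below the chord through u0 and 1. *)
Lemma exprn_chord (u0 v : R) n : 0 <= u0 < 1 -> u0 <= v <= 1 ->
  v ^+ n * (1 - u0) <= (1 - v) * u0 ^+ n + (v - u0).
Proof.
move=> /andP[u00 u01] /andP[uv v1]; elim: n => [|n IH]; first by rewrite !expr0; lra.
have x1 : u0 ^+ n <= 1 by rewrite exprn_ile1// ltW.
have x0 : 0 <= u0 ^+ n by rewrite exprn_ge0.
have H1 := ler_wpM2l (le_trans u00 uv) IH.
have H2 : 0 <= (1 - v) * ((v - u0) * (1 - u0 ^+ n)) by rewrite !mulr_ge0 ?subr_ge0.
rewrite !exprS; move: H1 H2; set a := u0 ^+ n; set b := v ^+ n => H1 H2.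
have E : (1 - v) * (u0 * a) + (v - u0) - v * b * (1 - u0) =
   (v * ((1 - v) * a + (v - u0)) - v * (b * (1 - u0))) + (1 - v) * ((v - u0) * (1 - a)) by ring.
by rewrite -subr_ge0 E addr_ge0// subr_ge0.
Qed.

Lemma progeny_gf_below u0 v : 0 <= u0 < 1 -> progeny_gf u0 < u0 -> u0 < v < 1 ->
  progeny_gf v < v.
Proof.
move=> /andP[u00 u01] Fu /andP[uv v1].
have v0 : 0 <= v by rewrite (le_trans u00)// ltW.
have v01 : 0 <= v <= 1 by rewrite v0 ltW.
have v1' : 0 <= 1 - v by rewrite subr_ge0 ltW.
have u1' : 0 <= 1 - u0 by rewrite subr_ge0 ltW.
have u01' : 0 <= u0 <= 1 by rewrite u00 ltW.
have mp (x : R) : measurable_fun setT (fun w : Omega => (x ^+ kids (marks_of w [::]))%:E).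
  by apply/measurable_EFinP; exact: (measurable_pow (measurable_cst x)).
have H : progeny_gf v * (1 - u0) <= (1 - v) * progeny_gf u0 + (v - u0).
  rewrite -lee_fin EFinM [leRHS]EFinD [X in (_ <= X + _)%E]EFinM !progeny_gfE//.
  rewrite -ge0_integralZr//; last by move=> w _; rewrite lee_fin exprn_ge0.
  rewrite -ge0_integralZl//; last by move=> w _; rewrite lee_fin exprn_ge0.
  rewrite -[X in (_ <= _ + X)%E](integral_constant PP).
  rewrite -ge0_integralD//; last 3 first.
  - by move=> w _; rewrite mule_ge0// lee_fin ?exprn_ge0.
  - exact: measurable_funeM.
  - by move=> w _; rewrite lee_fin subr_ge0 ltW.
  apply: ge0_le_integral => //.
  - by move=> w _; rewrite mule_ge0// lee_fin ?exprn_ge0.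
  - exact: emeasurable_funM.
  - by apply: emeasurable_funD => //; exact: measurable_funeM.
  - move=> w _; rewrite -!EFinM -EFinD lee_fin; apply: exprn_chord.
      by rewrite u00.
    by rewrite !ltW.
have : (1 - v) * progeny_gf u0 < (1 - v) * u0 by rewrite ltr_pM2l// subr_gt0.
have : 0 < 1 - u0 by rewrite subr_gt0.
nra.
Qed.

Lemma progeny_no_explosion_ni : {homo (fun s => progeny_gf (q s)) : s t / s <= t >-> t <= s}.
Proof.
move=> s t /no_explosion_ni st; apply: progeny_gf_nd => //.
  by have /andP[] := no_explosion01 t.
by have /andP[] := no_explosion01 s.
Qed.

Lemma measurable_progeny_no_explosion : measurable_fun setT (fun s => progeny_gf (q s)).
Proof. by apply: nonincreasing_measurable => //; exact: progeny_no_explosion_ni. Qed.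

(** Given the clock y and the number of children of the root, the subtrees of
    the children are independent, and the event holds if and only if each of
    them satisfies it at time t - y. *)
Lemma no_explosion_renewal t :
  (q t)%:E = (\int[Q]_y (progeny_gf (q (t - Num.max 0 y)))%:E)%E.
Proof.
have q0 s : 0 <= q s by have /andP[] := no_explosion01 s.
rewrite no_explosionE (probability_root PP_prod); last exact: measurable_dies_out1.
pose B := [set ww : Omega * Omega | forall i, (i < kids (marks_of ww.1 [::]))%N ->
     dies_out (t - Num.max 0 (clocks_of ww.1 [::])) (branch [:: i] ww.2)].
have mtc : measurable_fun setT (fun w : Omega => t - Num.max 0 (clocks_of w [::])).
  by apply: measurable_funB => //; apply: measurable_maxr => //; exact: measurable_clocks.
have mG : measurable [set w : Omega | exists n, child_count (marks_of w [::]) n].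
  by apply: countable_bigcup_measurable => n; exact: measurable_child_count_of.
have mB : measurable B.
  apply: countable_bigcap_measurable => i.
  rewrite (_ : (fun _ => _) = (fun ww : Omega * Omega => (i < kids (marks_of ww.1 [::]))%N) @^-1` [set false] `|`
    [set ww : Omega * Omega | dies_out (t - Num.max 0 (clocks_of ww.1 [::])) (branch [:: i] ww.2)]).
    apply: measurableU.
      have mk : measurable_fun setT (fun ww : Omega * Omega => (i < kids (marks_of ww.1 [::]))%N).
        apply: measurable_fun_ltn => //.
        exact: (measurableT_comp measurable_kids_root measurable_fst).
      by have := mk measurableT [set false]; rewrite setTI; apply.
    apply: (@measurable_dies_out _ (Omega * Omega)%type (fun ww => t - Num.max 0 (clocks_of ww.1 [::]))
      (fun ww => branch [:: i] ww.2)).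
      exact: (measurableT_comp mtc measurable_fst).
    exact: (measurableT_comp (measurable_branch [:: i]) measurable_snd).
  apply/seteqP; split => ww /=.
    by case: (ltnP i) => h H; [right; exact: H|left].
  by move=> [->|].
transitivity (\int[PP]_w PP [set w' | B (w, w')])%E.
  apply: ge0_ae_eq_integral => //.
  - apply: (@measurable_fun_section _ _ Omega _ Omega PP
      [set ww | dies_out t (recombine (fun k => k.2 == [::]) id id ww.1 ww.2)]).
    apply: (@measurable_dies_out _ (Omega * Omega)%type (fun=> t)
      (fun ww => recombine (fun k => k.2 == [::]) id id ww.1 ww.2)) => //.
    exact: measurable_recombine.
  - exact: measurable_fun_section.
  - exists (~` [set w | exists n, child_count (marks_of w [::]) n]); split.
    + exact: measurableC.
    + by apply: (etrans (probability_setC PP mG)); rewrite finite_progeny subee.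
    + move=> w /= nw [n wn]; apply: nw => _; congr (PP _).
      by apply/seteqP; split => w' /dies_out_root; apply; rewrite (kidsE wn).
transitivity (\int[PP]_w ((q (t - Num.max 0 (clocks_of w [::]))) ^+ kids (marks_of w [::]))%:E)%E.
  apply: eq_integral => w _.
  have := @child_branches_law _ _ _ PP_prod (kids (marks_of w [::]))
    (fun=> dies_out (t - Num.max 0 (clocks_of w [::]))) (fun=> measurable_dies_out1 _).
  by move=> E; apply: (etrans E); rewrite prodr_const card_ord.
(* resampling all but the clock of the root separates it from the marks *)
rewrite (@integral_recombine _ _ _ _ _ _ PP_prod (pred1 (false, [::])) id id)//; last 2 first.
- apply/measurable_EFinP; apply: measurable_pow.
  exact: (measurableT_comp measurable_no_explosion mtc).
- by move=> w; rewrite lee_fin exprn_ge0.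
transitivity (\int[PP]_w (progeny_gf (q (t - Num.max 0 (clocks_of w [::]))))%:E)%E.
  by apply: eq_integral => w _; rewrite progeny_gfE// no_explosion01.
have mg : measurable_fun setT (fun y : R => (progeny_gf (q (t - Num.max 0 y)))%:E).
  apply/measurable_EFinP; apply: (measurableT_comp measurable_progeny_no_explosion).
  by apply: measurable_funB => //; exact: measurable_maxr.
have g0 (y : R) : (0 <= (progeny_gf (q (t - Num.max 0 y)))%:E)%E.
  by rewrite lee_fin progeny_gf_ge0.
transitivity (\int[distribution PP (mfun_of (measurable_clocks [::]))]_y
    (progeny_gf (q (t - Num.max 0 y)))%:E)%E.
  by rewrite ge0_integral_distribution.
by apply: eq_measure_integral => A mA _; exact: clock_law.
Qed.

(** The probability of dies_out satisfies, by the renewal equation, the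
    inequality under which no_fall applies. *)
Theorem dies_out_as t :
  (forall eps : R, 0 < eps -> (forall u, 1 - eps < u < 1 -> progeny_gf u < u) ->
    (\int[lebesgue_measure]_(u in `](1 - eps)%R, 1%R[) ((u - progeny_gf u)^-1)%:E = +oo)%E) ->
  PP (dies_out t) = 1%E.
Proof.
move=> expl; rewrite -no_explosionE; congr EFin.
apply: (@no_fall _ progeny_gf).
- exact: progeny_gf_nd.
- by move=> u /andP[u0 _]; exact: progeny_gf_ge0.
- exact: progeny_gf1.
- exact: progeny_gf_below.
- exact: expl.
- exact: no_explosion01.
- exact: no_explosion_neg.
- exact: no_explosion_ni.
- move=> s h h0; apply: (renewal_step QE (f := fun s => progeny_gf (q s))) => //.
  + exact: measurable_progeny_no_explosion.
  + exact: progeny_no_explosion_ni.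
  + by move=> s'; apply: progeny_gf01; exact: no_explosion01.
  + exact: no_explosion_renewal.
Qed.

End non_explosion.

(** * Finiteness of the population *)

Section finiteness.
Context {R : realType}.
Implicit Types (xi : seq nat -> nat -> R) (e : seq nat -> R).

Lemma finite_viable_size xi n : (forall u, exists m, child_count (xi u) m) ->
  finite_set [set u | size u = n /\ viable xi u].
Proof.
move=> fc; elim: n => [|n IH].
  apply: (sub_finite_set _ (finite_set1 [::])) => u [+ _].
  by move=> /eqP; rewrite size_eq0 => /eqP ->.
have /choice[m Hm] := fc.
apply: (sub_finite_set _ (bigcup_finite IH
  (F := fun u => (fun i => i :: u) @` `I_(m u)) _)).
  move=> [|i u] [/= un]; first by [].
  move: un => [un] /andP[xiu vu]; exists u => //.
  by exists i => //; rewrite /= -Hm.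
by move=> u _; apply: finite_image; exact: finite_II.
Qed.

Lemma finite_viable_before xi e (t : R) n : (forall u, exists m, child_count (xi u) m) ->
  (forall u, size u = n -> viable xi u -> t < hbirth e u) ->
  finite_set [set u | viable xi u /\ hbirth e u <= t].
Proof.
move=> fc H.
apply: (sub_finite_set _ (bigcup_finite (finite_II n)
  (F := fun m => [set u | size u = m /\ viable xi u]) _)).
  move=> u [vu ut]; exists (size u) => //=; rewrite ltnNge; apply/negP => nu.
  have := vu; rewrite -(cat_take_drop (size u - n) u) viable_cat => /andP[_ vd].
  have sd : size (drop (size u - n) u) = n by rewrite size_drop subKn.
  have := lt_le_trans (H _ sd vd) (le_hbirth_cat e _ (take (size u - n) u)).
  by rewrite cat_take_drop ltNge ut.
by move=> m _; exact: finite_viable_size.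
Qed.

Lemma isize_gt0_viable x xi u : (forall z i, 0 <= xi z i) -> 0 < x ->
  0 < isize x xi u -> viable xi u.
Proof.
move=> xi0 x0; elim: u => //= i u IH; rewrite !lt_neqAle !xi0 mulr_ge0 ?isize_ge0 ?(ltW x0)// !andbT.
rewrite eq_sym mulf_eq0 negb_or => /andP[h1 h2]; rewrite eq_sym h1/=.
by apply: IH; rewrite lt_neqAle eq_sym h2 isize_ge0// ltW.
Qed.

(** Sizes of at most C make the clocks run at speed at most C ^ alpha. *)
Lemma hbirth_le_birth alpha (C x : R) xi e u : 0 <= alpha -> 0 < x ->
  (forall z i, 0 <= xi z i) -> (forall z, 0 <= e z) ->
  (forall z, isize x xi z <= C) -> viable xi u ->
  hbirth e u <= C `^ alpha * birth alpha x xi e u.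
Proof.
move=> a0 x0 xi0 e0 sC; have C0 : 0 <= C by apply: le_trans (sC [::]); exact: ltW.
have vs z : viable xi z -> 0 < isize x xi z.
  by elim: z => //= i z IH /andP[h1 /IH h2]; rewrite mulr_gt0.
elim: u => [|i u IH] /=; first by rewrite mulr0.
move=> /andP[_ vu]; rewrite mulrDr lerD ?IH// (max_idPr (e0 u)) /lifetime mulrA.
rewrite -[leLHS]mul1r ler_wpM2r// -[leLHS](powRr0 (isize x xi u)) -(subrr alpha) powRD; last first.
  by apply/implyP => _; rewrite gt_eqF// vs.
rewrite ler_wpM2r ?powR_ge0// ge0_ler_powR// nnegrE//.
by rewrite ltW// vs.
Qed.

(** Properties of the marks and clocks alone, which serve for all times and all
    sizes of the root at once. *)
Definition well_behaved xi e := [/\ forall u i, 0 <= xi u i,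
  forall u, exists m, child_count (xi u) m, forall u, 0 <= e u,
  exists C, forall u, isize 1 xi u <= C &
  forall n : nat, exists m, forall u, size u = m -> viable xi u -> n%:R < hbirth e u].

(** As sizes are bounded, an individual alive at time t was born before a fixed
    time in the tree where all sizes are 1; it then belongs to one of finitely
    many generations, each of which is finite. *)
Lemma well_behaved_finite alpha x t xi e : 0 <= alpha -> 0 < x ->
  well_behaved xi e -> finite_set (alive alpha x xi e t).
Proof.
move=> a0 x0 [xi0 fc e0 [C HC] hd].
have xC z : isize x xi z <= x * C.
  by rewrite -[in leLHS](mulr1 x) isize_scale ler_wpM2l// ltW.
pose M := (x * C) `^ alpha.
have M0 : 0 <= M by exact: powR_ge0.
pose n := (Num.trunc `|M * t|).+1.
have Mtn : M * t < n%:R by rewrite (le_lt_trans (ler_norm _))// truncnS_gt.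
have [m Hm] := hd n.
apply: (sub_finite_set _ (finite_viable_before fc Hm)) => u /aliveP[s0 bt _].
have vu : viable xi u by exact: isize_gt0_viable s0.
split=> //; apply: (le_trans (hbirth_le_birth a0 x0 xi0 e0 xC vu)).
by apply: le_trans (ltW Mtn); rewrite ler_wpM2l.
Qed.

End finiteness.

Section almost_surely.
Context {R : realType}.

Lemma ae_prob1 d (T : measurableType d) (P : probability T R) (A : set T) :
  measurable A -> P A = 1%E -> {ae P, forall w, A w}.
Proof.
move=> mA PA; exists (~` A); split => //; first exact: measurableC.
by apply: (etrans (probability_setC P mA)); rewrite PA subee.
Qed.

Lemma ae_countable (K : countType) d (T : measurableType d)
    (P : {measure set T -> \bar R}) (A : K -> T -> Prop) :
  (forall k, {ae P, forall w, A k w}) -> {ae P, forall w, forall k, A k w}.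
Proof.
move=> H; have : {ae P, forall w, forall n : nat, if choice.unpickle n is Some k then A k w else True}.
  apply: ae_foralln => n; case: (choice.unpickle n) => [k|]; first exact: H.
  exact: aeW.
by apply: filterS => w Hw k; have := Hw (choice.pickle k); rewrite choice.pickleK.
Qed.

Local Notation Omega := (tree_space R).
Variables (mu : bool -> probability (mark_space R) R) (PP : probability Omega R).
Hypothesis PP_prod : product_law (fun k => mu k.1) PP.

Lemma ae_branch (A : Omega -> Prop) u :
  {ae PP, forall w, A w} -> {ae PP, forall w, A (branch u w)}.
Proof.
move=> [N [mN N0 AN]]; exists (branch u @^-1` N); split.
- exact: measurable_branch_preimage.
- by apply: etrans N0; apply/esym; exact: (branch_law PP_prod).
- by move=> w Aw; apply: AN.
Qed.

(** The bound of reaches_bound does not depend on the number of generations and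
    tends to 0 as C grows. *)
Lemma reaches_ae p : 0 < p ->
  (\int[PP]_w \sum_(0 <= i <oo) (`|marks_of w [::] i| `^ p)%:E <= 1)%E ->
  {ae PP, forall w, exists C, forall u, isize 1 (marks_of w) u <= C}.
Proof.
move=> p0 mp.
have mr n k : measurable (reaches n k.+1%:R 1 : set Omega).
  exact: (@measurable_reaches _ _ Omega n k.+1%:R (fun=> 1) id).
pose N : set Omega := [set w | forall k : nat, exists n, reaches n k.+1%:R 1 w].
have mN : measurable N.
  by apply: countable_bigcap_measurable => k; apply: countable_bigcup_measurable.
have NC k : (PP N <= ((k.+1%:R^-1) `^ p)%:E)%E.
  apply: (@le_trans _ _ (PP (\bigcup_n reaches n k.+1%:R 1))).
    apply: le_measure; rewrite ?inE//; first exact: bigcup_measurable.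
    by move=> w /(_ k)[n]; exists n.
  have nd : nondecreasing_seq (fun n => reaches n k.+1%:R 1 : set Omega).
    move=> n m nm; apply/subsetPset => w [u [un h]]; exists u; split => //.
    exact: leq_trans nm.
  have := nondecreasing_cvg_mu (mu := PP) (mr ^~ k) (bigcup_measurable (fun n _ => mr n k)) nd.
  move=> /cvg_lim <- //; apply: lime_le.
    apply: ereal_nondecreasing_is_cvgn => n m nm; apply: le_measure; rewrite ?inE//.
    by apply/subsetPset; exact: nd.
  apply: nearW => n; apply: (le_trans (reaches_bound PP_prod p0 mp _ _ _)) => //.
  by rewrite normr1 mul1r.
have N0 : PP N = 0%E.
  pose r := fine (PP N); have rE : PP N = r%:E by rewrite fineK// fin_num_measure.
  have r0 : 0 <= r by exact: fine_ge0.
  rewrite rE; move: r0; rewrite le_eqVlt => /orP[/eqP <-//|r0]; exfalso.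
  pose k := Num.trunc (r `^ (p^-1))^-1.
  have := NC k; rewrite rE lee_fin leNgt => /negP; apply.
  have rp : 0 < r `^ p^-1 by exact: powR_gt0.
  have rE2 : r = (r `^ p^-1) `^ p by rewrite -powRrM mulVf ?powRr1 ?lt0r_neq0// ltW.
  rewrite [ltRHS]rE2; apply: gt0_ltr_powR; rewrite ?nnegrE ?invr_ge0 ?powR_ge0//.
  by rewrite invf_plt ?posrE// truncnS_gt.
exists N; split => // w /= nw k; apply: contrapT => nr; apply: nw.
exists k.+1%:R => u; rewrite leNgt; apply/negP => h; apply: nr; exists (size u), u.
by split=> //; rewrite (le_trans (ltW h))// ler_norm.
Qed.

End almost_surely.

Section well_behaved_as.
Context {R : realType}.
Local Notation Omega := (tree_space R).
Variables (mu : bool -> probability (mark_space R) R) (PP : probability Omega R).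
Hypothesis PP_prod : product_law (fun k => mu k.1) PP.
Variable Q : probability R R.
Hypothesis QE : forall B, measurable B -> Q B = exponential_prob 1 B.
Hypothesis clock_law : forall B, measurable B ->
  PP [set w | B (clocks_of w [::])] = Q B.
Hypothesis finite_progeny : PP [set w | exists n, child_count (marks_of w [::]) n] = 1%E.
Hypothesis nonneg_marks : PP [set w | forall i, 0 <= marks_of w [::] i] = 1%E.
Variable p : R.
Hypotheses (p0 : 0 < p) (mean_powers :
  (\int[PP]_w \sum_(0 <= i <oo) (`|marks_of w [::] i| `^ p)%:E <= 1)%E).
Hypothesis no_expl : forall eps : R, 0 < eps ->
  (forall u, 1 - eps < u < 1 -> progeny_gf PP u < u) ->
  (\int[lebesgue_measure]_(u in `](1 - eps)%R, 1%R[) ((u - progeny_gf PP u)^-1)%:E = +oo)%E.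

Lemma well_behaved_ae : {ae PP, forall w, well_behaved (marks_of w) (clocks_of w)}.
Proof.
have h1 : {ae PP, forall w, forall u i, 0 <= marks_of w u i}.
  apply: (ae_countable (A := fun u w => forall i, 0 <= marks_of w u i)) => u.
  apply: (@ae_branch _ _ _ PP_prod (fun w => forall i, 0 <= marks_of w [::] i) u).
  apply: (ae_prob1 _ nonneg_marks).
  apply: (@countable_bigcap_measurable nat _ Omega (fun i => [set w | 0 <= marks_of w [::] i])) => i.
  by apply: measurable_bool_set; apply: measurable_fun_ler => //; exact: measurable_marks.
have h2 : {ae PP, forall w, forall u, exists m, child_count (marks_of w u) m}.
  apply: (ae_countable (A := fun u w => exists m, child_count (marks_of w u) m)) => u.
  apply: (@ae_branch _ _ _ PP_prod (fun w => exists m, child_count (marks_of w [::]) m) u).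
  apply: (ae_prob1 _ finite_progeny).
  by apply: countable_bigcup_measurable => m; exact: measurable_child_count_of.
have h3 : {ae PP, forall w, forall u, 0 <= clocks_of w u}.
  apply: (ae_countable (A := fun u w => 0 <= clocks_of w u)) => u.
  apply: (@ae_branch _ _ _ PP_prod (fun w => 0 <= clocks_of w [::]) u).
  apply: ae_prob1.
    by apply: measurable_bool_set; apply: measurable_fun_ler => //; exact: measurable_clocks.
  have := clock_law (B := [set y | 0 <= y]) _ => ->; first exact: exponential_ge0.
  by rewrite (_ : [set y | 0 <= y] = `[0, +oo[%classic)//;
    apply/seteqP; split => y /=; rewrite in_itv/= andbT.
have h4 := reaches_ae PP_prod p0 mean_powers.
have h5 : {ae PP, forall w, forall n : nat, exists m, forall u, size u = m ->
    viable (marks_of w) u -> n%:R < hbirth (clocks_of w) u}.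
  apply: ae_foralln => n; apply: ae_prob1; first exact: measurable_dies_out1.
  exact: (dies_out_as PP_prod QE clock_law finite_progeny).
apply: filterS (filterI h1 (filterI h2 (filterI h3 (filterI h4 h5)))).
by move=> w [? [? [? [? ?]]]].
Qed.

End well_behaved_as.

(** * The transition kernel *)

Section forest.
Context {R : realType}.
Local Notation Omega := (tree_space R).
Variables (mu : bool -> probability (mark_space R) R) (PP : probability Omega R).
Hypothesis PP_prod : product_law (fun k => mu k.1) PP.
Variables (alpha t : R).

Definition path_snapshot (x : R) (r : R) (w : Omega) : point_measure R :=
  snapshot alpha x (marks_of w) (clocks_of w) r.

Lemma measurable_path_snapshot d (Y : measurableType d) (x : Y -> R) r (f : Y -> Omega) :
  measurable_fun setT x -> measurable_fun setT f ->
  measurable_fun setT (fun y => path_snapshot (x y) r (f y)).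
Proof.
move=> mx mf; apply: measurable_snapshot => // [u i|u].
  exact: (measurableT_comp (measurable_marks u i)).
exact: (measurableT_comp (measurable_clocks u)).
Qed.

(** The branches at the children of the root are independent copies of the
    tree: n of them give the population descending from n ancestors of
    arbitrary sizes x 0, ..., x n.-1. *)
Definition forest (x : nat -> R) (n : nat) (w : Omega) : point_measure R :=
  pm_sum [seq path_snapshot (x i) t (branch [:: i] w) | i <- iota 0 n].

Lemma measurable_fun_nat_case d (Y : measurableType d) d' (T' : measurableType d')
    (N : Y -> nat) (g : nat -> Y -> T') :
  measurable_fun setT N -> (forall n, measurable_fun setT (g n)) ->
  measurable_fun setT (fun y => g (N y) y).
Proof.
move=> mN mg _ B mB; rewrite setTI.
rewrite (_ : _ @^-1` _ = [set y | exists n, (N @^-1` [set n] `&` g n @^-1` B) y]).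
  apply: countable_bigcup_measurable => n; apply: measurableI.
    exact: (measurable_preimage mN).
  exact: (measurable_preimage (mg n)).
by apply/seteqP; split => y /=; [exists (N y)|move=> [n [<-]]].
Qed.

Lemma measurable_forest d (Y : measurableType d) (x : Y -> nat -> R) (n : Y -> nat)
    (f : Y -> Omega) :
  (forall i, measurable_fun setT (fun y => x y i)) -> measurable_fun setT n ->
  measurable_fun setT f ->
  measurable_fun setT (fun y => forest (x y) (n y) (f y)).
Proof.
move=> mx mn mf.
apply: (measurable_fun_nat_case (g := fun n y => forest (x y) n (f y))) => // m.
apply: measurable_pm_sum => i; apply: measurable_path_snapshot => //.
exact: (measurableT_comp (measurable_branch [:: i])).
Qed.

Lemma pm_sum_perm (s s' : seq (point_measure R)) : perm_eq s s' -> pm_sum s = pm_sum s'.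
Proof. by move=> ss; apply: pm_ext => A; rewrite !pm_sumE; exact: perm_big. Qed.

(** The law of the tree is invariant under a permutation of the children of the
    root, which permutes the trees of the forest. *)
Lemma forest_law_perm (x y : nat -> R) (n : nat) (B : set (point_measure R)) :
  perm_eq [seq x i | i <- iota 0 n] [seq y i | i <- iota 0 n] -> measurable B ->
  PP (forest x n @^-1` B) = PP (forest y n @^-1` B).
Proof.
move=> xy mB.
have /(perm_iotaP 0)[Is Isn xE] := xy.
rewrite size_map size_iota in Isn.
have szI : size Is = n by rewrite (perm_size Isn) size_iota.
have memI j : (j \in Is) = (j < n)%N by rewrite (perm_mem Isn) mem_iota.
have uI : uniq Is by rewrite (perm_uniq Isn) iota_uniq.
pose pi i := if (i < n)%N then nth 0%N Is i else i.
have pin i : (pi i < n)%N = (i < n)%N.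
  by rewrite /pi; case: (ltnP i n) => h; [rewrite -memI mem_nth// szI|rewrite ltnNge h].
have pi_inj : injective pi.
  move=> i j E; have := pin i; rewrite E pin => ij.
  move: E; rewrite /pi ij; case: ifP => // jn.
  by move=> /eqP; rewrite nth_uniq ?szI// ?ij// => /eqP.
have xy_pi i : (i < n)%N -> x i = y (pi i).
  move=> ni; have := congr1 (fun s => nth 0 s i) xE.
  rewrite (nth_map 0%N) ?size_iota// nth_iota// add0n => ->.
  rewrite (nth_map 0%N) ?szI// (nth_map 0%N) ?size_iota//; last by rewrite -memI mem_nth// szI.
  by rewrite nth_iota ?add0n /pi ?ni// -memI mem_nth// szI.
(* f permutes the children of the root, recorded by the last entry of a word *)
pose f (k : bool * seq nat) := (k.1, if k.2 is i :: v then rcons (belast i v) (pi (last i v)) else [::]).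
have fr b v i : f (b, rcons v i) = (b, rcons v (pi i)).
  case: v => //= j v; rewrite /f /= last_rcons; congr (_, _).
  by rewrite belast_rcons.
have f_inj : injective f.
  move=> [b u] [b' u']; case/lastP: u => [|u i]; case/lastP: u' => [|u' i'].
  - by move=> [->].
  - by rewrite fr => -[_ /(congr1 size)]; rewrite size_rcons.
  - by rewrite fr => -[_ /(congr1 size)]; rewrite size_rcons.
  - by rewrite !fr => -[-> /rcons_inj[-> /pi_inj ->]].
have mf z : measurable (forest z n @^-1` B).
  rewrite -[X in measurable X]setTI.
  exact: (@measurable_forest _ Omega (fun=> z) (fun=> n) id).
rewrite (relabel_law PP_prod f_inj _ (mf x))//; congr (PP _).
suff E w : forest x n (fun k => w (f k)) = forest y n w.
  by apply/seteqP; split => w /=; rewrite E.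
apply: (@etrans _ _ (pm_sum [seq path_snapshot (y (pi i)) t (branch [:: pi i] w) | i <- iota 0 n])).
  congr pm_sum; apply/eq_in_map => i; rewrite mem_iota add0n => /andP[_ ni].
  rewrite xy_pi//; congr path_snapshot; apply/funext => -[b v].
  by rewrite /branch/= !cats1 fr.
rewrite (map_comp (fun j => path_snapshot (y j) t (branch [:: j] w)) pi).
apply: pm_sum_perm; apply: perm_map.
rewrite (_ : map pi _ = Is)//.
apply: (@eq_from_nth _ 0%N); rewrite size_map size_iota// => i ni.
by rewrite (nth_map 0%N) ?size_iota// nth_iota// /pi ni.
Qed.

(** The trees of a forest are branches at distinct children of the root. *)
Lemma forest_indep (x : nat -> R) n (J : {fset 'I_n}) (B : 'I_n -> set (point_measure R)) :
  (forall i, measurable (B i)) ->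
  PP (\bigcap_(i in [set` J]) (fun w => path_snapshot (x i) t (branch [:: i : nat] w)) @^-1` B i) =
  (\prod_(i <- J) fine (PP ((fun w => path_snapshot (x i) t (branch [:: i : nat] w)) @^-1` B i)))%:E.
Proof.
move=> mB.
pose C (j : nat) : set Omega := if insub j is Some i then
  (if i \in J then path_snapshot (x i) t @^-1` B i else setT) else setT.
have mS z (i : 'I_n) : measurable (path_snapshot z t @^-1` B i).
  rewrite -[X in measurable X]setTI.
  exact: (@measurable_path_snapshot _ Omega (fun=> z) t id).
have mC j : measurable (C j).
  by rewrite /C; case: insub => [i|//]; case: ifP.
transitivity (PP [set w | forall i, (i < n)%N -> C i (branch [:: i] w)]).
  congr (PP _); apply/seteqP; split => w /= H i.
    move=> ni; rewrite /C insubT; case: ifPn => // iJ; exact: (H (Sub i ni)).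
  by move=> iJ; have := H i (ltn_ord i); rewrite /C valK; move: iJ => /= ->.
rewrite (child_branches_law PP_prod n mC); congr EFin.
transitivity (\prod_(i < n) (if i \in J then
    fine (PP ((fun w => path_snapshot (x i) t (branch [:: i : nat] w)) @^-1` B i)) else 1)).
  apply: eq_bigr => i _; rewrite /C valK; case: ifP => _; last first.
    by rewrite [X in fine X](_ : _ = 1%E)//; exact: probability_setT.
  congr fine; exact: (branch_law PP_prod [:: i : nat] (mS (x i) i)).
by rewrite -big_mkcond/= [RHS]big_uniq ?fset_uniq.
Qed.

(** Planting the atoms in decreasing order makes this measurable in s. *)
Definition forest_law (s : point_measure R) :
    {measure set (point_measure R) -> \bar R} :=
  distribution PP (mfun_of (@measurable_forest _ Omega (fun=> ratom s) (fun=> natoms s) id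
    (fun=> measurable_cst _) (measurable_cst _) (@measurable_id _ _ _))).

Lemma forest_lawE s B : forest_law s B = PP (forest (ratom s) (natoms s) @^-1` B).
Proof. by []. Qed.

Lemma measurable_forest_law B : measurable B ->
  measurable_fun setT (fun s : point_measure R => forest_law s B : \bar R).
Proof.
move=> mB.
apply: (@measurable_fun_section _ _ (point_measure R) _ Omega PP
  [set sw | B (forest (ratom sw.1) (natoms sw.1) sw.2)]).
have mf : measurable_fun setT (fun sw : point_measure R * Omega =>
    forest (ratom sw.1) (natoms sw.1) sw.2).
  apply: measurable_forest => //.
    by move=> i; exact: (measurableT_comp (measurable_ratom i)).
  exact: (measurableT_comp measurable_natoms).
exact: (measurable_preimage mf mB).
Qed.

HB.instance Definition _ := isKernel.Build _ _ _ _ R forest_law measurable_forest_law.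
Let forest_law_setT s : forest_law s setT = 1%E.
Proof. exact: probability_setT. Qed.

HB.instance Definition _ :=
  Kernel_isProbability.Build _ _ _ _ R forest_law forest_law_setT.

Definition forest_kernel : R.-pker (point_measure R) ~> (point_measure R) := forest_law.

End forest.

(** * Cutting a tree along an antichain *)

Section antichains.
Variable us : seq (seq nat).

(** Words extend to the left, so z descends from u when u is a suffix of z. *)
Definition below (z : seq nat) : bool := has (fun u => suffix u z) us.

Definition stem (z : seq nat) : nat := find (fun u => suffix u z) us.

(** A descendant v ++ u of the i-th word u of us becomes v ++ [:: i]: the subtrees
    of the words of us are renamed into the branches at the first children of
    the root. *)
Definition replant (k : bool * seq nat) : bool * seq nat :=
  (k.1, rcons (take (size k.2 - size (nth [::] us (stem k.2))) k.2) (stem k.2)).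

Lemma below_cat v u : below u -> below (v ++ u).
Proof.
move=> /hasP[y yus /suffixP[s ->]]; apply/hasP; exists y => //.
by apply/suffixP; exists (v ++ s); rewrite catA.
Qed.

Lemma belowP z : below z -> exists v, [/\ (stem z < size us)%N
  & z = v ++ nth [::] us (stem z)].
Proof.
move=> bz; have := nth_find [::] bz => /suffixP[v zE]; exists v; split => //.
by rewrite -has_find.
Qed.

Lemma replant_inj : {in predC (fun k => ~~ below k.2) &, injective replant}.
Proof.
move=> [b z] [b' z']; rewrite !inE/= !negbK => /belowP[v [_ zE]] /belowP[v' [_ zE']].
rewrite /replant/=; move: zE zE'; move: (stem z) (stem z') => i i' -> ->.
by rewrite !size_cat !addnK !take_size_cat// => -[-> /rcons_inj[-> ->]].
Qed.

Definition antichain := forall u v, u \in us -> v ++ u \in us -> v = [::].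

Hypotheses (us_antichain : antichain) (us_uniq : uniq us).

Lemma below_nth v i : (i < size us)%N -> below (v ++ nth [::] us i).
Proof.
move=> ni; apply/hasP; exists (nth [::] us i); first exact: mem_nth.
by apply/suffixP; exists v.
Qed.

(** In an antichain a word has at most one ancestor. *)
Lemma stem_cat v i : (i < size us)%N -> stem (v ++ nth [::] us i) = i.
Proof.
move=> ni; have [v' [nj E]] := belowP (below_nth v ni).
set j := stem _ in nj E *.
suff H : forall i j v v', (i < size us)%N -> (j < size us)%N ->
    (size (nth [::] us j) <= size (nth [::] us i))%N ->
    v ++ nth [::] us i = v' ++ nth [::] us j -> j = i.
  have [ji|/ltnW ij] := leqP (size (nth [::] us j)) (size (nth [::] us i)).
    exact: (H i j v v').
  by apply/esym; apply: (H j i v' v).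
move=> {v' nj E} {}i {}j {}v v' {}ni nj ji E.
have E' := cat_comparable ji E.
have d0 : drop (size v) v' = [::].
  by apply: (us_antichain (mem_nth [::] nj)); rewrite -E' mem_nth.
by move: E'; rewrite d0 cat0s => /eqP; rewrite nth_uniq// => /eqP.
Qed.

Lemma replant_cat b v i : (i < size us)%N -> replant (b, v ++ nth [::] us i) = (b, v ++ [:: i]).
Proof.
by move=> ni; rewrite /replant/= stem_cat// size_cat addnK take_size_cat// cats1.
Qed.

(** The size and the birth time of z only depend on its strict ancestors y, so
    they are determined outside the subtrees of us for such a z; the words of us
    themselves are of this kind. *)
Definition outer (z : seq nat) := forall v i y, z = v ++ i :: y -> ~~ below y.

Lemma outer_tail i z : outer (i :: z) -> ~~ below z /\ outer z.
Proof.
move=> oz; split; first exact: (oz [::] i).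
by move=> v j y zE; apply: (oz (i :: v) j); rewrite zE.
Qed.

Lemma not_below_outer z : ~~ below z -> outer z.
Proof.
move=> nz v i y zE; apply: contra nz => yb.
by rewrite zE -cat_rcons; exact: below_cat.
Qed.

Lemma antichain_outer z : z \in us -> outer z.
Proof.
move=> zus v i y zE; apply/negP => /hasP[u uus /suffixP[s yE]].
have := us_antichain (v := v ++ i :: s) uus; rewrite -catA cat_cons -yE -zE => /(_ zus).
by case: v zE.
Qed.

End antichains.

Section outside.
Context {R : realType}.
Local Notation Omega := (tree_space R).
Variables (alpha x : R) (us : seq (seq nat)).

Definition agree (w w' : Omega) := forall b z, ~~ below us z -> w (b, z) = w' (b, z).

Lemma agree_isize w w' z : agree w w' -> outer us z ->
  isize x (marks_of w) z = isize x (marks_of w') z.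
Proof.
move=> ww'; elim: z => //= i z IH /outer_tail[nz oz].
by rewrite IH// /marks_of ww'.
Qed.

Lemma agree_birth w w' z : agree w w' -> outer us z ->
  birth alpha x (marks_of w) (clocks_of w) z = birth alpha x (marks_of w') (clocks_of w') z.
Proof.
move=> ww'; elim: z => //= i z IH /outer_tail[nz oz].
by rewrite IH// /lifetime (agree_isize ww' oz) /clocks_of ww'.
Qed.

Lemma agree_alive w w' z s : agree w w' -> ~~ below us z ->
  alive alpha x (marks_of w) (clocks_of w) s z <->
  alive alpha x (marks_of w') (clocks_of w') s z.
Proof.
move=> ww' nz; have oz := not_below_outer nz.
have lE : lifetime alpha x (marks_of w) (clocks_of w) z =
    lifetime alpha x (marks_of w') (clocks_of w') z.
  by rewrite /lifetime (agree_isize ww' oz) /clocks_of ww'.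
split=> /aliveP[h1 h2 h3]; apply/aliveP; split.
- by rewrite -(agree_isize ww' oz).
- by rewrite -(agree_birth ww' oz).
- by rewrite -(agree_birth ww' oz) -lE.
- by rewrite (agree_isize ww' oz).
- by rewrite (agree_birth ww' oz).
- by rewrite (agree_birth ww' oz) lE.
Qed.

End outside.

Lemma isize_root0 (R : realType) (xi : seq nat -> nat -> R) v : isize 0 xi v = 0.
Proof. by elim: v => //= i v ->; rewrite mulr0. Qed.

Section markov_on_event.
Context {R : realType}.
Local Notation Omega := (tree_space R).
Variables (alpha x r : R) (us : seq (seq nat)).
Hypotheses (us_antichain : antichain us) (us_uniq : uniq us).

Definition inner : pred (bool * seq nat) := fun k => ~~ below us k.2.

Definition regraft (w w' : Omega) : Omega := recombine inner id (replant us) w w'.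

Lemma regraft_agree w w' : agree us (regraft w w') w.
Proof. by move=> b z nz; rewrite /regraft /recombine /inner /= nz. Qed.

Lemma regraft_branch w w' i : (i < size us)%N ->
  branch (nth [::] us i) (regraft w w') = branch [:: i] w'.
Proof.
move=> ni; apply/funext => -[b v]; rewrite /branch /regraft /recombine /inner /=.
by rewrite below_nth//= replant_cat.
Qed.

Definition cut_age (w : Omega) u := age_at_rate alpha x (marks_of w) (clocks_of w) r u.

Lemma agree_age w w' u : agree us w w' -> outer us u -> cut_age w u = cut_age w' u.
Proof.
by move=> ww' ou; rewrite /cut_age /age_at_rate (agree_isize x ww' ou) (agree_birth alpha x ww' ou).
Qed.

(** The part of the event that us is the set of individuals alive at time r which
    can be read outside the subtrees of us; what is missing is that the words of
    us have not died yet. *)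
Definition front (w : Omega) :=
  (forall z, ~~ below us z -> ~ alive alpha x (marks_of w) (clocks_of w) r z) /\
  (forall u, u \in us -> 0 < isize x (marks_of w) u /\
     birth alpha x (marks_of w) (clocks_of w) u <= r).

Lemma agree_front w w' : agree us w w' -> front w -> front w'.
Proof.
move=> ww' [h1 h2]; split=> [z nz|u uus].
  by move=> /(agree_alive alpha x r ww' nz); exact: h1.
have ou := antichain_outer us_antichain uus.
by rewrite -(agree_isize x ww' ou) -(agree_birth alpha x ww' ou); exact: h2.
Qed.

Lemma lt_lifetime (s b e : R) : 0 < s ->
  (r < b + s `^ (- alpha) * e) = (s `^ alpha * (r - b) < e).
Proof.
move=> s0; have sa : 0 < s `^ alpha by exact: powR_gt0.
by rewrite powRN -ltrBlDl ltr_pdivlMl.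
Qed.

(** A descendant of a living individual is not born yet, so it remains to compare
    the clocks of us with their ages. *)
Lemma front_alive w : (forall u, 0 <= clocks_of w u) ->
  alive alpha x (marks_of w) (clocks_of w) r = [set` us] <->
  front w /\ forall u, u \in us -> cut_age w u < clocks_of w u.
Proof.
move=> e0; split=> [E|[[h1 h2] h3]].
  have al u : u \in us -> alive alpha x (marks_of w) (clocks_of w) r u by rewrite E.
  split; first split.
  - move=> z; apply: contraNnot; rewrite E /= => zus.
    by apply/hasP; exists z => //; exact: suffix_refl.
  - by move=> u /al /aliveP[].
  - by move=> u /al /aliveP[s0 _]; rewrite lt_lifetime.
have al u : u \in us -> alive alpha x (marks_of w) (clocks_of w) r u.
  move=> uus; have [s0 b] := h2 u uus; apply/aliveP; split => //.
  by rewrite lt_lifetime//; exact: h3.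
apply/seteqP; split => z /=; last exact: al.
move=> za; case: (boolP (below us z)) => [bz|nz]; last by case: (h1 z nz).
have [v [ni zE]] := belowP bz; have ius := mem_nth [::] ni.
rewrite zE in za.
by rewrite zE (alive_antichain e0 (al _ ius) za).
Qed.

(** All that precedes time r in w on the event that us is the set of individuals
    alive at time r, rebuilt from the coordinates outside the subtrees of us: the
    words of us are given clocks that keep them alive after r, and no children. *)
Definition sealed (w : Omega) : Omega := fun k =>
  if inner k then w k
  else if ~~ k.1 && (k.2 \in us) then fun=> isize x (marks_of w) k.2 `^ alpha * (r + 1)
  else fun=> 0.

Lemma sealed_agree w : agree us (sealed w) w.
Proof. by move=> b z nz; rewrite /sealed /inner /= nz. Qed.

Lemma sealed_regraft w w' : sealed (regraft w w') = sealed w.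
Proof.
apply/funext => k; rewrite /sealed; case: ifPn => [ik|_].
  by rewrite /regraft /recombine ik.
case: ifP => // /andP[_ kus].
by rewrite (agree_isize x (regraft_agree w w') (antichain_outer us_antichain kus)).
Qed.

Lemma measurable_sealed : measurable_fun setT sealed.
Proof.
apply: measurable_to_product_space => k; rewrite /sealed.
case: (inner k); first exact: measurable_coordinate.
case: (_ && _); last exact: measurable_cst.
apply: measurable_to_product_space => i.
apply: measurable_funM => //.
exact: (measurableT_comp (measurable_powR _) (measurable_tree_isize x _)).
Qed.

(** Until time r the population consists of words outside the subtrees of us, on
    which both trees agree, and of words of us, which have the same size and
    birth time in both trees and are still alive at time r in both. *)
Lemma sealed_snapshot w q : 0 < x -> (forall u i, 0 <= marks_of w u i) ->
  (forall u, 0 <= clocks_of w u) ->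
  alive alpha x (marks_of w) (clocks_of w) r = [set` us] -> 0 <= q <= r ->
  path_snapshot alpha x q (sealed w) = path_snapshot alpha x q w.
Proof.
move=> x0 xi0 e0 E /andP[q0 qr].
have [[h1 h2] h3] := iffLR (front_alive e0) E.
have ww' := sealed_agree w.
set w1 := sealed w in ww' *.
have ra u : u \in us -> r < birth alpha x (marks_of w) (clocks_of w) u +
    lifetime alpha x (marks_of w) (clocks_of w) u.
  by move=> uus; have [s0 _] := h2 u uus; rewrite lt_lifetime//; exact: h3.
have unborn u v i : u \in us -> ~ alive alpha x (marks_of w) (clocks_of w) q (v ++ i :: u).
  move=> uus /aliveP[_ bz _].
  have := le_trans (@birth_child_le _ alpha x (marks_of w) _ u v i e0) bz.
  by move=> /(lt_le_trans (ra u uus))/lt_le_trans/(_ qr); rewrite ltxx.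
have usb u : u \in us -> below us u.
  by move=> uus; apply/hasP; exists u => //; exact: suffix_refl.
have al : alive alpha x (marks_of w1) (clocks_of w1) q =
    alive alpha x (marks_of w) (clocks_of w) q.
  apply/seteqP; split=> z.
    case: (boolP (below us z)) => [bz|nz]; last by move/(agree_alive alpha x q ww' nz).
    have [v [ni zE]] := belowP bz; have ius := mem_nth [::] ni.
    set u := nth _ _ _ in zE ius; rewrite zE.
    have ou := antichain_outer us_antichain ius.
    have [s0 b] := h2 u ius.
    case/lastP: v zE => [|v i] zE.
      rewrite !cat0s => /aliveP[_ b1 _]; apply/aliveP; split => //.
        by rewrite -(agree_birth alpha x ww' ou).
      by rewrite (le_lt_trans qr)// ra.
    move=> /aliveP[+ _ _]; rewrite cat_rcons => sz.
    suff s1 : isize x (marks_of w1) (i :: u) = 0 by rewrite isize_cat s1 isize_root0 ltxx in sz.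
    by rewrite /= {1}/marks_of /w1 /sealed /inner/= usb//= mul0r.
  case: (boolP (below us z)) => [bz|nz]; last by move/(agree_alive alpha x q ww' nz).
  have [v [ni zE]] := belowP bz; have ius := mem_nth [::] ni.
  set u := nth _ _ _ in zE ius; rewrite zE.
  have ou := antichain_outer us_antichain ius.
  have [s0 b] := h2 u ius.
  case/lastP: v zE => [|v i] zE; last by rewrite cat_rcons => /(unborn _ _ _ ius).
  rewrite !cat0s => /aliveP[_ b1 _]; apply/aliveP; split.
  - by rewrite (agree_isize x ww' ou).
  - by rewrite (agree_birth alpha x ww' ou).
  - rewrite (agree_birth alpha x ww' ou) /lifetime (agree_isize x ww' ou).
    rewrite (_ : clocks_of w1 u = isize x (marks_of w) u `^ alpha * (r + 1)).
      rewrite mulrA -powRD ?addNr ?powRr0 ?mul1r; last first.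
        by apply/implyP => _; rewrite gt_eqF.
      by have := @birth_ge0 _ alpha x (marks_of w) _ u e0; move: qr; lra.
    by rewrite /clocks_of /w1 /sealed /inner/= usb//= ius.
rewrite /path_snapshot /snapshot; congr to_point_measure; apply/funext => A.
rewrite /population; rewrite -!/(alive _ _ _ _ _) al; apply: eq_esum => z za.
suff -> : isize x (marks_of w1) z = isize x (marks_of w) z by [].
apply: (agree_isize x ww'); case: (boolP (below us z)) => [bz|]; last exact: not_below_outer.
have [v [ni zE]] := belowP bz; have ius := mem_nth [::] ni.
case/lastP: v zE => [->|v i]; first by rewrite cat0s; exact: antichain_outer.
by rewrite cat_rcons => zE; case: (@unborn _ v i ius); rewrite -zE.
Qed.

End markov_on_event.

Section restart.
Context {R : realType}.
Local Notation Omega := (tree_space R).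
Variables (mu : bool -> probability (mark_space R) R) (PP : probability Omega R).
Hypothesis PP_prod : product_law (fun k => mu k.1) PP.
Variable Q : probability R R.
Hypothesis QE : forall B, measurable B -> Q B = exponential_prob 1 B.
Hypothesis mu_clock : forall A, measurable A -> mu false A = Q [set y | A (fun=> y)].
Variables (alpha x r t : R) (us : seq (seq nat)).
Hypotheses (us_antichain : antichain us) (us_uniq : uniq us).

Definition survive (w : Omega) := forall u, u \in us -> cut_age alpha x r w u < clocks_of w u.

(** By snapshot_add, the population at time t + r if us is the set of individuals
    alive at time r. *)
Definition offshoots (w : Omega) : point_measure R :=
  pm_sum [seq snapshot alpha (isize x (marks_of w) u) (fun z => marks_of w (z ++ u))
    (residual_clock (cut_age alpha x r w u) (clocks_of w) u) t | u <- us].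

Definition root_sizes (w : Omega) (i : nat) : R := isize x (marks_of w) (nth [::] us i).

Lemma agree_sizes w w' i : agree us w w' -> root_sizes w i = root_sizes w' i.
Proof.
move=> ww'; rewrite /root_sizes; have [ni|ni] := ltnP i (size us).
  by apply: (agree_isize x ww'); apply: antichain_outer => //; exact: mem_nth.
by rewrite nth_default.
Qed.

Lemma measurable_cut_age u : measurable_fun setT (fun w : Omega => cut_age alpha x r w u).
Proof.
apply: measurable_funM.
  exact: (measurableT_comp (measurable_powR _) (measurable_tree_isize x u)).
by apply: measurable_funB => //; exact: measurable_tree_birth.
Qed.

Lemma measurable_survive : measurable [set w | survive w].
Proof.
apply: (@countable_bigcap_measurable _ _ Omega
  (fun u => [set w | u \in us -> cut_age alpha x r w u < clocks_of w u])) => u.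
have [uus|nus] := boolP (u \in us); last first.
  by rewrite (_ : [set w | _] = setT)//; apply/seteqP; split.
rewrite (_ : [set w | _] = [set w | cut_age alpha x r w u < clocks_of w u]).
  apply: measurable_bool_set; apply: measurable_fun_ltr; first exact: measurable_cut_age.
  exact: measurable_clocks.
by apply/seteqP; split => w /=; [exact|].
Qed.

Lemma measurable_offshoots : measurable_fun setT offshoots.
Proof.
apply: measurable_pm_sum => u; apply: measurable_snapshot.
- exact: measurable_tree_isize.
- by move=> v i; exact: measurable_marks.
- case=> [|i v]; last exact: measurable_clocks.
  by apply: measurable_funB; [exact: measurable_clocks|exact: measurable_cut_age].
Qed.

Lemma measurable_front : measurable [set w | front alpha x r us w].
Proof.
pose F1 u : set Omega := if below us u then setT else
  ~` [set w | alive alpha x (marks_of w) (clocks_of w) r u].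
pose F2 u : set Omega := if u \in us then [set w | 0 < isize x (marks_of w) u] `&`
  [set w | birth alpha x (marks_of w) (clocks_of w) u <= r] else setT.
rewrite (_ : [set w | _] = [set w | forall u, F1 u w] `&` [set w | forall u, F2 u w]).
  apply: measurableI; apply: countable_bigcap_measurable => u.
    by rewrite /F1; case: ifP => // _; apply: measurableC; exact: measurable_tree_alive.
  rewrite /F2; case: ifP => // _; apply: measurableI; apply: measurable_bool_set.
    by apply: measurable_fun_ltr => //; exact: measurable_tree_isize.
  by apply: measurable_fun_ler => //; exact: measurable_tree_birth.
apply/seteqP; split => w [/= h1 h2]; split => u.
- by rewrite /F1; case: ifPn => //; exact: h1.
- by rewrite /F2; case: ifPn => // /h2.
- by move=> nu; have := h1 u; rewrite /F1 (negbTE nu).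
- by move=> uus; have := h2 u; rewrite /F2 uus.
Qed.

(** Once w is fixed, so are the ages c i at time r of the words of us.  By lack of
    memory, given that the clock of the i-th one exceeds c i, subtracting c i from
    it gives back an exponential variable, hence an independent copy of the
    tree. *)
Lemma survivors_law w (B : set (point_measure R)) : front alpha x r us w -> measurable B ->
  PP [set w' | survive (regraft us w w') /\ B (offshoots (regraft us w w'))] =
  (PP [set w' | survive (regraft us w w')] *
   PP (forest alpha t (root_sizes w) (size us) @^-1` B))%E.
Proof.
move=> [_ fw] mB.
pose c i := cut_age alpha x r w (nth [::] us i).
pose L := [seq (false, [:: i]) | i <- iota 0 (size us)] : seq (bool * seq nat).
pose V (k : bool * seq nat) : set (mark_space R) := [set z | c (head 0%N k.2) < z 0%N].
pose h (k : bool * seq nat) (z : mark_space R) : mark_space R := fun j => z j - c (head 0%N k.2).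
have uL : uniq L by rewrite map_inj_uniq ?iota_uniq// => i j [].
have mV k : measurable (V k).
  apply: measurable_bool_set; apply: measurable_fun_ltr => //.
  exact: (@measurable_coordinate nat _ R 0%N).
have mh k : measurable_fun setT (h k).
  apply: measurable_to_product_space => j; apply: measurable_funB => //.
  exact: (@measurable_coordinate nat _ R j).
have memL b z i : ((b, z ++ [:: i]) \in L) = [&& ~~ b, z == [::] & (i < size us)%N].
  apply/mapP/idP => [[j + [-> E]]|/and3P[/negPf -> /eqP -> ni]].
    rewrite mem_iota add0n => /andP[_ nj]; rewrite /=.
    by case: z E => [[->]//|k [|? ?]].
  by exists i => //; rewrite mem_iota add0n.
have ageE w' i : (i < size us)%N -> cut_age alpha x r (regraft us w w') (nth [::] us i) = c i.
  move=> ni; apply: (@agree_age _ alpha x r us); first exact: regraft_agree.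
  by apply: antichain_outer => //; exact: mem_nth.
have brE w' i b v : (i < size us)%N ->
    regraft us w w' (b, v ++ nth [::] us i) = w' (b, v ++ [:: i]).
  by move=> ni; have := congr1 (@^~ (b, v)) (regraft_branch us_antichain us_uniq w w' ni).
have sE : [set w' | survive (regraft us w w')] = cylinder L V.
  apply/seteqP; split => w' /=.
    move=> H k /mapP[i]; rewrite mem_iota add0n => /andP[_ ni] ->.
    have := H _ (mem_nth [::] ni); rewrite ageE//.
    by rewrite /clocks_of -[nth [::] us i]cat0s brE.
  move=> H u /(nthP [::])[i ni <-]; rewrite ageE// /clocks_of -[X in (_, X)]cat0s brE//.
  by apply: (H (false, [:: i])); rewrite -[[:: i]]cat0s memL.
have oE w' : offshoots (regraft us w w') =
    forest alpha t (root_sizes w) (size us) (alter L h w').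
  rewrite /offshoots /forest; set F := (F in map F us).
  have usE : us = [seq nth [::] us i | i <- iota 0 (size us)].
    by rewrite map_nth_iota0// take_size.
  rewrite [X in map F X]usE /F {F usE}.
  rewrite -map_comp; congr pm_sum; apply/eq_in_map => i.
  rewrite mem_iota add0n => /andP[_ ni]; rewrite /path_snapshot /= ageE//.
  rewrite (_ : isize _ _ _ = root_sizes w i); last first.
    by apply: agree_sizes; exact: regraft_agree.
  congr (snapshot alpha _ _ _ t); apply/funext => v.
    by apply/funext => j; rewrite /marks_of /branch brE// /alter/= memL.
  rewrite /residual_clock /clocks_of /branch/= /alter memL/=; case: v => [|j v].
    by rewrite eqxx ni -[nth [::] us i]cat0s brE.
  by rewrite brE.
have -> : [set w' | survive (regraft us w w') /\ B (offshoots (regraft us w w'))] =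
    cylinder L V `&` alter L h @^-1` (forest alpha t (root_sizes w) (size us) @^-1` B).
  by rewrite -sE; apply/seteqP; split => w' /=; rewrite oE.
rewrite sE; apply: (alter_law PP_prod) => //; last first.
  rewrite -[X in measurable X]setTI.
  exact: (@measurable_forest _ _ _ _ Omega (fun=> root_sizes w) (fun=> size us) id).
move=> [b u] C /mapP[i]; rewrite mem_iota add0n => /andP[_ ni] [-> ->] mC /=.
have mVC : measurable (V (false, [:: i]) `&` h (false, [:: i]) @^-1` C).
  by apply: measurableI => //; have := mh (false, [:: i]) measurableT _ mC; rewrite setTI.
rewrite !mu_clock//.
have c0 : 0 <= c i.
  have [s0 b0] := fw _ (mem_nth [::] ni).
  by rewrite mulr_ge0 ?powR_ge0// subr_ge0.
apply: (exponential_memoryless QE (c := c i) (B := [set y | C (fun=> y)])) => //.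
exact: (measurable_preimage measurable_constant_seq mC).
Qed.

Lemma measurable_forest_front (B : set (point_measure R)) : measurable B ->
  measurable_fun setT (fun w => PP (forest alpha t (root_sizes w) (size us) @^-1` B)).
Proof.
move=> mB; apply: (@measurable_fun_section _ _ Omega _ Omega PP
  [set ww | B (forest alpha t (root_sizes ww.1) (size us) ww.2)]).
have mf : measurable_fun setT (fun ww : Omega * Omega =>
    forest alpha t (root_sizes ww.1) (size us) ww.2).
  apply: measurable_forest => // i.
  apply: measurable_isize => // v j.
  exact: (measurableT_comp (measurable_marks v j)).
exact: (measurable_preimage mf mB).
Qed.

(** Integrate over the subtrees of us first, the rest of the tree being fixed: then
    A and front are constants and survivors_law computes the integral on the left.
    On the right, the integrand does not depend on the subtrees. *)
Lemma restart_law (A : set Omega) (B : set (point_measure R)) :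
  measurable A -> measurable B ->
  PP [set w | [/\ A (sealed alpha x r us w), front alpha x r us w, survive w & B (offshoots w)]] =
  (\int[PP]_(w in [set w | [/\ A (sealed alpha x r us w), front alpha x r us w & survive w]])
    PP (forest alpha t (root_sizes w) (size us) @^-1` B))%E.
Proof.
move=> mA mB.
pose past w := A (sealed alpha x r us w) /\ front alpha x r us w.
have mpast : measurable [set w | past w].
  apply: measurableI; last exact: measurable_front.
  exact: (measurable_preimage (measurable_sealed alpha x r us) mA).
have pastE w w' : past (regraft us w w') <-> past w.
  rewrite /past sealed_regraft//.
  split=> -[? f]; split=> //; apply: agree_front f => //; first exact: regraft_agree.
  by move=> b z nz; apply/esym; exact: regraft_agree.
set q := fun w => PP (forest alpha t (root_sizes w) (size us) @^-1` B).
have qE w w' : q (regraft us w w') = q w.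
  rewrite /q; suff -> : root_sizes (regraft us w w') = root_sizes w by []; apply/funext => i.
  by apply: agree_sizes; exact: regraft_agree.
have mq : measurable_fun setT q by exact: measurable_forest_front.
have q0 w : (0 <= q w)%E by exact: measure_ge0.
have mbig : measurable [set w | [/\ A (sealed alpha x r us w), front alpha x r us w, survive w & B (offshoots w)]].
  rewrite (_ : [set w | _] = [set w | past w] `&` [set w | survive w] `&` offshoots @^-1` B).
    apply: measurableI; first by apply: measurableI => //; exact: measurable_survive.
    exact: measurable_preimage measurable_offshoots mB.
  by apply/seteqP; split => w /=; [move=> []|move=> [[[]]]].
have mE : measurable [set w | [/\ A (sealed alpha x r us w), front alpha x r us w & survive w]].
  rewrite (_ : [set w | _] = [set w | past w] `&` [set w | survive w]).
    by apply: measurableI => //; exact: measurable_survive.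
  by apply/seteqP; split => w /=; [move=> []|move=> [[]]].
have inj1 : {in inner us &, injective (@id (bool * seq nat))} by [].
have inj2 := @replant_inj us.
rewrite (probability_recombine PP_prod inj1 inj2)//.
set E := [set w | _] in mE *.
rewrite [RHS]integral_mkcond.
transitivity (\int[PP]_w (q w * (\1_E w)%:E))%E; last first.
  by apply: eq_integral => w _; rewrite /patch indicE; case: (w \in E); rewrite ?mule1 ?mule0.
rewrite [RHS](integral_recombine PP_prod inj1 inj2)//; last 2 first.
- apply: emeasurable_funM => //; apply/measurable_EFinP; exact: measurable_indic.
- by move=> w; rewrite mule_ge0// lee_fin.
apply: eq_integral => w _.
rewrite -/(regraft us w).
have mS : measurable [set w' | survive (regraft us w w')].
  have mr : measurable_fun setT (regraft us w).
    apply: measurable_to_product_space => k; rewrite /regraft /recombine.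
    by case: (inner us k) => //; exact: measurable_coordinate.
  exact: (measurable_preimage mr measurable_survive).
have [pw|npw] := pselect (past w); last first.
  rewrite (_ : [set w' | _] = set0); last first.
    by apply/seteqP; split => w' //= -[? ? _ _]; apply: npw; apply/(pastE w w').
  rewrite measure0; apply/esym; apply: integral0_eq => w' _.
  rewrite indicE memNset ?mule0// => -[? ? _]; apply: npw; exact/(pastE w w').
transitivity (PP [set w' | survive (regraft us w w')] * q w)%E.
  rewrite -survivors_law//; last by case: pw.
  congr (PP _); apply/seteqP; split => w' /=; first by move=> [].
  by move=> []; have [] := iffRL (pastE w w') pw.
transitivity (\int[PP]_w' (q w * (\1_[set w' | survive (regraft us w w')] w')%:E))%E.
  rewrite ge0_integralZl//; last first.
    by apply/measurable_EFinP; exact: measurable_indic.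
  by rewrite integral_indic// setIT muleC.
apply: eq_integral => w' _; rewrite -(qE w w'); congr (_ * (_ : R)%:E)%E.
rewrite !indicE; congr (_%:R : R); congr nat_of_bool; apply/idP/idP; rewrite !inE.
  by move=> ?; have [] := iffRL (pastE w w') pw.
by move=> [].
Qed.

End restart.

(** * The Markov property of the random tree *)

(** An event generated by the variables Y i cannot separate two samples at which
    all of these variables coincide. *)
Lemma sigma_of_transfer (Omega I : Type) d (T : measurableType d) (D : set I)
    (Y : I -> Omega -> T) (w w' : Omega) (A : set Omega) :
  (forall i, D i -> Y i w = Y i w') -> sigma_of D Y A -> A w <-> A w'.
Proof.
move=> YE.
apply: (smallest_sub (C := sigma_algebra setT) (X := [set A | A w <-> A w'])).
  split => //= [B h|F h]; first by rewrite /setD /=; tauto.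
  by split=> -[k _ Fk]; exists k => //; apply/(h k).
by move=> B [i Di [C mC <-]] /=; rewrite (YE i Di).
Qed.

Section markov_property.
Context {R : realType}.
Local Notation Omega := (tree_space R).
Variables (mu : bool -> probability (mark_space R) R) (PP : probability Omega R).
Hypothesis PP_prod : product_law (fun k => mu k.1) PP.
Variable Q : probability R R.
Hypothesis QE : forall B, measurable B -> Q B = exponential_prob 1 B.
Hypothesis mu_clock : forall A, measurable A -> mu false A = Q [set y | A (fun=> y)].
Hypothesis WB : {ae PP, forall w, well_behaved (marks_of w) (clocks_of w)}.
Variables (alpha x r t : R).
Hypotheses (alpha0 : 0 <= alpha) (x0 : 0 < x) (r0 : 0 <= r) (t0 : 0 <= t).
Variables (A : set Omega) (B : set (point_measure R)).
Hypotheses (mA : measurable A) (mB : measurable B).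
Hypothesis pastA : sigma_of [set q : R | 0 <= q <= r] (path_snapshot alpha x) A.

Let living (w : Omega) := alive alpha x (marks_of w) (clocks_of w) r.
Let E (S : {fset seq nat}) : set Omega := [set w | living w = [set` S]].

Let mE S : measurable (E S).
Proof.
by apply: measurable_random_set_eq => u; exact: measurable_tree_alive.
Qed.

Let mX q : measurable_fun setT (path_snapshot alpha x q : Omega -> point_measure R).
Proof. exact: (@measurable_path_snapshot _ _ _ Omega (fun=> x) q id). Qed.

Let mXB : measurable (path_snapshot alpha x (t + r) @^-1` B).
Proof. exact: measurable_preimage (mX _) mB. Qed.

Let f w := forest_law PP alpha t (path_snapshot alpha x r w) B.

Let mf : measurable_fun setT f.
Proof. exact: (measurableT_comp (measurable_forest_law PP alpha t mB) (mX r)). Qed.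

Let f0 w : (0 <= f w)%E. Proof. exact: measure_ge0. Qed.

(** On the event E S, the past A can be replaced by its value at sealed w, and the
    population at time t + r by offshoots; restart_law then applies, and its right
    hand side is the law of the forest planted at the atoms of the population at
    time r, up to the order of the trees. *)
Let markov_on_antichain (S : {fset seq nat}) : antichain S ->
  PP (A `&` E S `&` path_snapshot alpha x (t + r) @^-1` B) =
  (\int[PP]_(w in A `&` E S) f w)%E.
Proof.
move=> Santi; have Suniq := fset_uniq S.
have key w : well_behaved (marks_of w) (clocks_of w) -> (A `&` E S) w <->
    [/\ A (sealed alpha x r S w), front alpha x r S w & survive alpha x r S w].
  move=> [xi0 _ e0 _ _].
  have AE : E S w -> (A w <-> A (sealed alpha x r S w)).
    move=> ESw; apply: sigma_of_transfer pastA => q /= q0r.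
    by apply/esym; exact: sealed_snapshot.
  split=> [[Aw ESw]|[Aw fw sw]].
    by have [? ?] := iffLR (front_alive alpha x r S e0) ESw; split => //; exact/AE.
  have ESw : E S w by apply/(front_alive alpha x r S e0).
  by split => //; exact/AE.
have sizesE w : E S w -> path_snapshot alpha x r w =
    pm_of_seq [seq isize x (marks_of w) u | u <- S].
  move=> ESw; rewrite /path_snapshot snapshot_finite -/(living w) ESw ?set_fsetK//.
have gt0 w : E S w -> all (fun a => 0 < a) [seq isize x (marks_of w) u | u <- S].
  move=> ESw; apply/allP => _ /mapP[u uS ->].
  by have /aliveP[] : living w u by rewrite ESw.
have fE w : E S w -> f w = PP (forest alpha t (root_sizes x S w) (size S) @^-1` B).
  move=> ESw; have nE : natoms (path_snapshot alpha x r w) = size S.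
    by rewrite sizesE// natoms_of_seq ?gt0// size_map.
  rewrite /f forest_lawE nE; apply: (forest_law_perm PP_prod) => //.
  have := perm_ratom (path_snapshot alpha x r w); rewrite nE => /perm_trans; apply.
  rewrite sizesE// (perm_trans (perm_atoms_of_seq (gt0 _ ESw)))//.
  by rewrite [X in perm_eq _ X](map_comp (isize x (marks_of w)) (nth [::] S))
    map_nth_iota0// take_size.
have xgt0 w : well_behaved (marks_of w) (clocks_of w) -> E S w ->
    path_snapshot alpha x (t + r) w = offshoots alpha x r t S w.
  move=> wb ESw; have [xi0 _ e0 _ _] := wb.
  apply: snapshot_add => //; first exact: ltW.
  exact: well_behaved_finite.
pose C := [set w | [/\ A (sealed alpha x r S w), front alpha x r S w & survive alpha x r S w]].
have mAS : measurable (A \o sealed alpha x r S).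
  exact: (measurable_preimage (measurable_sealed alpha x r S) mA).
have mC : measurable C.
  rewrite (_ : C = (A \o sealed alpha x r S) `&` [set w | front alpha x r S w] `&`
      [set w | survive alpha x r S w]).
    apply: measurableI; last exact: measurable_survive.
    by apply: measurableI => //; exact: measurable_front.
  by apply/seteqP; split => w /= [] // [].
transitivity (PP [set w | [/\ A (sealed alpha x r S w), front alpha x r S w,
    survive alpha x r S w & B (offshoots alpha x r t S w)]]).
  apply: probability_ae_eq.
  - by apply: measurableI => //; exact: measurableI.
  - rewrite (_ : [set w | _] = C `&` offshoots alpha x r t S @^-1` B).
      by apply: measurableI => //; exact: measurable_preimage (measurable_offshoots _ _ _ _ _) mB.
    by apply/seteqP; split => w /= [] // [].
  - apply: filterS WB => w wb; split.
      move=> [AE]; have [? ? ?] := iffLR (key w wb) AE.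
      by rewrite /= (xgt0 w wb AE.2).
    move=> [h1 h2 h3 h4]; have AE : (A `&` E S) w by apply/(key w wb).
    by split => //=; rewrite (xgt0 w wb AE.2).
transitivity (\int[PP]_(w in C) PP (forest alpha t (root_sizes x S w) (size S) @^-1` B))%E.
  exact: (restart_law PP_prod QE).
rewrite integral_mkcond [RHS]integral_mkcond.
apply: ge0_ae_eq_integral => //.
- apply/(measurable_restrictT _ mC); apply: measurable_funTS.
  exact: measurable_forest_front.
- apply/(measurable_restrictT _ (measurableI _ _ mA (mE S))); exact: measurable_funTS.
- by move=> w _; rewrite erestrict_ge0.
- by move=> w _; rewrite erestrict_ge0.
apply: filterS WB => w wb _; rewrite /patch.
case: (boolP (w \in A `&` E S)) => AE.
  have AE' := set_mem AE; rewrite mem_set ?(fE w AE'.2)//; exact/(key w wb).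
rewrite memNset// => Cw; move/negP: AE; apply; apply/mem_set/(key w wb).
exact: Cw.
Qed.

Let markov_on (S : {fset seq nat}) :
  PP (A `&` E S `&` path_snapshot alpha x (t + r) @^-1` B) =
  (\int[PP]_(w in A `&` E S) f w)%E.
Proof.
have [|nS] := pselect (antichain S); first exact: markov_on_antichain.
have mAE : measurable (A `&` E S) by exact: measurableI.
have AE0 : PP (A `&` E S) = 0%E.
  rewrite -(measure0 PP); apply: probability_ae_eq => //.
  apply: filterS WB => w [_ _ e0 _ _]; split => // -[_ ESw]; apply: nS => u v uS vS.
  have al z : z \in S -> living w z by rewrite ESw.
  exact: (alive_antichain e0 (al u uS) (al _ vS)).
rewrite null_set_integral//; last exact: measurable_funTS.
apply/eqP; rewrite eq_le measure_ge0 andbT -AE0; apply: le_measure; rewrite ?inE//.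
  exact: measurableI.
Qed.

(** There are countably many possible values S for the set of individuals alive at
    time r, which is almost surely finite. *)
Theorem tree_markov :
  PP (A `&` path_snapshot alpha x (t + r) @^-1` B) =
  (\int[PP]_(w in A) forest_law PP alpha t (path_snapshot alpha x r w) B)%E.
Proof.
pose F k : set Omega := if choice.pickle_inv k is Some S0 then E S0 else set0.
have mF k : measurable (F k) by rewrite /F; case: choice.pickle_inv.
have tF : trivIset setT F.
  move=> i j _ _ [w []]; rewrite /F.
  case Ei : (choice.pickle_inv i) => [S|//]; case Ej : (choice.pickle_inv j) => [S'|//] e e'.
  have SS' : S = S'.
    apply/fsetP => u; apply/idP/idP => uS.
      have lu : living w u by rewrite e. by move: lu; rewrite e'.
    have lu : living w u by rewrite e'. by move: lu; rewrite e.
  have := @choice.pickle_invK {fset seq nat} i; have := @choice.pickle_invK {fset seq nat} j.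
  by rewrite Ei Ej SS' /= => -> ->.
have fin : {ae PP, forall w, (\bigcup_k F k) w}.
  apply: filterS WB => w wb.
  have /finite_fsetP[S SE] := well_behaved_finite r alpha0 x0 wb.
  by exists (choice.pickle S) => //; rewrite /F choice.pickleK_inv.
have mU : measurable (\bigcup_k F k) by exact: bigcup_measurable.
have tAF G : trivIset setT (fun k => G `&` F k).
  by move=> i j _ _ [w [[_ ?] [_ ?]]]; apply: (tF i j) => //; exists w.
transitivity (PP (\bigcup_k (A `&` path_snapshot alpha x (t + r) @^-1` B `&` F k))).
  apply: probability_ae_eq; first exact: measurableI.
    by apply: bigcup_measurable => k _; apply: measurableI => //; exact: measurableI.
  apply: filterS fin => w [k _ Fk]; split=> [AX|[j _ []]//]; by exists k.
rewrite measure_semi_bigcup//; last 2 first.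
  by move=> k; apply: measurableI => //; exact: measurableI.
  by apply: bigcup_measurable => k _; apply: measurableI => //; exact: measurableI.
transitivity (\int[PP]_(w in \bigcup_k (A `&` F k)) f w)%E; last first.
  have mAU : measurable (\bigcup_k (A `&` F k)).
    by apply: bigcup_measurable => k _; exact: measurableI.
  rewrite integral_mkcond [RHS]integral_mkcond; apply: ge0_ae_eq_integral => //.
  - by apply/(measurable_restrictT _ mAU); exact: measurable_funTS.
  - by apply/(measurable_restrictT _ mA); exact: measurable_funTS.
  - by move=> w _; rewrite erestrict_ge0.
  - by move=> w _; rewrite erestrict_ge0.
  apply: filterS fin => w [k _ Fk] _; rewrite /patch.
  rewrite (_ : (w \in _) = (w \in A))//; apply/idP/idP; rewrite !inE.
    by move=> [j _ []].
  by exists k.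
rewrite ge0_integral_bigcup//; last 2 first.
- by move=> k; exact: measurableI.
- exact: measurable_funTS.
apply: eq_eseriesr => k _; rewrite -setIA [X in _ `&` X]setIC setIA /F.
case: choice.pickle_inv => [S|]; first exact: markov_on.
by rewrite setI0 set0I measure0 integral_set0.
Qed.

End markov_property.

(** * The law of the marked tree *)

Section sigma_of_tools.
Context (I : Type) d' (E : measurableType d').

Lemma sigma_of_comp d (T : measurableType d) d1 (S : measurableType d1) (D : set I)
    (Y : I -> S -> E) (h : T -> S) (A : set T) :
  sigma_of D (fun i => Y i \o h) A -> exists2 C, sigma_of D Y C & A = h @^-1` C.
Proof.
apply: (smallest_sub (C := sigma_algebra setT)
  (X := [set A | exists2 C, sigma_of D Y C & A = h @^-1` C])) => /=; last first.
  move=> B [i Di [C mC <-]]; exists (Y i @^-1` C); last by rewrite setTI.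
  by apply: sub_sigma_algebra; exists i => //; exists C; rewrite ?setTI.
have sC : sigma_algebra setT (sigma_of D Y) by exact: smallest_sigma_algebra.
have [s0 sD sU] := sC; split.
- by exists set0 => //; rewrite preimage_set0.
- move=> B [C sCC ->]; exists (setT `\` C); first exact: sD.
  by rewrite !setTD preimage_setC.
- move=> F HF.
  have /choice[C HC] : forall n, exists C, sigma_of D Y C /\ F n = h @^-1` C.
    by move=> n; have [C ? ?] := HF n; exists C.
  exists (\bigcup_k C k); first by apply: sU => n; have [] := HC n.
  by rewrite preimage_bigcup; apply: eq_bigcupr => k _; have [_ ->] := HC k.
Qed.

Context d (T : measurableType d).

Lemma sigma_of_measurable (D : set I) (Y : I -> T -> E) (A : set T) :
  (forall i, measurable_fun setT (Y i)) -> sigma_of D Y A -> measurable A.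
Proof.
move=> mY; apply: (smallest_sub (C := sigma_algebra setT)); first exact: sigma_algebra_measurable.
by move=> _ [i _ [C mC <-]]; exact: mY.
Qed.

(** T with the sigma-algebra generated by Y: membership in sigma_of becomes a
    statement of measurability on this space. *)
Definition generated_space (Y : I -> T -> E) := g_sigma_algebraType
  (\bigcup_(i in [set: I]) preimage_set_system [set: T] (Y i) measurable).

HB.instance Definition _ Y := Measurable.on (generated_space Y).

Lemma measurable_generated (Y : I -> T -> E) i :
  @measurable_fun _ _ (generated_space Y) E setT (Y i).
Proof. by move=> _ B mB; apply: sub_sigma_algebra; exists i => //; exists B. Qed.

End sigma_of_tools.

Section marked_tree.
Context {R : realType} d (T : measurableType d) (P : probability T R).
Variables (nu : probability (point_measure R) R)
  (xi : seq nat -> nat -> {RV P >-> R}) (e : seq nat -> {RV P >-> R}).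
Hypothesis xi_e : marks nu xi e.

Definition realized_tree (w : T) : tree_space R :=
  fun k => if k.1 then (fun i => xi k.2 i w) else (fun=> e k.2 w).

Definition mark_seq u (w : T) : mark_space R := fun i => xi u i w.
Definition clock_seq u (w : T) : mark_space R := fun=> e u w.

Lemma measurable_mark_seq u : measurable_fun setT (mark_seq u).
Proof. by apply: measurable_to_product_space => i; exact: measurable_funPT. Qed.

Lemma measurable_clock_seq u : measurable_fun setT (clock_seq u).
Proof. by apply: measurable_to_product_space => i; exact: measurable_funPT. Qed.

Lemma measurable_realized_tree : measurable_fun setT realized_tree.
Proof.
apply: measurable_to_product_space => -[[] u].
  exact: measurable_mark_seq.
exact: measurable_clock_seq.
Qed.

Definition tree_law : probability (tree_space R) R :=
  distribution P (mfun_of measurable_realized_tree).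

Definition root_seq (b : bool) := if b then mark_seq [::] else clock_seq [::].

Lemma measurable_root_seq b : measurable_fun setT (root_seq b).
Proof. by case: b; [exact: measurable_mark_seq|exact: measurable_clock_seq]. Qed.

Definition mark_law (b : bool) : probability (mark_space R) R :=
  distribution P (mfun_of (measurable_root_seq b)).

Definition clock_law : probability R R := distribution P (e [::]).

Lemma sigma_of_mark_seq u (A : set (mark_space R)) : measurable A ->
  sigma_of [set: nat] (xi u) (mark_seq u @^-1` A).
Proof.
move=> mA.
have mm : @measurable_fun _ _ (generated_space (fun i => xi u i : T -> R)) (mark_space R)
    setT (mark_seq u).
  by apply: measurable_to_product_space => i; exact: (@measurable_generated _ _ _ _ T (fun i => xi u i : T -> R) i).
exact: (measurable_preimage mm mA).
Qed.

Lemma clock_seq_preimage (A : set (mark_space R)) : measurable A ->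
  measurable [set y : R | A (fun=> y)].
Proof.
move=> mA; exact: (measurable_preimage measurable_constant_seq mA).
Qed.

Lemma mark_lawE (b : bool) u (A : set (mark_space R)) : measurable A ->
  P (realized_tree @^-1` [set w | A (w (b, u))]) = mark_law b A.
Proof.
have [[_ same] _ eE _ _] := xi_e.
move=> mA; case: b; first exact: (same u [::] A mA).
have mA' := clock_seq_preimage mA.
change (distribution P (e u) [set y | A (fun=> y)] = distribution P (e [::]) [set y | A (fun=> y)]).
by rewrite !eE.
Qed.

(** A cylinder splits into its conditions on marks and those on clocks, which are
    independent of each other; each part splits by the independence of the
    litters, respectively of the clocks. *)
Lemma tree_law_product : product_law (fun k => mark_law k.1) tree_law.
Proof.
have [_ ixi _ ie ixe] := xi_e.
move=> s A us mA.
pose J (b : bool) : {fset seq nat} := [fset k.2 | k in [seq k <- s | k.1 == b]]%fset.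
pose F b u := realized_tree @^-1` [set w | A (b, u) (w (b, u))].
have memJ b u : (u \in J b) = ((b, u) \in s).
  apply/imfsetP/idP => /= [[[b' u']]|bs]; first by rewrite mem_filter/= => /andP[/eqP -> ?] ->.
  by exists (b, u) => //; rewrite mem_filter eqxx.
transitivity (P (\bigcap_(u in [set` J true]) F true u `&` \bigcap_(u in [set` J false]) F false u)).
  change (P (realized_tree @^-1` cylinder s A) =
    P (\bigcap_(u in [set` J true]) F true u `&` \bigcap_(u in [set` J false]) F false u)).
  congr (P _); apply/seteqP; split => w.
    by move=> H; split => u /=; rewrite memJ => us'; exact: H.
  move=> [h1 h2] [[] u] us'; [apply: (h1 u)|apply: (h2 u)]; by rewrite /= memJ.
rewrite ixe; last 2 first.
- pose G := generated_space (fun ui : seq nat * nat => xi ui.1 ui.2 : T -> R).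
  suff : measurable (\bigcap_(u in [set` J true]) mark_seq u @^-1` A (true, u) : set G) by [].
  apply: fin_bigcap_measurable => // u _.
  have mm : @measurable_fun _ _ G (mark_space R) setT (mark_seq u).
    apply: measurable_to_product_space => i.
    exact: (@measurable_generated _ _ _ _ T (fun ui : seq nat * nat => xi ui.1 ui.2 : T -> R) (u, i)).
  exact: (measurable_preimage mm (mA (true, u))).
- pose G := generated_space (fun u : seq nat => e u : T -> R).
  suff : measurable (\bigcap_(u in [set` J false]) clock_seq u @^-1` A (false, u) : set G) by [].
  apply: fin_bigcap_measurable => // u _.
  have mm : @measurable_fun _ _ G (mark_space R) setT (clock_seq u).
    apply: measurable_to_product_space => i.
    exact: (@measurable_generated _ _ _ _ T (fun u : seq nat => e u : T -> R) u).
  exact: (measurable_preimage mm (mA (false, u))).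
rewrite ixi; last by move=> u _; exact: sigma_of_mark_seq.
rewrite ie; last first.
  move=> u _; exists [set y | A (false, u) (fun=> y)]; first exact: clock_seq_preimage.
  by rewrite setTI.
have prodE b : \prod_(u <- J b) fine (P (F b u)) =
    \prod_(k <- s | k.1 == b) fine (mark_law k.1 (A k)).
  rewrite -[RHS]big_filter [RHS](perm_big [seq (b, u) | u <- J b]); last first.
    apply: uniq_perm; first exact: filter_uniq.
      by rewrite map_inj_uniq ?fset_uniq// => u v [].
    move=> [b' u]; rewrite mem_filter/=; apply/andP/mapP => [[/eqP -> us']|[v vJ [-> ->]]].
      by exists u => //; rewrite memJ.
    by rewrite eqxx -memJ.
  by rewrite big_map; apply: eq_bigr => u _; rewrite mark_lawE.
rewrite !prodE -EFinM; congr EFin.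
rewrite [RHS](bigID (fun k => k.1 == true)) /=; congr (_ * _).
by apply: eq_bigl => -[[] ?].
Qed.

End marked_tree.

(** * Consequences of the assumptions on reproduction *)

Lemma ae_distribution (R : realType) d (T : measurableType d) d' (T' : measurableType d')
    (P : probability T R) (h : {mfun T >-> T'}) (A : T' -> Prop) :
  {ae distribution P h, forall y, A y} -> {ae P, forall w, A (h w)}.
Proof.
move=> [N [mN N0 sN]]; exists (h @^-1` N); split => //.
  by apply: measurable_preimage.
by move=> w nA; exact: sN.
Qed.

Section reproduction.
Context {R : realType} d (T : measurableType d) (P : probability T R).
Variables (nu : probability (point_measure R) R)
  (xi : seq nat -> nat -> {RV P >-> R}) (e : seq nat -> {RV P >-> R}).
Hypotheses (xi_e : marks nu xi e).
Local Notation PP := (tree_law xi e).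

(* the index after which the marks vanish *)
Let litter_size u : {n : T -> nat | [/\ measurable_fun [set: T] n,
  forall w i, (i < n w)%N -> 0 < xi u i w, forall w i, (n w <= i)%N -> xi u i w = 0 &
  forall B, measurable B ->
    P ((fun w => pm_of_seq [seq xi u i w | i <- iota 0 (n w)]) @^-1` B) = nu B]}.
Proof. by apply: cid; have [[+ _] _ _ _ _] := xi_e; apply. Qed.

Let n u := sval (litter_size u).

Let mn : measurable_fun setT (n [::]). Proof. by rewrite /n; case: litter_size => ? []. Qed.

Let pos u w i : (i < n u w)%N -> 0 < xi u i w.
Proof. by rewrite /n; case: litter_size => ? [? + ? ?] /=; exact. Qed.

Let zero u w i : (n u w <= i)%N -> xi u i w = 0.
Proof. by rewrite /n; case: litter_size => ? [? ? + ?] /=; exact. Qed.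

Lemma marks_ge0 u i w : 0 <= xi u i w.
Proof. by have [/pos/ltW|/zero ->] := ltnP i (n u w). Qed.

Let child_countE u w : child_count (fun i => xi u i w) (n u w).
Proof. by move=> i; have [/pos ->|/zero ->] := ltnP i (n u w); rewrite ?ltxx. Qed.

Let litter_law B : measurable B ->
  P ((fun w => pm_of_seq [seq xi [::] i w | i <- iota 0 (n [::] w)]) @^-1` B) = nu B.
Proof. by rewrite /n; case: litter_size => ? [? ? ? +] /=; exact. Qed.

Let litter w := pm_of_seq [seq xi [::] i w | i <- iota 0 (n [::] w)].

Let litter_gt0 w : all (fun a => 0 < a) [seq xi [::] i w | i <- iota 0 (n [::] w)].
Proof. by apply/allP => _ /mapP[i + ->]; rewrite mem_iota add0n => /andP[_ /pos]. Qed.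

Let measurable_litter : measurable_fun setT litter.
Proof.
apply: (measurable_fun_nat_case (g := fun m w => pm_of_seq [seq xi [::] i w | i <- iota 0 m])) => // m.
by apply: measurable_pm_of_seq => i; exact: measurable_funPT.
Qed.

Let integral_litter (f : point_measure R -> \bar R) :
  measurable_fun setT f -> (forall s, 0 <= f s)%E ->
  (\int[P]_w f (litter w) = \int[nu]_s f s)%E.
Proof.
move=> mf f0.
rewrite -(eq_measure_integral nu (m1 := distribution P (mfun_of measurable_litter))).
  by rewrite ge0_integral_distribution.
by move=> A mA _; exact: litter_law.
Qed.

Lemma tree_integral (f : tree_space R -> \bar R) :
  measurable_fun setT f -> (forall w, 0 <= f w)%E ->
  (\int[PP]_w f w = \int[P]_w f (realized_tree xi e w))%E.
Proof. by move=> mf f0; rewrite /tree_law ge0_integral_distribution. Qed.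

Lemma mean_powers_moment p : 0 < p ->
  (\int[PP]_w \sum_(0 <= i <oo) (`|marks_of w [::] i| `^ p)%:E = moment nu p)%E.
Proof.
move=> p0; rewrite tree_integral; last 2 first.
- apply: ge0_emeasurable_sum => // i _; apply/measurable_EFinP.
  apply: (measurableT_comp (measurable_powR p)).
  by apply: measurableT_comp => //; exact: measurable_marks.
- by move=> w; apply: nneseries_ge0 => i _; rewrite lee_fin powR_ge0.
rewrite /moment -integral_litter; last 2 first.
- by apply/measurable_EFinP; exact: measurable_pm_int_powR.
- by move=> s; rewrite lee_fin sumr_ge0// => i _; exact: powR_ge0.
apply: eq_integral => w _; rewrite pm_int_of_seq// big_map.
rewrite (nneseries_split 0 (n [::] w)); last by move=> k _; rewrite lee_fin powR_ge0.
rewrite eseries0 ?adde0.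
  rewrite add0n -sumEFin /index_iota subn0; apply: eq_bigr => i _.
  by rewrite ger0_norm ?marks_ge0.
move=> i; rewrite add0n => ni _.
by rewrite /marks_of /realized_tree/= zero// normr0 powR0// gt_eqF.
Qed.

Lemma progeny_offspring u : 0 <= u <= 1 -> progeny_gf PP u = offspring_gf nu u.
Proof.
move=> /[dup] u01 /andP[u0 _].
rewrite -[LHS]/(fine _%:E) progeny_gfE// /offspring_gf; congr fine.
have mu : measurable_fun setT (fun m : nat => u ^+ m) by [].
rewrite tree_integral; last 2 first.
- apply/measurable_EFinP; apply: (measurableT_comp mu).
  apply: (measurableT_comp (measurable_kids (R := R))).
  exact: (@measurable_coordinate _ _ (mark_space R) (true, [::])).
- by move=> w; rewrite lee_fin exprn_ge0.
rewrite -integral_litter; last 2 first.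
- by apply/measurable_EFinP; exact: (measurableT_comp mu measurable_natoms).
- by move=> s; rewrite lee_fin exprn_ge0.
apply: eq_integral => w _.
by rewrite natoms_of_seq// size_map size_iota (kidsE (child_countE [::] w)).
Qed.

Let full (A : set (tree_space R)) : (forall w, A (realized_tree xi e w)) -> PP A = 1%E.
Proof.
move=> HA; transitivity (P setT); last exact: probability_setT.
change (P (realized_tree xi e @^-1` A) = P setT); congr (P _).
by apply/seteqP; split => // w _; exact: HA.
Qed.

Lemma clock_lawE B : measurable B -> clock_law e B = exponential_prob 1 B.
Proof. by have [_ _ eE _ _] := xi_e; exact: eE. Qed.

(** Divergence is assumed for the generating function of nu; on [0, 1] it is
    also that of the tree. *)
Lemma tree_well_behaved p : 0 < p -> moment nu p = 1%E -> non_explosion nu ->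
  {ae PP, forall w, well_behaved (marks_of w) (clocks_of w)}.
Proof.
move=> p0 mp nexp.
apply: (well_behaved_ae (tree_law_product xi_e) (Q := clock_law e) _ _ _ _ p0) => //.
- exact: clock_lawE.
- by apply: full => w; exists (n [::] w); exact: child_countE.
- by apply: full => w i; exact: marks_ge0.
- by rewrite mean_powers_moment// mp.
move=> eps eps0 Heps.
(* an interval of length greater than 1 contains 0, where the generating
   function is not smaller than its argument *)
have [eps1|eps1] := ltP 1 eps.
  have := Heps 0; rewrite ltr01 andbT subr_lt0 => /(_ eps1).
  by rewrite ltNge progeny_gf_ge0.
have u01 u : 1 - eps < u < 1 -> 0 <= u <= 1.
  by move=> /andP[h1 h2]; apply/andP; split; move: h1 h2 eps1; lra.
rewrite -(nexp eps eps0); last first.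
  by move=> u Hu; rewrite -progeny_offspring ?u01// Heps.
apply: eq_integral => u; rewrite inE/= in_itv/= => Hu.
by rewrite progeny_offspring// u01.
Qed.

(** Any zero p of kappa will do: then the p-th moment is 1, and p is positive
    as p is at least p_zero. *)
Lemma malthusian_exponent : malthusian nu -> exists2 p, 0 < p & moment nu p = 1%E.
Proof.
move=> [[p [/andP[lp pu] kp]] z0 _ _]; exists p.
  rewrite -lte_fin (lt_le_trans z0)//; apply: ereal_inf_lbound; exists p => //.
  by split => //; apply/andP.
have m0 : (0 <= moment nu p)%E.
  by apply: integral_ge0 => s _; rewrite lee_fin sumr_ge0// => i _; exact: powR_ge0.
have mfin : (moment nu p < +oo)%E.
  rewrite ltey; apply/eqP => mE; move: pu; rewrite ltNge => /negP; apply.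
  by apply: ereal_inf_lbound; exists p.
have mpm : measurable_fun setT (pm_int (fun x : R => x `^ p)) by exact: measurable_pm_int_powR.
have ip : nu.-integrable setT (EFin \o pm_int (fun x : R => x `^ p)).
  apply/integrableP; split; first exact/measurable_EFinP.
  apply: le_lt_trans mfin; rewrite le_eqVlt; apply/orP; left; apply/eqP.
  by apply: eq_integral => s _ /=; rewrite ger0_norm// sumr_ge0// => i _; exact: powR_ge0.
have i1 : nu.-integrable setT (EFin \o cst (1 : R)).
  by apply: finite_measure_integrable_cst.
have : (1 - moment nu p = 0)%E.
  rewrite -kp /kappa /moment.
  transitivity (\int[nu]_s ((cst 1 s)%:E - (pm_int (fun y : R => y `^ p) s)%:E))%E.
    by rewrite (integralB_EFin _ i1 ip)//; congr (_ - _)%E; rewrite integral_constant.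
  by apply: eq_integral => s _; rewrite -EFinB.
move: m0 mfin; case: (moment nu p) => // m _ _ /eqP.
by rewrite -EFinB eqe subr_eq0 => /eqP <-.
Qed.

End reproduction.

(** * The process *)

Section process_law.
Context {R : realType} (alpha : R) (nu : probability (point_measure R) R)
  d (T : measurableType d) (P : probability T R)
  (xi : seq nat -> nat -> {RV P >-> R}) (e : seq nat -> {RV P >-> R}).
Hypotheses (alpha0 : 0 <= alpha) (xi_e : marks nu xi e).
Local Notation PP := (tree_law xi e).
Hypothesis WB : {ae PP, forall w, well_behaved (marks_of w) (clocks_of w)}.

Let mtree : measurable_fun setT (realized_tree xi e).
Proof. exact: measurable_realized_tree. Qed.

Let mpath x t : measurable_fun setT (path_snapshot alpha x t : tree_space R -> _).
Proof. exact: (@measurable_path_snapshot _ _ _ (tree_space R) (fun=> x) t id). Qed.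

Let mX x t : measurable_fun setT (X alpha xi e x t).
Proof. exact: (measurableT_comp (mpath x t) mtree). Qed.

Lemma process_finite_valued : finite_valued alpha xi e.
Proof.
move=> x x0; split=> [|t _]; last exact: mX.
apply: filterS (ae_distribution WB) => w wb t t0.
by apply/is_point_measure_population; exact: well_behaved_finite wb.
Qed.

Lemma process_scaling : scaling alpha xi e.
Proof.
move=> c c0 B _; congr (P _); congr (_ @^-1` B); apply/funext => w; apply/funext => t.
have := @snapshot_scale R alpha c 1 (fun u i => xi u i w) (fun u => e u w) t c0.
by rewrite mulr1 => <- // u i; exact: marks_ge0 xi_e _ _ _.
Qed.

(** The independent processes are found on the space of trees itself, as the
    branches at the first children of the root. *)
Lemma forest_indep_sum t (l : seq R) : all (fun a => 0 < a) l ->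
  indep_sum_law (fun (i : 'I_(size l)) B => P (X alpha xi e l`_i t @^-1` B))
    (forest_kernel PP alpha t (pm_of_seq l)).
Proof.
move=> l0.
have mY (i : nat) : measurable_fun setT (fun w : tree_space R => path_snapshot alpha l`_i t (branch [:: i] w)).
  by apply: measurable_path_snapshot => //; exact: measurable_branch.
exists _, (tree_space R), PP, (fun i : 'I_(size l) => mfun_of (mY i)); split.
- move=> J A HA.
  have /choice[B HB] : forall i : 'I_(size l), exists B, measurable B /\
      (i \in J -> A i = (fun w => path_snapshot alpha l`_i t (branch [:: i : nat] w)) @^-1` B).
    move=> i; have [iJ|iJ] := boolP (i \in J); last by exists set0; split.
    have [B mB <-] := HA i iJ; exists B; split => // _; by rewrite setTI.
  transitivity (PP (\bigcap_(i in [set` J])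
      (fun w => path_snapshot alpha l`_i t (branch [:: i : nat] w)) @^-1` B i)).
    congr (PP _); apply: eq_bigcapr => i iJ; exact: (HB i).2.
  rewrite (forest_indep (tree_law_product xi_e) alpha t (fun i => l`_i)); last by move=> i; exact: (HB i).1.
  by congr EFin; apply: eq_big_seq => i iJ; rewrite (HB i).2.
- move=> i B mB.
  have mB' : measurable (path_snapshot alpha l`_i t @^-1` B).
    exact: (measurable_preimage (mpath l`_i t) mB).
  exact/esym/(branch_law (tree_law_product xi_e) [:: i : nat] mB').
- move=> B mB.
  change (PP ((fun w => pm_sum [seq path_snapshot alpha l`_(nat_of_ord i) t (branch [:: nat_of_ord i] w)
      | i <- enum 'I_(size l)]) @^-1` B) =
    forest_law PP alpha t (pm_of_seq l) B).
  rewrite forest_lawE natoms_of_seq//.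
  rewrite (forest_law_perm (tree_law_product xi_e) _ _ (y := fun i => l`_i))//; last first.
    have := perm_ratom (pm_of_seq l); rewrite natoms_of_seq// => /perm_trans; apply.
    by rewrite map_nth_iota0// take_size; exact: perm_atoms_of_seq.
  by congr (PP _); apply/seteqP; split => w /=; rewrite /forest -val_enum_ord -map_comp.
Qed.

(** The past of the process is the inverse image of an event on the space of
    trees, where tree_markov applies. *)
Lemma process_markov t x r (B : set (point_measure R)) (A : set T) :
  0 <= t -> 0 < x -> 0 <= r -> measurable B ->
  sigma_of [set q : R | 0 <= q <= r] (X alpha xi e x) A ->
  P (A `&` X alpha xi e x (t + r) @^-1` B) =
  (\int[P]_(w in A) forest_law PP alpha t (X alpha xi e x r w) B)%E.
Proof.
move=> t0 x0 r0 mB.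
move=> /(@sigma_of_comp _ _ _ _ _ _ _ _ (path_snapshot alpha x) (realized_tree xi e))[C sC ->].
have mC : measurable C by apply: sigma_of_measurable sC => q; exact: mpath.
have mQ : measurable_fun setT (fun w => forest_law PP alpha t (path_snapshot alpha x r w) B).
  exact: (measurableT_comp (measurable_forest_law PP alpha t mB) (mpath x r)).
transitivity (PP (C `&` path_snapshot alpha x (t + r) @^-1` B)); first by [].
rewrite (tree_markov (tree_law_product xi_e) (Q := clock_law e) _ _ WB)//; last exact: clock_lawE xi_e.
rewrite integral_mkcond tree_integral; last 2 first.
- by apply/(measurable_restrictT _ mC); exact: measurable_funTS.
- by move=> w; rewrite erestrict_ge0.
rewrite [RHS]integral_mkcond; apply: eq_integral => w _.
by rewrite /patch; congr (if _ then _ else _); apply/idP/idP; rewrite !inE.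
Qed.

Lemma process_branching_markov : branching_markov alpha xi e.
Proof.
move=> t t0; exists (forest_kernel PP alpha t); split; first exact: forest_indep_sum.
move=> x r x0 r0.
have sG : g_sigma_algebra_preimage (X alpha xi e x r) `<=`
    sigma_of [set q : R | 0 <= q <= r] (X alpha xi e x).
  by move=> A HA; apply: sub_sigma_algebra; exists r => //=; rewrite r0 lexx.
have sK B : measurable B -> g_sigma_algebra_preimage
    (fun w => forest_kernel PP alpha t (X alpha xi e x r w) B) `<=`
    g_sigma_algebra_preimage (X alpha xi e x r).
  move=> mB _ [C mC <-]; exists ((fun s => forest_kernel PP alpha t s B) @^-1` C) => //.
  exact: (measurable_preimage (measurable_forest_law PP alpha t mB) mC).
split=> B mB; split.
- exact: sK.
- by move=> A /sG; exact: process_markov.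
- exact: subset_trans (sK B mB) sG.
- by move=> A; exact: process_markov.
Qed.

End process_law.

Theorem theorem2 (R : realType) (alpha : R)
    (nu : probability (point_measure R) R)
    (d : measure_display) (T : measurableType d) (P : probability T R)
    (xi : seq nat -> nat -> {RV P >-> R}) (e : seq nat -> {RV P >-> R}) :
  0 <= alpha -> malthusian nu -> non_explosion nu -> marks nu xi e ->
  [/\ finite_valued alpha xi e,
      branching_markov alpha xi e &
      scaling alpha xi e].
Proof.
move=> alpha0 /malthusian_exponent[p p0 mp] nexp xi_e.
have WB := tree_well_behaved xi_e p0 mp nexp.
split.
- exact: process_finite_valued alpha0 WB.
- exact: process_branching_markov alpha0 xi_e WB.
- exact: process_scaling xi_e.
Qed.
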